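(* Let $\alpha\geq 0$. For all $0<\beta<1$ and for all $n$ large enough such that $n\alpha\notin\pi\mathbb Z$, we have $$\left|\frac{\mathbb E\left[\mathcal N(f_n,[0,2\pi])\right]}{n}-\ell^\alpha(n\alpha\ \mathrm{mod}\ \pi)\right|=O\left(\frac{1}{n^{\beta}(1-|\cos(n\alpha)|)^2}\right)+o(1),$$ where $O$ and $o$ refer to $n\to+\infty$ along the integers $n$ with $n\alpha\notin\pi\mathbb Z$, for fixed $\alpha$ and $\beta$.
   Context: Let $\alpha\ge 0$ be real. Let $(a_k)_{k\ge1}$ and $(b_k)_{k\ge1}$ be two independent (centered) stationary Gaussian processes with $\mathbb E[a_ka_l]=\mathbb E[b_kb_l]=\cos((k-l)\alpha)$ and $\mathbb E[a_kb_l]=0$ for all $k,l\ge1$. For $n\ge 1$ and $t\in\mathbb R$ set $f_n(t)=\frac{1}{\sqrt n}\sum_{k=1}^n\big(a_k\cos(kt)+b_k\sin(kt)\big)$. $\mathcal N(f_n,[0,2\pi])$ denotes the number of real zeros of $f_n$ in $[0,2\pi]$. For $x\in(0,\pi)$ define $$g_x^\alpha(s,u)=\frac{\sin(x)\sin\left(\frac{s-\alpha}{2}\right)\sin\left(\frac{s+\alpha}{2}\right)}{\sin^2\left(\frac{u-x}{2}\right)\sin^2\left(\frac{s+\alpha}{2}\right)+\sin^2\left(\frac{u+x}{2}\right)\sin^2\left(\frac{s-\alpha}{2}\right)},$$ $$\ell^\alpha(x)=\frac{1}{4\pi^2}\int_{[0,2\pi]^2}\sqrt{1+|g_x^\alpha(s,u)|^2}\,ds\,du$$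 (the integrand is defined almost everywhere). For $n\alpha\notin\pi\mathbb Z$, $n\alpha\ \mathrm{mod}\ \pi$ denotes the representative in $(0,\pi)$ of $n\alpha$ modulo $\pi$. *)

(* Defs.v *)
From HB Require Import structures.
From mathcomp Require Import all_boot all_order all_algebra.
From mathcomp Require Import all_classical all_reals all_analysis.

Set Implicit Arguments.
Unset Strict Implicit.
Unset Printing Implicit Defensive.

Import Order.TTheory GRing.Theory Num.Theory.
Import numFieldNormedType.Exports.

Local Open Scope classical_set_scope.
Local Open Scope ring_scope.

(* Processes (X_k)_{k >= 1} are encoded as functions on nat; the value at
   index 0 is never used. *)

Section processes.
Context (d : measure_display) (Omega : measurableType d) (R : realType)
  (P : probability Omega R).
Implicit Types X Y : nat -> {RV P >-> R}.

(* Degenerate Gaussian laws (point masses) are allowed, which is essential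
   for the covariance cos((k - l) alpha), of rank at most 2.  They are treated
   separately because [normal_prob m 0] is the uniform law on [0, 1] in the
   library. *)
Definition gaussian (Z : Omega -> R) : Prop :=
  exists m s : R, forall A : set R, measurable A ->
    P (Z @^-1` A) = (if s == 0 then \d_m A else normal_prob m s A).

Definition gaussian_process X : Prop :=
  forall (m : nat) (c : nat -> R),
    gaussian (fun w => \sum_(1 <= k < m.+1) c k * X k w).

Definition centered X : Prop :=
  forall k, (1 <= k)%N -> ('E_P[X k] = 0)%E.

(* Strict stationarity: the finite-dimensional laws, which are determined by
   their values on measurable rectangles, are invariant under time shifts. *)
Definition stationary X : Prop :=
  forall (m h : nat) (A : nat -> set R), (forall k, measurable (A k)) ->
    P (\bigcap_(k in `[1%N, m]) (X (k + h)%N @^-1` A k)) =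
    P (\bigcap_(k in `[1%N, m]) (X k @^-1` A k)).

Definition process_sigma_algebra X : set_system Omega :=
  <<s \bigcup_(k in [set k : nat | (1 <= k)%N])
        preimage_set_system setT (X k) measurable >>.

Definition independent_processes X Y : Prop :=
  forall A B : set Omega,
    process_sigma_algebra X A -> process_sigma_algebra Y B ->
    P (A `&` B) = (P A * P B)%E.

Definition trig_poly (a b : nat -> {RV P >-> R}) (n : nat) (w : Omega) (t : R)
  : R :=
  (Num.sqrt n%:R)^-1 *
  \sum_(1 <= k < n.+1) (a k w * cos (k%:R * t) + b k w * sin (k%:R * t)).

End processes.

Section zeros_and_limit.
Context {R : realType}.

(* Number of distinct zeros of f in I, +oo if there are infinitely many. *)
Definition num_zeros (f : R -> R) (I : set R) : \bar R :=
  counting [set t | I t /\ f t = 0].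

Definition g (alpha x s u : R) : R :=
  (sin x * sin ((s - alpha) / 2) * sin ((s + alpha) / 2)) /
  (sin ((u - x) / 2) ^+ 2 * sin ((s + alpha) / 2) ^+ 2 +
   sin ((u + x) / 2) ^+ 2 * sin ((s - alpha) / 2) ^+ 2).

(* The denominator of g vanishes only on a null set of points (s, u) when
   0 < x < pi and alpha is not in pi Z; the value of g there (0, by the
   convention on division) is irrelevant to the integral. *)
Definition ell (alpha x : R) : \bar R :=
  (((4 * pi ^+ 2)^-1)%:E *
   \int[lebesgue_measure \x lebesgue_measure]_(z in `[0%R, (2 * pi)%R] `*`
                                                   `[0%R, (2 * pi)%R])
     (Num.sqrt (1 + `|g alpha x z.1 z.2| ^+ 2))%:E)%E.

Definition in_piZ (y : R) : Prop := exists k : int, y = k%:~R * pi.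

(* The representative of y modulo pi in [0, pi[; it lies in ]0, pi[ as soon as
   y is not in pi Z. *)
Definition mod_pi (y : R) : R := y - (Num.floor (y / pi))%:~R * pi.

Definition admissible (alpha : R) : set nat :=
  [set n | ~ in_piZ (n%:R * alpha)].

End zeros_and_limit.

(* Main.v *)
Require Import Defs.
From HB Require Import structures.
From mathcomp Require Import all_boot all_order all_algebra.
From mathcomp Require Import all_classical all_reals all_analysis.
From mathcomp Require Import measurable_realfun.
From mathcomp Require Import ring lra.

Set Implicit Arguments.
Unset Strict Implicit.
Unset Printing Implicit Defensive.

Import Order.TTheory GRing.Theory Num.Theory.
Import numFieldNormedType.Exports.

Local Open Scope classical_set_scope.
Local Open Scope ring_scope.

(** The error tends to 0 uniformly in the position of [n alpha] modulo [pi], so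
    the theorem holds with [h1 = 0].

    The covariance of [f] is explicit: with [D] the Dirichlet kernel centred at
    frequency [(n + 1) / 2] and [v t = (D (t + alpha), D (t - alpha))],
    [E (f t * f u) = cos ((n + 1) (t - u) / 2) <v t, v u> / (2 n)].  Since
    [|v t|^2 >= 1 - |cos (n alpha)| > 0], almost surely all zeros are simple, and
    the number of zeros is the limit of the measures of the sets
    [{t | f t * f (t + h) < 0}] divided by [h].  Sheppard's formula
    [P (f t * f (t + h) < 0) = acos rho / pi] and dominated convergence give
    [E N = (1 / pi) * int sqrt ((n + 1)^2 / 4 + psi'^2)], where [psi'] is the
    angular speed of [v].

    Up to an error which is [O(1 / n)] away from the zeros of
    [sin ((t +- alpha) / 2)], [2 psi' t / n = g (t, n t)] for the function [g] with
    parameter [x = n alpha].  Averaging over the window [t = s + v / n],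
    [0 <= v <= 2 pi], decouples the two arguments of [g]; the Poisson integral
    [int_0^(2 pi) |g (s, u)| du <= 2 pi], uniform in [s] and [x], provides the
    domination. *)

(** * Lebesgue integrals on the line *)

(** The Kac-Rice approach works with the joint density of f and f'; counting sign changes only calls
    for P (f t * f (t + h) < 0), and Sheppard's formula is derived from the one-dimensional laws of
    u f(t) + v f(t') through logarithmic moments, so no bivariate density appears. In the comparison
    with the limit, the obstacle is that g (t, n t) depends on t through a slow and a fast argument,
    with peaks that grow without bound when n alpha comes close to a multiple of pi. A window of
    length exactly 2 pi / n lets the fast argument run over one full period, so the double integral
    in [ell] is recovered exactly by periodicity and only the variation of g in its slow argument
    has to be estimated. As g depends on that argument only through the ratio of two sines, this
    variation is controlled multiplicatively, and a multiplicative error is integrable by the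
    Poisson integral. The error is uniform in n alpha because |D (t + alpha) D (t - alpha)| <= |v
    t|^2 / 2 whatever n alpha is. *)

Section lebesgue_tools.
Context {R : realType}.
Local Notation mu := (@lebesgue_measure R).
Local Open Scope ereal_scope.

(* The integral of a nonnegative function is a supremum over the simple
   functions below it, hence monotone without measurability. *)
Lemma ge0_le_integral_nomeas d (T : measurableType d)
    (m : {measure set T -> \bar R}) (D : set T) (f g : T -> \bar R) :
  (forall x, D x -> 0 <= f x) -> (forall x, D x -> f x <= g x) ->
  \int[m]_(x in D) f x <= \int[m]_(x in D) g x.
Proof.
move=> f0 fg.
have g0 x : D x -> 0 <= g x by move=> Dx; apply: le_trans (fg _ Dx); exact: f0.
rewrite !ge0_integralE//; apply: le_ereal_sup => _ [h hf <-].
exists h => // x; apply: (le_trans (hf x)).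
by rewrite /patch; case: ifPn => // /[!inE]; exact: fg.
Qed.

Definition affine_map (s m : R) (x : measurableTypeR R) : measurableTypeR R :=
  (s * x + m)%R.

Let measurable_affine_map s m : measurable_fun setT (affine_map s m).
Proof. exact: measurable_funD. Qed.

HB.instance Definition _ (s m : R) := isMeasurableFun.Build _ _ _ _
  (affine_map s m) (measurable_affine_map s m).

(** Uniqueness of Lebesgue measure: the rescaled image measure agrees with it on the intervals ]a,
    b]. A negative [s] reverses the orientation of the preimage, hence the two shapes of
    interval. *)
Lemma lebesgue_measure_affine (s m : R) (A : set R) : (s != 0)%R ->
  measurable A ->
  mu A = `|s|%:E * pushforward mu (affine_map s m) A.
Proof.
move=> s0 mA.
pose ns : {nonneg R} := NngNum (normr_ge0 s).
apply: (@lebesgue_measure_unique R (mscale ns (pushforward mu (affine_map s m)))) => //.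
move=> _ [[a b]] _ <-.
change (mu `]a, b]%classic =
  `|s|%:E * mu (affine_map s m @^-1` `]a, b]%classic)).
have -> : affine_map s m @^-1` `]a, b] =
    [set` if (0 < s)%R then `](a - m) / s, (b - m) / s]%R
          else `[(b - m) / s, (a - m) / s[%R].
  suff H x : (s * x + m \in `]a, b])%R =
      (x \in if (0 < s)%R then `](a - m) / s, (b - m) / s]%R
             else `[(b - m) / s, (a - m) / s[%R).
    by apply/seteqP; split=> x; rewrite /affine_map /= H.
  case: ifPn => sp; rewrite !in_itv/=.
    by rewrite ltr_pdivrMr// ler_pdivlMr// ltrBlDr lerBrDr (mulrC x).
  have sn : (s < 0)%R by rewrite lt_neqAle s0 leNgt.
  rewrite ler_ndivrMr// ltr_ndivlMr//.
  by rewrite ltrBlDr lerBrDr (mulrC x) andbC.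
case: ifPn => sp; rewrite !lebesgue_measure_itv/= !lte_fin.
  rewrite ltr_pM2r ?invr_gt0// ltrD2r; case: ifPn => ab; last by rewrite mule0.
  by rewrite -!EFinB -EFinM gtr0_norm//; congr EFin; field.
have sn : (s < 0)%R by rewrite lt_neqAle s0 leNgt.
rewrite ltr_nM2r ?invr_lt0// ltrD2r; case: ifPn => ab; last by rewrite mule0.
by rewrite -!EFinB -EFinM ltr0_norm//; congr EFin; field.
Qed.

Lemma ge0_integral_affine (s m : R) (f : R -> \bar R) : (s != 0)%R ->
  measurable_fun setT f -> (forall x, 0 <= f x) ->
  \int[mu]_x f x = `|s|%:E * \int[mu]_x f (s * x + m)%R.
Proof.
move=> s0 mf f0.
pose ns : {nonneg R} := NngNum (normr_ge0 s).
rewrite (@eq_measure_integral _ _ R setT (mscale ns (pushforward mu (affine_map s m)))).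
  rewrite ge0_integral_mscale// ge0_integral_pushforward//.
by move=> A mA _; exact: (lebesgue_measure_affine m s0 mA).
Qed.

Lemma ge0_integral_affine_itv (c T m : R) (f : R -> \bar R) :
  measurable_fun setT f -> (forall x, 0 <= f x) ->
  \int[mu]_(x in `[c, T]) f (x + m)%R =
  \int[mu]_(x in `[(c + m)%R, (T + m)%R]) f x.
Proof.
move=> mf f0.
rewrite [RHS]integral_mkcond (@ge0_integral_affine 1 m)//; last 2 first.
- by apply/(measurable_restrictT _ _).1 => //; exact: measurable_funTS.
- by move=> x; rewrite erestrict_ge0.
rewrite normr1 mul1e integral_mkcond; apply: eq_integral => x _.
rewrite /patch; congr (if _ then _ else _); last by rewrite mul1r.
by apply/idP/idP; rewrite !inE/= !in_itv/= mul1r !lerD2r.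
Qed.

Lemma ge0_integral_itvU (a b c : R) (f : R -> \bar R) :
  measurable_fun setT f -> (forall x, 0 <= f x) -> (a <= b <= c)%R ->
  \int[mu]_(x in `[a, c]) f x =
  \int[mu]_(x in `[a, b]) f x + \int[mu]_(x in `[b, c]) f x.
Proof.
move=> mf f0 /andP[ab bc].
rewrite -(@integral_itv_obnd_cbnd _ b (BRight c)); last exact: measurable_funTS.
rewrite -ge0_integral_setU//=.
- by rewrite -itv_bndbnd_setU// !bnd_simp.
- exact: measurable_funTS.
- apply/disj_setPS => x [] /=; rewrite !in_itv/= => /andP[_ h1] /andP[h2 _].
  by move: (le_lt_trans h1 h2); rewrite ltxx.
Qed.

(** Reducing [c] modulo [T] leaves a shift 0 <= r <= T; the window [r, r + T] is then cut at T and
    its second piece translated back onto [0, r]. *)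
Lemma ge0_integral_periodic (T : R) (f : R -> \bar R) (c : R) : (0 < T)%R ->
  measurable_fun setT f -> (forall x, 0 <= f x) ->
  (forall x, f (x + T)%R = f x) ->
  \int[mu]_(x in `[0%R, T]) f (x + c)%R = \int[mu]_(x in `[0%R, T]) f x.
Proof.
move=> T0 mf f0 fT.
have fTn (n : nat) x : f (x + n%:R * T)%R = f x.
  elim: n x => [|n IH] x; first by rewrite mul0r addr0.
  by rewrite -natr1 mulrDl mul1r addrA fT IH.
have fTz (z : int) x : f (x + z%:~R * T)%R = f x.
  case: z => n; first exact: fTn.
  rewrite NegzE mulrNz mulNr.
  by rewrite -[LHS](fTn n.+1); congr f; rewrite pmulrn; ring.
pose z := Num.floor (c / T); pose r := (c - z%:~R * T)%R.
have r0 : (0 <= r)%R.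
  by rewrite /r subr_ge0 -ler_pdivlMr//; exact: ge_floor.
have rT : (r <= T)%R.
  have : (c / T <= (z + 1)%:~R)%R by exact/ltW/floorD1_gt.
  by rewrite ler_pdivrMr// intrD mulrDl mul1r /r; lra.
have -> : (fun x => f (x + c)%R) = (fun x => f (x + r)%R).
  by apply/funext => x; rewrite -(fTz z (x + r)%R); congr f; rewrite /r; ring.
rewrite ge0_integral_affine_itv// add0r.
rewrite (@ge0_integral_itvU r T)//; last by rewrite rT/= lerDl.
rewrite [in RHS](@ge0_integral_itvU 0%R r)// ?r0// addeC; congr (_ + _).
have := @ge0_integral_affine_itv 0%R r T f mf f0.
rewrite add0r addrC => <-; apply: eq_integral => x _; exact: fT.
Qed.
End lebesgue_tools.

(** * Tonelli's theorem on rectangles *)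

Section ge0_fubini_setX.
Context d1 d2 (T1 : measurableType d1) (T2 : measurableType d2) (R : realType).
Variable m1 : {sigma_finite_measure set T1 -> \bar R}.
Variable m2 : {sigma_finite_measure set T2 -> \bar R}.
Local Open Scope ereal_scope.

Let restrict1 (A : set T1) (B : set T2) (k : T1 * T2 -> \bar R) x :
  \int[m2]_y ((k \_ (A `*` B)) (x, y)) =
  ((fun x => \int[m2]_(y in B) k (x, y)) \_ A) x.
Proof.
rewrite [RHS]/patch; case: ifPn => [xA|xA].
  rewrite [RHS]integral_mkcond; apply: eq_integral => y _.
  by rewrite /patch in_setX xA.
by rewrite integral0_eq// => y _; rewrite /patch in_setX (negbTE xA).
Qed.

Let restrict2 (A : set T1) (B : set T2) (k : T1 * T2 -> \bar R) y :
  \int[m1]_x ((k \_ (A `*` B)) (x, y)) =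
  ((fun y => \int[m1]_(x in A) k (x, y)) \_ B) y.
Proof.
rewrite [RHS]/patch; case: ifPn => [yB|yB].
  rewrite [RHS]integral_mkcond; apply: eq_integral => x _.
  by rewrite /patch in_setX yB andbT.
by rewrite integral0_eq// => x _; rewrite /patch in_setX (negbTE yB) andbF.
Qed.

Lemma ge0_fubini_setX (A : set T1) (B : set T2) (k : T1 * T2 -> \bar R) :
  measurable A -> measurable B -> measurable_fun setT k -> (forall p, 0 <= k p) ->
  \int[m1]_(x in A) \int[m2]_(y in B) k (x, y) =
  \int[m2]_(y in B) \int[m1]_(x in A) k (x, y).
Proof.
move=> mA mB mk k0; rewrite [LHS]integral_mkcond [RHS]integral_mkcond.
under eq_integral do rewrite -restrict1.
under [RHS]eq_integral do rewrite -restrict2.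
apply: (fubini_tonelli (k \_ (A `*` B))).
  apply/(measurable_restrictT _ _).1; first exact: measurableX.
  exact: measurable_funTS.
by move=> p; rewrite erestrict_ge0.
Qed.

Lemma ge0_fubini_setXE (A : set T1) (B : set T2) (k : T1 * T2 -> \bar R) :
  measurable A -> measurable B -> measurable_fun setT k -> (forall p, 0 <= k p) ->
  \int[m1 \x m2]_(p in A `*` B) k p =
  \int[m1]_(x in A) \int[m2]_(y in B) k (x, y).
Proof.
move=> mA mB mk k0; rewrite [LHS]integral_mkcond [RHS]integral_mkcond.
under [RHS]eq_integral do rewrite -restrict1.
apply: (fubini_tonelli1 (k \_ (A `*` B))).
  apply/(measurable_restrictT _ _).1; first exact: measurableX.
  exact: measurable_funTS.
by move=> p; rewrite erestrict_ge0.
Qed.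

Lemma measurable_integral_section (B : set T2) (k : T1 * T2 -> \bar R) :
  measurable B -> measurable_fun setT k -> (forall p, 0 <= k p) ->
  measurable_fun setT (fun x => \int[m2]_(y in B) k (x, y)).
Proof.
move=> mB mk k0.
rewrite (_ : (fun x => _) = fun x => \int[m2]_y ((k \_ (setT `*` B)) (x, y))).
  apply: (measurable_fun_fubini_tonelli_F (k \_ (setT `*` B))).
    apply/(measurable_restrictT _ _).1; first exact: measurableX.
    exact: measurable_funTS.
  by move=> p; rewrite erestrict_ge0.
by apply/funext => x; rewrite restrict1 patch_setT.
Qed.

End ge0_fubini_setX.

(** * Gaussian laws *)

Section density.
Context {R : realType}.
Local Notation mu := (@lebesgue_measure R).
Local Open Scope ereal_scope.
Import HBNNSimple.

Lemma ge0_integral_density (m : {measure set (measurableTypeR R) -> \bar R})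
    (p : measurableTypeR R -> R) (h : measurableTypeR R -> \bar R) :
  measurable_fun setT p -> (forall x, 0 <= p x)%R ->
  (forall A, measurable A -> m A = \int[mu]_(x in A) (p x)%:E) ->
  measurable_fun setT h -> (forall x, 0 <= h x) ->
  \int[m]_x h x = \int[mu]_x (h x * (p x)%:E).
Proof.
move=> mp p0 mE mh h0.
have mpE : measurable_fun setT (EFin \o p) by exact/measurable_EFinP.
pose h_ := nnsfun_approx measurableT mh.
(* The identity for simple functions, level set by level set; it passes to [h] by monotone
   convergence on both sides. *)
have hsf (f : {nnsfun (measurableTypeR R) >-> R}) :
    \int[m]_x (f x)%:E = \int[mu]_x ((f x)%:E * (p x)%:E).
  under eq_integral do rewrite fimfunE -fsumEFin//.
  rewrite ge0_integral_fsum//; last 2 first.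
  - by move=> y; exact/measurable_EFinP/measurable_funM.
  - by move=> y x _; rewrite nnfun_muleindic_ge0.
  transitivity (\int[mu]_x (\sum_(k \in range f)
      ((k * \1_(f @^-1` [set k]) x)%:E * (p x)%:E))); last first.
    apply: eq_integral => x _.
    rewrite -ge0_mule_fsuml; last by move=> k; rewrite nnfun_muleindic_ge0.
    by rewrite [in RHS]fimfunE -fsumEFin.
  rewrite ge0_integral_fsum//; last 2 first.
  - move=> y; apply: emeasurable_funM => //.
    by apply/measurable_EFinP; exact: measurable_funM.
  - by move=> y x _; rewrite EFinM mule_ge0 ?nnfun_muleindic_ge0// lee_fin.
  apply: eq_fsbigr => r _; rewrite integralZl_indic_nnsfun//.
  rewrite integral_indic// setIT mE//.
  under [in RHS]eq_integral do rewrite EFinM -muleA.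
  (* A negative level [r] has an empty preimage, since [f] is nonnegative. *)
  have [r0|r0] := ltP r 0%R.
    rewrite preimage_nnfun0// integral_set0 mule0.
    rewrite integral0_eq// => x _.
    by rewrite indic0 mul0e mule0.
  rewrite ge0_integralZl//.
  - congr (_ * _); rewrite [LHS]integral_mkcond.
    apply: (@eq_integral _ (measurableTypeR R)) => x _.
    rewrite /patch indicE; case: ifPn => _; first by rewrite mul1e.
    by rewrite mul0e.
  - by apply: emeasurable_funM => //; exact/measurable_EFinP.
  - by move=> x _; rewrite mule_ge0// lee_fin.
transitivity (limn (fun n => \int[m]_x (h_ n x)%:E)).
  rewrite -monotone_convergence//.
  - by apply: eq_integral => y _; apply/esym/cvg_lim => //;
      exact: cvg_nnsfun_approx.
  - by move=> n; exact/measurable_EFinP/measurable_funP.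
  - by move=> n y _; rewrite lee_fin.
  - by move=> y _ a b ab; rewrite lee_fin; exact/lefP/nd_nnsfun_approx.
transitivity (limn (fun n => \int[mu]_x ((h_ n x)%:E * (p x)%:E))).
  by congr (limn _); apply/funext => n; exact: hsf.
rewrite -monotone_convergence//.
- apply: eq_integral => y _; apply/cvg_lim => //.
  apply: cvgeZr => //; first exact: cvg_nnsfun_approx.
- move=> n; apply: emeasurable_funM => //.
  by apply/measurable_EFinP; exact: measurable_funP.
- by move=> n y _; rewrite mule_ge0// lee_fin.
- move=> y _ a b ab; rewrite lee_wpmul2r ?lee_fin//.
  exact/lefP/nd_nnsfun_approx.
Qed.

End density.

Section standard_normal.
Context {R : realType}.
Local Notation mu := (@lebesgue_measure R).

Definition phi : measurableTypeR R -> R := normal_pdf 0 1.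

Lemma phiE x : phi x = normal_peak 1 * expR (- (x ^+ 2 / 2)).
Proof.
rewrite /phi normal_pdfE ?oner_neq0// /normal_fun subr0 expr1n.
by rewrite mulNr.
Qed.

Lemma phi_ge0 x : 0 <= phi x. Proof. exact: normal_pdf_ge0. Qed.

Lemma measurable_phi : measurable_fun setT phi.
Proof. exact: measurable_normal_pdf. Qed.

Lemma phi_even x : phi (- x) = phi x.
Proof. by rewrite !phiE sqrrN. Qed.

(** Rotation invariance of the standard Gaussian of the plane, the reason behind
    [integral_phi_rot]. *)
Lemma phi_rot x y x' y' : x ^+ 2 + y ^+ 2 = x' ^+ 2 + y' ^+ 2 ->
  phi x * phi y = phi x' * phi y'.
Proof.
move=> h; rewrite !phiE.
rewrite mulrACA -expRD [RHS]mulrACA -expRD; congr (_ * expR _).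
by rewrite -!opprD -!mulrDl h.
Qed.

Lemma phi_le_peak x : phi x <= normal_peak 1.
Proof. by apply: normal_pdf_ub; rewrite oner_neq0. Qed.

Lemma normal_peak_scale (s : R) : s != 0 -> `|s| * normal_peak s = normal_peak 1.
Proof.
move=> s0; rewrite /normal_peak expr1n mul1r -mulrnAr sqrtrM ?sqr_ge0//.
by rewrite sqrtr_sqr invfM mulrA mulfV ?mul1r// normr_eq0.
Qed.

Lemma normal_pdf_scale (m s x : R) : s != 0 ->
  `|s| * normal_pdf m s (s * x + m) = phi x.
Proof.
move=> s0; rewrite normal_pdfE// /normal_fun addrK mulrA normal_peak_scale//.
rewrite phiE; congr (_ * expR _); rewrite mulNr; congr (- _).
by rewrite -mulr_natr; field.
Qed.

Local Open Scope ereal_scope.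

Lemma integral_phi : \int[mu]_x (phi x)%:E = 1.
Proof. exact: integral_normal_pdf. Qed.

Lemma ge0_integral_normal_prob (m s : R) (h : measurableTypeR R -> \bar R) :
  (s != 0)%R -> measurable_fun setT h -> (forall x, 0 <= h x) ->
  \int[normal_prob m s]_x h x = \int[mu]_x (h (m + s * x)%R * (phi x)%:E).
Proof.
move=> s0 mh h0.
transitivity (\int[mu]_x (h x * (normal_pdf m s x)%:E)).
  apply: (@ge0_integral_density R (normal_prob m s) (normal_pdf m s) h) => //.
  - exact: measurable_normal_pdf.
  - by move=> x; exact: normal_pdf_ge0.
rewrite (@ge0_integral_affine _ s m)//; last 2 first.
- apply: emeasurable_funM => //; apply/measurable_EFinP.
  exact: measurable_normal_pdf.
- by move=> x; rewrite mule_ge0// lee_fin normal_pdf_ge0.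
rewrite -ge0_integralZl//; last 2 first.
- apply: emeasurable_funM => //.
    apply: measurableT_comp => //; exact: measurable_funD.
  apply/measurable_EFinP.
  apply: (@measurableT_comp _ _ _ _ _ _ (normal_pdf m s)).
    exact: measurable_normal_pdf.
  exact: measurable_funD.
- by move=> x _; rewrite mule_ge0// lee_fin normal_pdf_ge0.
apply: eq_integral => x _; rewrite muleCA -EFinM normal_pdf_scale//.
by rewrite [in RHS]addrC.
Qed.

(** The law of a sum of two independent centred Gaussians. The rotation of the plane is split into
    two substitutions, each affine in one variable: first in [x] with Jacobian sg / s, then in [y]
    with Jacobian s / sg, with Tonelli's theorem in between. The first one divides by [s], so s = 0
    is treated apart. *)
Lemma integral_phi_rot (s t : R) (h : measurableTypeR R -> \bar R) :
  measurable_fun setT h -> (forall x, 0 <= h x) ->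
  \int[mu]_x (\int[mu]_y (h (s * x + t * y)%R * (phi y)%:E) * (phi x)%:E) =
  \int[mu]_z (h (Num.sqrt (s ^+ 2 + t ^+ 2) * z)%R * (phi z)%:E).
Proof.
move=> mh h0; set sg := Num.sqrt _.
have mphi1 d (T : measurableType d) (f : T -> R) : measurable_fun setT f ->
    measurable_fun setT (fun p => (phi (f p))%:E).
  move=> mf; apply/measurable_EFinP.
  exact: (measurableT_comp measurable_phi mf).
have mh1 d (T : measurableType d) (f : T -> R) : measurable_fun setT f ->
    measurable_fun setT (fun p => h (f p)).
  by move=> mf; exact: (measurableT_comp mh mf).
have [s0|s0] := eqVneq s 0%R.
  transitivity (\int[mu]_x (\int[mu]_y (h (t * y)%R * (phi y)%:E)
      * (phi x)%:E)).
    apply: eq_integral => x _; congr (_ * _).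
    by apply: eq_integral => y _; rewrite s0 mul0r add0r.
  have I0 u : 0 <= \int[mu]_y (h (u * y)%R * (phi y)%:E).
    by apply: integral_ge0 => y _; rewrite mule_ge0// lee_fin phi_ge0.
  rewrite ge0_integralZl//; last 2 first.
  - by apply/measurable_EFinP; exact: measurable_phi.
  - by move=> x _; rewrite lee_fin phi_ge0.
  rewrite integral_phi mule1 /sg s0 expr0n add0r sqrtr_sqr.
  have [t0|t0] := leP 0%R t; first by rewrite ger0_norm.
  rewrite ltr0_norm// (@ge0_integral_affine _ (-1) 0)//; last 2 first.
  - apply: emeasurable_funM; last exact: mphi1.
    by apply: mh1; exact: measurable_funM.
  - by move=> x; rewrite mule_ge0// lee_fin phi_ge0.
  rewrite normrN1 mul1e; apply: eq_integral => x _.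
  by rewrite addr0 mulN1r phi_even mulrN mulNr.
have sg0 : (0 < sg)%R.
  by rewrite sqrtr_gt0 ltr_pwDl ?sqr_ge0// exprn_even_gt0.
have sgE : (sg ^+ 2 = s ^+ 2 + t ^+ 2)%R.
  by rewrite sqr_sqrtr// addr_ge0// sqr_ge0.
pose F (p : measurableTypeR R * measurableTypeR R) :=
  h (s * p.1 + t * p.2)%R * (phi p.2)%:E * (phi p.1)%:E.
(* [G] is [F] after the substitution that turns s x + t y into sg z, up to the Jacobian. *)
pose G (p : measurableTypeR R * measurableTypeR R) :=
  h (sg * p.1)%R * (phi p.2)%:E * (phi ((sg * p.1 - t * p.2) / s))%:E.
have mF : measurable_fun setT F.
  apply: emeasurable_funM; last exact: mphi1.
  apply: emeasurable_funM; last exact: mphi1.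
  by apply: mh1; apply: measurable_funD; exact: measurable_funM.
have mG : measurable_fun setT G.
  apply: emeasurable_funM; last first.
    apply: mphi1; apply: measurable_funM => //.
    by apply: measurable_funB; exact: measurable_funM.
  apply: emeasurable_funM; last exact: mphi1.
  by apply: mh1; exact: measurable_funM.
have F0 p : 0 <= F p by rewrite /F !mule_ge0// lee_fin phi_ge0.
have G0 p : 0 <= G p by rewrite /G !mule_ge0// lee_fin phi_ge0.
have c0 : (sg / s != 0)%R by rewrite mulf_neq0 ?invr_eq0// gt_eqF.
transitivity (\int[mu]_x \int[mu]_y F (x, y)).
  apply: eq_integral => x _; rewrite -ge0_integralZr//.
  - by apply: emeasurable_funM; [apply: mh1; exact: measurable_funD|exact: mphi1].
  - by move=> y _; rewrite mule_ge0// lee_fin phi_ge0.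
  - by rewrite lee_fin phi_ge0.
rewrite (fubini_tonelli F)//.
have -> : \int[mu]_y \int[mu]_x F (x, y) =
    \int[mu]_y (`|sg / s|%:E * \int[mu]_z G (z, y)).
  apply: eq_integral => y _.
  rewrite (@ge0_integral_affine _ (sg / s) (- t * y / s)
    (fun x => F (x, y)) c0); last 2 first.
    exact: (measurableT_comp mF (pair2_measurable y)).
    by move=> x; exact: F0.
  apply: congr1; apply: eq_integral => z _; rewrite /F /G; cbn [fst snd].
  by congr (h _ * _ * (phi _)%:E); field.
rewrite ge0_integralZl//; last 2 first.
- exact: (measurable_fun_fubini_tonelli_G G).
- by move=> y _; exact: integral_ge0.
rewrite -(fubini_tonelli G)//.
have -> : \int[mu]_z \int[mu]_y G (z, y) =
    \int[mu]_z (`|s / sg|%:E * (h (sg * z)%R * (phi z)%:E)).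
  apply: eq_integral => z _.
  rewrite (@ge0_integral_affine _ (s / sg) (t / sg * z)
    (fun y => G (z, y))); last 3 first.
  - by rewrite -invf_div invr_eq0.
  - exact: (measurableT_comp mG (pair1_measurable z)).
  - by move=> x; exact: G0.
  congr (_ * _).
  under eq_integral => y _.
    rewrite /G; cbn [fst snd]; rewrite -muleA -EFinM (@phi_rot _ _ z y).
      rewrite EFinM muleA.
      over.
    have sgn0 : sg != 0%R by rewrite gt_eqF.
    have sgV : sg = ((s ^+ 2 + t ^+ 2) / sg)%R.
      by rewrite -sgE expr2 mulfK.
    have -> : ((sg * z - t * (s / sg * y + t / sg * z)) / s =
        s / sg * z - t / sg * y)%R.
      by rewrite {1}sgV; field; rewrite s0 sgn0.
    transitivity ((s ^+ 2 + t ^+ 2) / sg ^+ 2 * (z ^+ 2 + y ^+ 2))%R.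
      by field.
    by rewrite -sgE divff ?mul1r// expf_neq0.
  rewrite ge0_integralZl ?integral_phi ?mule1//.
  - exact: mphi1.
  - by move=> y _; rewrite lee_fin phi_ge0.
  - by rewrite mule_ge0// lee_fin phi_ge0.
rewrite ge0_integralZl//; last 2 first.
- by apply: emeasurable_funM; [apply: mh1; exact: measurable_funM|exact: mphi1].
- by move=> y _; rewrite mule_ge0// lee_fin phi_ge0.
rewrite muleA -EFinM -normrM mulrA divfK// divff ?gt_eqF// normr1 mul1e//.
Qed.

(** As exp (x^2 / 4) >= 1 + x^2 / 4, the integrand is at most a multiple of exp (- x^2 / 4), which
    is proportional to the density of variance 2: hence sqrt 2 and the factor 4. *)
Lemma phi_sqr_lty : \int[mu]_x ((x ^+ 2)%:E * (phi x)%:E) < +oo.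
Proof.
pose s2 : R := Num.sqrt 2.
have s2sq : (s2 ^+ 2 = 2)%R by rewrite sqr_sqrtr.
have s20 : (s2 != 0)%R by rewrite sqrtr_eq0 -ltNge.
pose C : R := (4 * normal_peak 1 / normal_peak s2)%R.
have C0 : (0 <= C)%R.
  by rewrite /C divr_ge0 ?normal_peak_ge0// mulr_ge0 ?normal_peak_ge0.
apply: (@le_lt_trans _ _ (\int[mu]_x (C%:E * (normal_pdf 0 s2 x)%:E))).
  apply: ge0_le_integral_nomeas => x _.
    by rewrite mule_ge0// lee_fin ?sqr_ge0// phi_ge0.
  rewrite -!EFinM lee_fin phiE normal_pdfE// /normal_fun subr0 s2sq.
  have -> : (C * (normal_peak s2 * expR (- x ^+ 2 / (2 *+ 2))) =
      normal_peak 1 * (4 * expR (- x ^+ 2 / (2 *+ 2))))%R.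
    by rewrite /C; field; rewrite gt_eqF// normal_peak_gt0.
  rewrite mulrCA ler_wpM2l ?normal_peak_ge0//.
  have -> : (- (x ^+ 2 / 2) = - (x ^+ 2 / 4) + - x ^+ 2 / (2 *+ 2))%R.
    by rewrite -mulr_natr; field.
  rewrite expRD mulrA ler_wpM2r ?expR_ge0// expRN -ler_pdivlMr ?invr_gt0 ?expR_gt0//.
  rewrite invrK; have := expR_ge1Dx (x ^+ 2 / 4); lra.
rewrite ge0_integralZl//; last 2 first.
- by apply/measurable_EFinP; exact: measurable_normal_pdf.
- by move=> x _; rewrite lee_fin normal_pdf_ge0.
by rewrite integral_normal_pdf mule1 ltry.
Qed.

Lemma integrable_phi : mu.-integrable setT (fun x => (phi x)%:E).
Proof. exact: integrable_normal_pdf. Qed.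

Lemma integrable_xphi : mu.-integrable setT (fun x => (x * phi x)%:E).
Proof.
have mxp : measurable_fun setT (fun x : measurableTypeR R => x * phi x)%R.
  by apply: measurable_funM => //; exact: measurable_phi.
apply/integrableP; split; first exact/measurable_EFinP.
apply: (@le_lt_trans _ _ (\int[mu]_x ((phi x)%:E + (x ^+ 2)%:E * (phi x)%:E))).
  apply: ge0_le_integral_nomeas => x _ //.
  rewrite -EFinM -EFinD lee_fin normrM (ger0_norm (phi_ge0 x)).
  rewrite -{2}(mul1r (phi x)) -mulrDl ler_wpM2r ?phi_ge0//.
  rewrite -(real_normK (num_real x)); have := sqr_ge0 (`|x| - 1)%R.
  by rewrite sqrrB1; have := sqr_ge0 `|x|; lra.
rewrite ge0_integralD//; last 4 first.
- by move=> x _; rewrite lee_fin phi_ge0.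
- by apply/measurable_EFinP; exact: measurable_phi.
- by move=> x _; rewrite mule_ge0// lee_fin ?sqr_ge0 ?phi_ge0.
- apply: emeasurable_funM; apply/measurable_EFinP; last exact: measurable_phi.
  exact: measurable_funX.
by rewrite integral_phi lte_add_pinfty ?ltry// phi_sqr_lty.
Qed.

(** The substitution x -> - x exchanges the positive and negative parts. *)
Lemma integral_xphi : \int[mu]_x (x * phi x)%:E = 0.
Proof.
have mxp : measurable_fun setT (fun x : measurableTypeR R => (x * phi x)%:E).
  by apply/measurable_EFinP/measurable_funM => //; exact: measurable_phi.
rewrite integralE.
rewrite [X in X - _](_ : _ = \int[mu]_x (fun x => (x * phi x)%:E)^\- x).
  apply: subee; apply: integral_fune_fin_num => //.
  exact/integrable_funeneg/integrable_xphi.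
have mpos : measurable_fun setT (fun x : measurableTypeR R => (x * phi x)%:E)^\+.
  exact: measurable_funepos.
rewrite (@ge0_integral_affine _ (-1) 0 (fun x => (x * phi x)%:E)^\+)//.
rewrite normrN1 mul1e; apply: eq_integral => x _.
by rewrite funeposE funenegE addr0 mulN1r phi_even mulNr EFinN.
Qed.

Lemma integral_phi_affine (m s : R) :
  \int[mu]_x ((m + s * x)%:E * (phi x)%:E) = m%:E.
Proof.
transitivity (\int[mu]_x ((m%:E * (phi x)%:E) + (s%:E * (x * phi x)%:E))).
  by apply: eq_integral => x _; rewrite -!EFinM -EFinD; congr EFin; ring.
rewrite integralD//; last 2 first.
- by apply: integrableZl => //; exact: integrable_phi.
- by apply: integrableZl => //; exact: integrable_xphi.
rewrite !integralZl//; last 2 first.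
- exact: integrable_xphi.
- exact: integrable_phi.
by rewrite integral_phi integral_xphi mule0 mule1 adde0.
Qed.

End standard_normal.

Section gaussian_laws.
Context d (Omega : measurableType d) (R : realType) (P : probability Omega R).
Local Notation mu := (@lebesgue_measure R).
Local Open Scope ereal_scope.

(* [Z] has the law of [m + s * N] with [N] standard normal; [s = 0] covers
   point masses. *)
Definition normal_law (Z : Omega -> R) (m s : R) : Prop :=
  forall h : measurableTypeR R -> \bar R, measurable_fun setT h ->
    (forall x, 0 <= h x) ->
    \int[P]_w h (Z w) = \int[mu]_x (h (m + s * x)%R * (phi x)%:E).

Lemma gaussian_normal_law (Z : Omega -> R) : measurable_fun setT Z ->
  gaussian P Z -> exists m s, normal_law Z m s.
Proof.
move=> mZ [m [s PZ]]; exists m, s => h mh h0.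
have pushE := @ge0_integral_pushforward _ _ _ (measurableTypeR R) _ Z mZ P setT h measurableT mh
  (fun x _ => h0 x).
rewrite preimage_setT in pushE; rewrite -pushE.
have [s0|s0] := eqVneq s 0%R.
  rewrite (@eq_measure_integral _ (measurableTypeR R) R setT
    (\d_ (m : measurableTypeR R))).
    rewrite integral_dirac// diracT mul1e.
    transitivity (\int[mu]_x (h m * (phi x)%:E)); last first.
      by apply: eq_integral => x _; rewrite s0 mul0r addr0.
    rewrite ge0_integralZl ?integral_phi ?mule1//.
    - by apply/measurable_EFinP; exact: measurable_phi.
    - by move=> x _; rewrite lee_fin phi_ge0.
  by move=> A mA _; rewrite -[LHS]/(P (Z @^-1` A)) PZ// s0 eqxx.
rewrite -ge0_integral_normal_prob//; apply: eq_measure_integral.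
by move=> A mA _; rewrite -[LHS]/(P (Z @^-1` A)) PZ// (negbTE s0).
Qed.

Lemma normal_law_integral (Z : Omega -> R) (m s : R) (h : measurableTypeR R -> R) :
  normal_law Z m s -> measurable_fun setT h ->
  \int[P]_w (h (Z w))%:E = \int[mu]_x ((h (m + s * x)%R)%:E * (phi x)%:E).
Proof.
move=> hZ mh; rewrite integralE [RHS]integralE; congr (_ - _).
- under [RHS]eq_integral => x _.
    rewrite funeposE -[0]/(0%R%:E) -EFinM -EFin_max -(mul0r (phi x)).
    rewrite -maxr_pMl ?phi_ge0// EFinM EFin_max.
    over.
  under eq_integral do rewrite funeposE.
  apply: (hZ (fun x => maxe (h x)%:E 0)).
    by apply: measurable_maxe => //; exact/measurable_EFinP.
  by move=> x; rewrite le_max lexx orbT.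
- under [RHS]eq_integral => x _.
    rewrite funenegE -[0]/(0%R%:E) -EFinM -EFinN -EFin_max -(mul0r (phi x)).
    rewrite -mulNr -maxr_pMl ?phi_ge0// EFinM EFin_max.
    over.
  under eq_integral do rewrite funenegE.
  apply: (hZ (fun x => maxe (- h x)%R%:E 0)).
    by apply: measurable_maxe => //; exact/measurable_EFinP/measurable_funN.
  by move=> x; rewrite le_max lexx orbT.
Qed.

Lemma normal_law_mean (Z : Omega -> R) (m s : R) : normal_law Z m s ->
  \int[P]_w (Z w)%:E = m%:E.
Proof.
move=> hZ; rewrite (normal_law_integral (h := idfun) hZ).
  exact: integral_phi_affine.
exact: measurable_id.
Qed.

Lemma normal_law_sqr (Z : Omega -> R) (s : R) : normal_law Z 0 s ->
  \int[P]_w (Z w ^+ 2)%:E = (s ^+ 2)%:E * \int[mu]_x ((x ^+ 2)%:E * (phi x)%:E).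
Proof.
move=> hZ; rewrite (hZ (fun x => (x ^+ 2)%:E)); last 2 first.
- by apply/measurable_EFinP; exact: measurable_funX.
- by move=> x; rewrite lee_fin sqr_ge0.
rewrite -ge0_integralZl ?lee_fin ?sqr_ge0//; last 2 first.
- apply: emeasurable_funM; apply/measurable_EFinP; last exact: measurable_phi.
  exact: measurable_funX.
- by move=> x _; rewrite mule_ge0// lee_fin ?sqr_ge0 ?phi_ge0.
by apply: eq_integral => x _; rewrite add0r exprMn EFinM muleA.
Qed.

(** Independence on rectangles identifies the law of (U, V) with the product of the marginal laws;
    [integral_phi_rot] then gives the law of the sum. *)
Lemma normal_law_add (U V : {RV P >-> R}) (s t : R) :
  (forall A B : set R, measurable A -> measurable B ->
    P (U @^-1` A `&` V @^-1` B) = P (U @^-1` A) * P (V @^-1` B)) ->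
  normal_law U 0 s -> normal_law V 0 t ->
  normal_law (U \+ V)%R 0 (Num.sqrt (s ^+ 2 + t ^+ 2)).
Proof.
move=> indep hU hV h mh h0.
pose UV (w : Omega) : R * R := (U w, V w).
have mU : measurable_fun setT U.
  exact: (measurable_funPT U).
have mV : measurable_fun setT V.
  exact: (measurable_funPT V).
have mUV : measurable_fun setT UV by exact: measurable_fun_pair.
pose PU := distribution P U.
pose PV := distribution P V.
pose k (p : R * R) := h (p.1 + p.2)%R.
have mk : measurable_fun setT k.
  by apply: (measurableT_comp mh); exact: measurable_funD.
have k0 p : 0 <= k p by exact: h0.
transitivity (\int[PU \x PV]_p k p).
  rewrite (@eq_measure_integral _ _ R setT (pushforward P UV)).
    by rewrite ge0_integral_pushforward// preimage_setT.
  move=> A mA _.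
  exact: (@product_measure_unique _ _ _ _ _ _ _ (pushforward P UV)).
rewrite fubini_tonelli1// /fubini_F /PU ge0_integral_distribution//; last 2 first.
- exact: (measurable_fun_fubini_tonelli_F k).
- by move=> x; exact: integral_ge0.
pose H (x : measurableTypeR R) := \int[mu]_y (h (x + t * y)%R * (phi y)%:E).
have HE x : \int[PV]_y k (x, y) = H x.
  rewrite /PV ge0_integral_distribution//; last first.
    exact: (measurableT_comp mk (pair1_measurable x)).
  rewrite (hV (fun y => h (x + y)%R))//; last first.
    by apply: (measurableT_comp mh); exact: measurable_funD.
  by apply: eq_integral => y _; rewrite add0r.
have mH : measurable_fun setT H.
  rewrite (_ : H = fun x => \int[PV]_y k (x, y)).
    exact: (measurable_fun_fubini_tonelli_F k).
  by apply/funext => x; rewrite HE.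
transitivity (\int[P]_w H (U w)).
  by apply: eq_integral => w _; exact: HE.
rewrite hU//; last first.
  by move=> x; rewrite -HE; exact: integral_ge0.
under [RHS]eq_integral do rewrite add0r.
rewrite -(integral_phi_rot s t mh h0); apply: eq_integral => x _.
by rewrite add0r.
Qed.

End gaussian_laws.

(** * Linear combinations of the two processes *)

Section process_combinations.
Context d (Omega : measurableType d) (R : realType) (P : probability Omega R).
Local Notation mu := (@lebesgue_measure R).
Implicit Types X : nat -> {RV P >-> R}.

Definition lincomb X (n : nat) (c : nat -> R) (w : Omega) : R :=
  \sum_(1 <= k < n.+1) c k * X k w.

(** The variance of [lincomb X n c] when [X] is centred with covariance [C]. *)
Definition quad (C : nat -> nat -> R) (n : nat) (c : nat -> R) : R :=
  \sum_(1 <= k < n.+1) \sum_(1 <= l < n.+1) c k * c l * C k l.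

Lemma measurable_lincomb X n c : measurable_fun setT (lincomb X n c).
Proof.
by apply: measurable_sum => k; exact: measurable_funM.
Qed.

(** Transfers the independence of the two generated sigma-algebras to linear combinations of [a] and
    of [b]. *)
Lemma lincomb_sigma_algebra X n c (A : set R) : measurable A ->
  process_sigma_algebra X (lincomb X n c @^-1` A).
Proof.
move=> mA.
pose G : set (set Omega) := \bigcup_(k in [set k : nat | (1 <= k)%N])
  preimage_set_system setT (X k) measurable.
have mX k : (1 <= k)%N ->
    measurable_fun setT (X k : g_sigma_algebraType G -> R).
  move=> k1 _ B mB; apply: sub_sigma_algebra.
  by exists k => //; exists B.
rewrite -[process_sigma_algebra X]/(@measurable _ (g_sigma_algebraType G)).
rewrite -[X in measurable X]setTI.
suff : measurable_fun setT (lincomb X n c : g_sigma_algebraType G -> R).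
  by apply.
(* Reindexing from 0 makes only the indices k + 1 occur: [X 0] need not be measurable for this
   sigma-algebra. *)
rewrite /lincomb; under eq_fun do rewrite big_add1/=.
apply: measurable_sum => k; apply: measurable_funM => //.
exact: mX.
Qed.

Local Open Scope ereal_scope.

Section moments.
Variables (X : nat -> {RV P >-> R}) (C : nat -> nat -> R).
Hypothesis centX : centered X.
Hypothesis covX : forall k l, (1 <= k)%N -> (1 <= l)%N ->
  'E_P[(X k \* X l)%R] = (C k l)%:E.

Let mX k : measurable_fun setT (X k). Proof. exact: measurable_funPT. Qed.

(** The covariance hypothesis equates an expectation with a real number; for k = l the integrand is
    nonnegative, so this yields square integrability. *)
Let X2 k : (1 <= k)%N -> \int[P]_w (X k w ^+ 2)%:E < +oo.
Proof.
move=> k1; have := covX k1 k1; rewrite unlock => h.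
by rewrite [ltLHS](_ : _ = (C k k)%:E) ?ltry// -h; apply: eq_integral.
Qed.

Let integrableXX k l : (1 <= k)%N -> (1 <= l)%N ->
  P.-integrable setT (fun w => (X k w * X l w)%:E).
Proof.
move=> k1 l1; apply/integrableP; split.
  by apply/measurable_EFinP; exact: measurable_funM.
apply: (@le_lt_trans _ _ (\int[P]_w ((X k w ^+ 2)%:E + (X l w ^+ 2)%:E))).
  apply: ge0_le_integral_nomeas => w _ //.
  rewrite -EFinD lee_fin normrM.
  rewrite -(real_normK (num_real (X k w))) -(real_normK (num_real (X l w))).
  have := sqr_ge0 (`|X k w| - `|X l w|)%R.
  rewrite sqrrB; have := mulr_ge0 (normr_ge0 (X k w)) (normr_ge0 (X l w)).
  by rewrite -mulr_natr; lra.
have m2 i : measurable_fun setT (fun w => (X i w ^+ 2)%:E).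
  by apply/measurable_EFinP; exact: measurable_funX.
rewrite ge0_integralD// => [|w _|w _]; last 2 first.
  by rewrite lee_fin sqr_ge0.
  by rewrite lee_fin sqr_ge0.
by rewrite lte_add_pinfty// X2.
Qed.

Let integrableX k : (1 <= k)%N -> P.-integrable setT (EFin \o X k).
Proof.
move=> k1; apply/integrableP; split; first exact/measurable_EFinP.
apply: (@le_lt_trans _ _ (\int[P]_w (1 + (X k w ^+ 2)%:E))).
  apply: ge0_le_integral_nomeas => w _ //.
  rewrite -EFinD lee_fin -(real_normK (num_real (X k w))).
  by have := sqr_ge0 (`|X k w| - 1)%R; rewrite sqrrB1; have := sqr_ge0 `|X k w|; lra.
rewrite ge0_integralD//=; last 2 first.
  by move=> w _; rewrite lee_fin sqr_ge0.
  by apply/measurable_EFinP; exact: measurable_funX.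
rewrite lte_add_pinfty ?X2// integral_cst// mul1e.
exact: fin_num_fun_lty.
Qed.

Lemma lincomb_mean n c : \int[P]_w (lincomb X n c w)%:E = 0.
Proof.
transitivity (\int[P]_w \sum_(0 <= k < n) ((c k.+1)%:E * (X k.+1 w)%:E)).
  apply: eq_integral => w _; rewrite /lincomb big_add1/= -sumEFin.
  by apply: eq_bigr => k _; rewrite EFinM.
rewrite integral_sum//; last first.
  by move=> k; apply: integrableZl => //; exact: integrableX.
rewrite big1// => k _; rewrite integralZl//; last exact: integrableX.
have := @centX k.+1 isT; rewrite unlock => ->; exact: mule0.
Qed.

Lemma lincomb_sqr n c :
  \int[P]_w (lincomb X n c w ^+ 2)%:E = (quad C n c)%:E.
Proof.
transitivity (\int[P]_w \sum_(0 <= k < n) \sum_(0 <= l < n)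
    ((c k.+1 * c l.+1)%:E * (X k.+1 w * X l.+1 w)%:E)).
  apply: eq_integral => w _; rewrite /lincomb big_add1/= expr2 big_distrl/=.
  rewrite -sumEFin; apply: eq_bigr => k _; rewrite big_distrr/= -sumEFin.
  by apply: eq_bigr => l _; rewrite -EFinM; congr EFin; ring.
rewrite integral_sum//; last first.
  move=> k; apply: integrable_sum => // l _; apply: integrableZl => //.
  exact: integrableXX.
rewrite /quad big_add1/= -sumEFin; apply: eq_bigr => k _.
rewrite integral_sum//; last first.
  by move=> l; apply: integrableZl => //; exact: integrableXX.
rewrite big_add1/= -sumEFin; apply: eq_bigr => l _.
rewrite integralZl//; last exact: integrableXX.
have := @covX k.+1 l.+1 isT isT; rewrite unlock => h.
by rewrite -[X in _ * X]/(\int[P]_w ((X k.+1 \* X l.+1)%R w)%:E) h.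
Qed.

End moments.

(* It equals 1, but only its positivity matters. *)
Definition kappa : R := fine (\int[mu]_x ((x ^+ 2)%:E * (phi x)%:E)).

Lemma kappaE : \int[mu]_x ((x ^+ 2)%:E * (phi x)%:E) = kappa%:E :> \bar R.
Proof.
rewrite fineK// ge0_fin_numE ?phi_sqr_lty//.
by apply: integral_ge0 => x _; rewrite mule_ge0// lee_fin ?sqr_ge0 ?phi_ge0.
Qed.

Section pair_of_processes.
Variables (a b : nat -> {RV P >-> R}) (C : nat -> nat -> R).
Hypothesis gauss_a : gaussian_process a.
Hypothesis gauss_b : gaussian_process b.
Hypothesis centered_a : centered a.
Hypothesis centered_b : centered b.
Hypothesis indep_ab : independent_processes a b.
Hypothesis cov_a : forall k l, (1 <= k)%N -> (1 <= l)%N ->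
  'E_P[(a k \* a l)%R] = (C k l)%:E.
Hypothesis cov_b : forall k l, (1 <= k)%N -> (1 <= l)%N ->
  'E_P[(b k \* b l)%R] = (C k l)%:E.
Hypothesis C11 : C 1%N 1%N != 0%R.

(** Centring forces the mean of the Gaussian law to be 0, and the covariance determines its scale up
    to [kappa]. *)
Let lincomb_law X (gX : gaussian_process X) (cX : centered X)
    (covX : forall k l, (1 <= k)%N -> (1 <= l)%N ->
      'E_P[(X k \* X l)%R] = (C k l)%:E) n c :
  exists s, normal_law P (lincomb X n c) 0 s /\
    (quad C n c = s ^+ 2 * kappa)%R.
Proof.
have [m [s ms]] := gaussian_normal_law (measurable_lincomb X n c) (gX n c).
have m0 : m = 0%R.
  have := normal_law_mean ms; rewrite (lincomb_mean cX covX).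
  by case.
rewrite m0 in ms; exists s; split => //.
have := normal_law_sqr ms; rewrite (lincomb_sqr covX) kappaE -EFinM.
by case.
Qed.

(** Read off the process instead of the Gaussian integral: the second moment of [a 1] is C 1 1 <> 0,
    and it is also a square times [kappa]. *)
Lemma kappa_gt0 : (0 < kappa)%R.
Proof.
have [s [_]] := lincomb_law gauss_a centered_a cov_a 1 (fun=> 1%R).
rewrite /quad !big_nat1 !mul1r => h.
rewrite lt0r; apply/andP; split.
  by apply/eqP => k0; move: C11; rewrite h k0 mulr0 eqxx.
apply/fine_ge0/integral_ge0 => x _.
by rewrite mule_ge0// lee_fin ?sqr_ge0 ?phi_ge0.
Qed.

Definition lincomb2 n (c e : nat -> R) (w : Omega) : R :=
  (lincomb a n c w + lincomb b n e w)%R.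

Lemma lincomb2_law n c e : normal_law P (lincomb2 n c e) 0
  (Num.sqrt ((quad C n c + quad C n e) / kappa)).
Proof.
have [s [hs qs]] := lincomb_law gauss_a centered_a cov_a n c.
have [t [ht qt]] := lincomb_law gauss_b centered_b cov_b n e.
have -> : ((quad C n c + quad C n e) / kappa = s ^+ 2 + t ^+ 2)%R.
  by rewrite qs qt -mulrDl mulfK// gt_eqF// kappa_gt0.
pose mU := isMeasurableFun.Build _ _ _ _ _ (measurable_lincomb a n c).
pose U : {RV P >-> R} := HB.pack (lincomb a n c) mU.
pose mV := isMeasurableFun.Build _ _ _ _ _ (measurable_lincomb b n e).
pose V : {RV P >-> R} := HB.pack (lincomb b n e) mV.
apply: (@normal_law_add _ _ _ _ U V) => // A B mA mB.
by apply: indep_ab; exact: lincomb_sigma_algebra.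
Qed.

End pair_of_processes.
End process_combinations.

(** * Derivatives, measurability and the kernel of the orthant integral *)

Section derivatives.
Context {R : realType}.
Implicit Types (f g : R -> R) (x a b c : R).

Lemma isd_cst c x : is_derive x 1 (fun=> c : R) 0.
Proof. exact: is_derive_cst. Qed.

Lemma isd_id x : is_derive x 1 (fun t : R => t) 1.
Proof. exact: is_derive_id. Qed.

Lemma isdD f g x a b : is_derive x 1 f a -> is_derive x 1 g b ->
  is_derive x 1 (fun t => f t + g t) (a + b).
Proof. by move=> *; exact: is_deriveD. Qed.

Lemma isdN f x a : is_derive x 1 f a -> is_derive x 1 (fun t => - f t) (- a).
Proof. by move=> *; exact: is_deriveN. Qed.

Lemma isdM f g x a b : is_derive x 1 f a -> is_derive x 1 g b ->
  is_derive x 1 (fun t => f t * g t) (f x * b + g x * a).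
Proof. by move=> *; exact: is_deriveM. Qed.

Lemma isd_comp f g x a b : is_derive (g x) 1 f a -> is_derive x 1 g b ->
  is_derive x 1 (fun t => f (g t)) (a * b).
Proof. by move=> hf hg; exact: is_derive1_comp. Qed.

Lemma isdX f n x a : is_derive x 1 f a ->
  is_derive x 1 (fun t => f t ^+ n) (n%:R * f x ^+ n.-1 * a).
Proof.
move=> hf; have -> : (fun t => f t ^+ n) = f ^+ n.
  by apply/funext => t; elim: n => // n IH; rewrite !exprS IH.
exact: is_deriveX.
Qed.

Lemma isdV f x a : f x != 0 -> is_derive x 1 f a ->
  is_derive x 1 (fun t => (f t)^-1) (- (f x ^- 2) * a).
Proof.
move=> fx0 [df fa]; apply: DeriveDef; first exact: derivableV.
by rewrite deriveV// fa.
Qed.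

Lemma isd_sin f x a : is_derive x 1 f a ->
  is_derive x 1 (fun t => sin (f t)) (cos (f x) * a).
Proof. by move=> hf; apply: (isd_comp (f := sin)). Qed.

Lemma isd_cos f x a : is_derive x 1 f a ->
  is_derive x 1 (fun t => cos (f t)) (- sin (f x) * a).
Proof. by move=> hf; apply: (isd_comp (f := cos)). Qed.

Lemma isd_atan f x a : is_derive x 1 f a ->
  is_derive x 1 (fun t => atan (f t)) ((1 + f x ^+ 2)^-1 * a).
Proof. by move=> hf; apply: (isd_comp (f := atan)). Qed.

Lemma isd_ln f x a : 0 < f x -> is_derive x 1 f a ->
  is_derive x 1 (fun t => ln (f t)) ((f x)^-1 * a).
Proof. by move=> fx0 hf; apply: (isd_comp (f := @ln R)) => //; exact: is_derive1_ln. Qed.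

Lemma isd_continuous f x a : is_derive x 1 f a -> {for x, continuous f}.
Proof.
by move=> [df _]; apply: differentiable_continuous; exact/derivable1_diffP.
Qed.

End derivatives.

(** Differentiates by recursion on the syntax of the function; nonvanishing or positivity conditions
    for inverses and logarithms remain as goals. [isde] allows the derivative to be given in another
    form. *)
Ltac isd := cbv beta; lazymatch goal with
  | |- is_derive _ _ (fun _ => ?c) _ => exact: isd_cst
  | |- is_derive _ _ (fun t => t) _ => exact: isd_id
  | |- is_derive _ _ (fun t => (@?f t + @?g t)%R) _ =>
      notypeclasses refine (@isdD _ f g _ _ _ _ _); isd
  | |- is_derive _ _ (fun t => (- @?f t)%R) _ =>
      notypeclasses refine (@isdN _ f _ _ _); isd
  | |- is_derive _ _ (fun t => (@?f t * @?g t)%R) _ =>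
      notypeclasses refine (@isdM _ f g _ _ _ _ _); isd
  | |- is_derive _ _ (fun t => (@?f t ^+ ?n)%R) _ =>
      notypeclasses refine (@isdX _ f n _ _ _); isd
  | |- is_derive _ _ (fun t => ((@?f t)^-1)%R) _ =>
      notypeclasses refine (@isdV _ f _ _ _ _); [..|isd]
  | |- is_derive _ _ (fun t => sin (@?f t)) _ =>
      notypeclasses refine (@isd_sin _ f _ _ _); isd
  | |- is_derive _ _ (fun t => cos (@?f t)) _ =>
      notypeclasses refine (@isd_cos _ f _ _ _); isd
  | |- is_derive _ _ (fun t => atan (@?f t)) _ =>
      notypeclasses refine (@isd_atan _ f _ _ _); isd
  | |- is_derive _ _ (fun t => ln (@?f t)) _ =>
      notypeclasses refine (@isd_ln _ f _ _ _ _); [..|isd]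
  | |- _ => idtac
  end.

Ltac isde := eapply is_derive_eq; first isd; cbv beta.

Section ftc.
Context {R : realType}.
Local Notation mu := (@lebesgue_measure R).
Local Open Scope ereal_scope.

Lemma integral_is_derive (f F : R -> R) (a b : R) : (a <= b)%R ->
  (forall x, (a <= x <= b)%R -> is_derive x 1%R F (f x)) ->
  (forall x, (a <= x <= b)%R -> {for x, continuous f}) ->
  \int[mu]_(x in `[a, b]) (f x)%:E = (F b - F a)%:E.
Proof.
move=> ab dF cf; move: (ab); rewrite le_eqVlt => /predU1P[abE|ltab].
  by rewrite abE set_itv1 integral_set1 subrr.
rewrite (@continuous_FTC2 _ f F)//.
- apply: continuous_in_subspaceT => x /[!inE]/=; rewrite in_itv/=; exact: cf.
- split.
  + by move=> x; rewrite in_itv/= => /andP[ax xb]; have [] := dF x;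
      rewrite ?(ltW ax) ?(ltW xb).
  + apply: cvg_at_right_filter; apply: (isd_continuous (a := f a)).
    by apply: dF; rewrite lexx.
  + apply: cvg_at_left_filter; apply: (isd_continuous (a := f b)).
    by apply: dF; rewrite lexx ab.
- move=> x; rewrite in_itv/= => /andP[ax xb]; rewrite derive1E.
  by have [] := dF x; rewrite ?(ltW ax) ?(ltW xb).
Qed.

End ftc.

Section measurability.
Context {R : realType} d (T : measurableType d).
Implicit Types (f : T -> R).

Lemma measurable_inv : measurable_fun setT (GRing.inv : R -> R).
Proof.
rewrite -(setUv [set 0 : R]); apply/measurable_funU => //.
  exact: measurableC.
split; first exact: measurable_fun_set1.
apply: open_continuous_measurable_fun; first exact/closed_openC/closed_eq.
by move=> x /[!inE]/= /eqP x0; exact: inv_continuous.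
Qed.

Lemma measfV f : measurable_fun setT f -> measurable_fun setT (fun x => (f x)^-1).
Proof. exact: (measurableT_comp measurable_inv). Qed.

Lemma measf_sin f : measurable_fun setT f ->
  measurable_fun setT (fun x => sin (f x)).
Proof.
apply: (measurableT_comp (f := sin)); apply: continuous_measurable_fun.
exact: continuous_sin.
Qed.

Lemma measf_cos f : measurable_fun setT f ->
  measurable_fun setT (fun x => cos (f x)).
Proof.
apply: (measurableT_comp (f := cos)); apply: continuous_measurable_fun.
exact: continuous_cos.
Qed.

Lemma measf_ln f : measurable_fun setT f -> measurable_fun setT (fun x => ln (f x)).
Proof. exact: (measurableT_comp (@measurable_ln R)). Qed.

Lemma measf_sqrt f : measurable_fun setT f ->
  measurable_fun setT (fun x => Num.sqrt (f x)).
Proof.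
have msq : measurable_fun setT (Num.sqrt : R -> R).
  by apply: continuous_measurable_fun; exact: sqrt_continuous.
exact: (measurableT_comp msq).
Qed.

Lemma measf_norm f : measurable_fun setT f -> measurable_fun setT (fun x => `|f x|).
Proof. exact: (measurableT_comp (@normr_measurable R setT)). Qed.

End measurability.

Ltac meas := cbv beta; lazymatch goal with
  | |- measurable_fun _ (fun _ => ?c) => exact: measurable_cst
  | |- measurable_fun _ (fun x => EFin (@?f x)) =>
      apply/measurable_EFinP; change (measurable_fun setT f); meas
  | |- measurable_fun _ (fun x => x) => exact: measurable_id
  | |- measurable_fun _ (fun x => fst x) => exact: measurable_fst
  | |- measurable_fun _ (fun x => snd x) => exact: measurable_snd
  | |- measurable_fun _ (fun x => (@?f x + - @?g x)%R) =>
      refine (@measurable_funB _ _ _ _ f g _ _); meas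
  | |- measurable_fun _ (fun x => (@?f x + @?g x)%R) =>
      refine (@measurable_funD _ _ _ _ f g _ _); meas
  | |- measurable_fun _ (fun x => (- @?f x)%R) =>
      refine (@measurable_funN _ _ _ _ f _); meas
  | |- measurable_fun _ (fun x => (@?f x * @?g x)%R) =>
      refine (@measurable_funM _ _ _ _ f g _ _); meas
  | |- measurable_fun _ (fun x => (@?f x ^+ ?n)%R) =>
      refine (@measurable_funX _ _ _ _ f n _); meas
  | |- measurable_fun _ (fun x => ((@?f x)^-1)%R) =>
      refine (@measfV _ _ _ f _); meas
  | |- measurable_fun _ (fun x => sin (@?f x)) =>
      refine (@measf_sin _ _ _ f _); meas
  | |- measurable_fun _ (fun x => cos (@?f x)) =>
      refine (@measf_cos _ _ _ f _); meas
  | |- measurable_fun _ (fun x => ln (@?f x)) =>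
      refine (@measf_ln _ _ _ f _); meas
  | |- measurable_fun _ (fun x => Num.sqrt (@?f x)) =>
      refine (@measf_sqrt _ _ _ f _); meas
  | |- measurable_fun _ (fun x => Num.norm (@?f x)) =>
      refine (@measf_norm _ _ _ f _); meas
  | |- _ => idtac
  end.

Section sheppard_kernel.
Context {R : realType}.
Local Notation mu := (@lebesgue_measure R).

(** The derivative in [s] of [lnker (sin s) t] and, in [t], of a sum of two arctangents: integrating
    it in both orders evaluates the integral of [lnker]. *)
Definition ker (s t : R) : R :=
  cos s / (1 + 2 * t * sin s + t ^+ 2) + cos s / (1 - 2 * t * sin s + t ^+ 2).

(** For standard Gaussians X and Y of correlation [r], the expectation of ln |(X + t Y) / (X - t Y)|
    / t. *)
Definition lnker (r t : R) : R :=
  ln ((1 + 2 * t * r + t ^+ 2) / (1 - 2 * t * r + t ^+ 2)) / (2 * t).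

Lemma den_plus (s t : R) :
  1 + 2 * t * sin s + t ^+ 2 = cos s ^+ 2 + (t + sin s) ^+ 2.
Proof. by have := cos2Dsin2 s; nra. Qed.

Lemma den_minus (s t : R) :
  1 - 2 * t * sin s + t ^+ 2 = cos s ^+ 2 + (t - sin s) ^+ 2.
Proof. by have := cos2Dsin2 s; nra. Qed.

Lemma cos_gt0_itv (s : R) : 0 <= s < pi / 2 -> 0 < cos s.
Proof.
move=> /andP[s0 sp]; apply: cos_gt0_pihalf; rewrite sp andbT.
by apply: lt_le_trans s0; rewrite oppr_lt0 divr_gt0 ?pi_gt0.
Qed.

Lemma cos_ge0_itv (s : R) : 0 <= s <= pi / 2 -> 0 <= cos s.
Proof.
move=> /andP[s0 sp]; apply: cos_ge0_pihalf; rewrite sp andbT.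
by apply: le_trans s0; rewrite oppr_le0 divr_ge0 ?pi_ge0.
Qed.

Lemma ker_ge0 (s t : R) : 0 <= s <= pi / 2 -> 0 <= ker s t.
Proof.
by move=> sp; rewrite /ker addr_ge0// divr_ge0 ?cos_ge0_itv// ?den_plus ?den_minus
  addr_ge0// sqr_ge0.
Qed.

(** The antiderivative, a sum of two arctangents with opposite shifts, vanishes at 0 and tends to pi
    / 2 + pi / 2. *)
Lemma integral_ker_t (s : R) : 0 <= s < pi / 2 ->
  (\int[mu]_(t in `[0%R, +oo[) (ker s t)%:E = pi%:E)%E.
Proof.
move=> sp; have cs := cos_gt0_itv sp.
have spw : 0 <= s <= pi / 2 by case/andP: sp => -> /ltW.
have dp t : 0 < 1 + 2 * t * sin s + t ^+ 2.
  by rewrite den_plus ltr_pwDl ?sqr_ge0// exprn_gt0.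
have dm t : 0 < 1 - 2 * t * sin s + t ^+ 2.
  by rewrite den_minus ltr_pwDl ?sqr_ge0// exprn_gt0.
pose F t := atan ((t + sin s) / cos s) + atan ((t - sin s) / cos s).
have dF (t : R) : is_derive t 1 F (ker s t).
  rewrite /F; isde; rewrite /ker den_plus den_minus; field.
  have h u : cos s ^+ 2 + u ^+ 2 != 0.
    by rewrite gt_eqF// ltr_pwDl ?sqr_ge0// exprn_gt0.
  by rewrite !h gt_eqF.
have dk (t : R) : exists d, is_derive t 1 (ker s) d.
  by eexists; rewrite /ker; isd; rewrite gt_eqF.
rewrite (@ge0_continuous_FTC2y _ _ F _ pi).
- by rewrite /F add0r sub0r mulNr atanN subrr sube0.
- by move=> t _; exact: ker_ge0.
- apply: continuous_subspaceT => t.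
  by have [d hd] := dk t; exact: isd_continuous hd.
- rewrite [X in _ --> X](_ : _ = pi / 2 + pi / 2); last by rewrite -splitr.
  have h u : (fun t => (t + u) / cos s) t @[t --> +oo] --> +oo.
    apply: gt0_cvgMly; first by rewrite invr_gt0.
    exact: cvg_addrr.
  by apply: cvgD; (apply: cvg_comp; [exact: h|exact: cvgy_atan]).
- by move=> t _; have [] := dF t.
- by apply: cvg_at_right_filter; exact: (isd_continuous (dF 0)).
- by move=> t _; rewrite derive1E; have [] := dF t.
Qed.

(** The hypothesis on the denominator excludes only t = 1 with b = pi / 2. The denominator decreases
    in [s], so its positivity at [b] gives positivity on [0, b]. *)
Lemma integral_ker_s (b t : R) : 0 <= b <= pi / 2 -> 0 < t ->
  0 < 1 - 2 * t * sin b + t ^+ 2 ->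
  (\int[mu]_(s in `[0%R, b]) (ker s t)%:E = (lnker (sin b) t)%:E)%E.
Proof.
move=> /andP[b0 bp] t0 db.
have sp s : 0 <= s <= b -> 0 <= s <= pi / 2.
  by case/andP => -> /le_trans; apply.
have ss s : 0 <= s <= b -> 0 <= sin s <= sin b.
  move=> sb; have := sp _ sb => /andP[s0 sp2].
  have p0 := @pi_ge0 R.
  rewrite sin_ge0_pi ?s0/=; last by lra.
  case/andP: sb => _ sb; rewrite leNgt ltr_sin -?leNgt// in_itv/=; lra.
have dp s : 0 <= s <= b -> 0 < 1 + 2 * t * sin s + t ^+ 2.
  move=> /ss /andP[h _]; have := mulr_ge0 (ltW t0) h; have := sqr_ge0 t; nra.
have dm s : 0 <= s <= b -> 0 < 1 - 2 * t * sin s + t ^+ 2.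
  by move=> /ss /andP[_ h]; apply: lt_le_trans db _; rewrite lerD2r lerD2l lerN2;
    rewrite ler_wpM2l// mulr_ge0// ltW.
pose F s := (ln (1 + 2 * t * sin s + t ^+ 2)
  - ln (1 - 2 * t * sin s + t ^+ 2)) / (2 * t).
transitivity (F b - F 0)%:E; last first.
  rewrite /F sin0 mulr0 addr0 subr0 subrr mul0r subr0 /lnker ln_div//.
  by rewrite posrE dp// b0 lexx.
apply: integral_is_derive => //.
- move=> s sb; rewrite /F; isde; rewrite ?dp ?dm// /ker; field.
  by rewrite !gt_eqF ?dp ?dm.
- move=> s sb; suff [e he] : exists e, is_derive s (1 : R) (ker ^~ t) e.
    exact: isd_continuous he.
  by eexists; rewrite /ker; isd; rewrite gt_eqF ?dp ?dm.
Qed.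

Lemma measurable_ker : measurable_fun setT (fun p : R * R => ker p.1 p.2).
Proof. by rewrite /ker; meas. Qed.

Lemma measurable_lnker d (T : measurableType d) (f g : T -> R) :
  measurable_fun setT f -> measurable_fun setT g ->
  measurable_fun setT (fun x => lnker (f x) (g x)).
Proof. by move=> mf mg; rewrite /lnker; meas. Qed.

(** Once [lnker] is written as an integral of [ker] in [s] and the order is exchanged, each [s]
    contributes pi. The endpoint b = pi / 2 is included because it yields the deterministic integral
    of [lnratio]. *)
Lemma integral_lnker (b : R) : 0 <= b <= pi / 2 ->
  (\int[mu]_(t in `[0%R, +oo[) (lnker (sin b) t)%:E = (pi * b)%:E)%E.
Proof.
move=> b0p; have /andP[b0 bp] := b0p.
(* Two null points are removed: t = 0, where [lnker] divides by 2 t, and t = 1, where the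
   denominator vanishes when b = pi / 2. *)
pose D : set R := `]0, +oo[%classic `\ 1.
have mD : measurable D by exact: measurableD.
have mln A : measurable_fun A (fun t => (lnker (sin b) t)%:E).
  by apply: measurable_funTS; apply/measurable_EFinP; exact: measurable_lnker.
rewrite -integral_itv_obnd_cbnd// -(@integral_setD1 _ _ 1)// -/D.
have Dt t : D t -> 0 < t by case; rewrite /= in_itv/= andbT.
have sb s : s \in (`[0, b]%classic : set R) -> 0 <= s <= pi / 2.
  by rewrite inE/= in_itv/= => /andP[-> /le_trans]; apply.
(* [ker] is known to be nonnegative only for [s] in [0, pi / 2]; the absolute value makes Tonelli's
   theorem applicable on the whole plane. *)
pose k (p : R * R) := `|(ker p.1 p.2)%:E|%E.
have mk : measurable_fun setT k.
  apply: measurableT_comp => //; apply/measurable_EFinP; exact: measurable_ker.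
have kE s t : s \in (`[0, b]%classic : set R) -> k (s, t) = (ker s t)%:E.
  by move=> /sb sp; rewrite /k/= ger0_norm// ker_ge0.
transitivity (\int[mu]_(t in D) \int[mu]_(s in `[0%R, b]) k (s, t))%E.
  apply: eq_integral => t /[!inE] -[t0 t1].
  have {}t0 : 0 < t by move: t0; rewrite /= in_itv/= andbT.
  rewrite -integral_ker_s//; last first.
    rewrite den_minus; have [bp2|bp2] := eqVneq b (pi / 2).
      rewrite bp2 cos_pihalf sin_pihalf expr0n add0r exprn_even_gt0//=.
      by rewrite subr_eq0; apply/eqP.
    rewrite ltr_pwDl ?sqr_ge0// exprn_gt0// cos_gt0_itv// b0/=.
    by rewrite lt_neqAle bp2.
  by apply: eq_integral => s /kE ->.
rewrite -(@ge0_fubini_setX _ _ _ _ _ mu mu)//; last first.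
  by move=> p; exact: abse_ge0.
have mF : measurable_fun setT (fun s => \int[mu]_(t in D) k (s, t))%E.
  by apply: measurable_integral_section => // p; exact: abse_ge0.
(* The point s = b is dropped since [integral_ker_t] requires s < pi / 2. *)
rewrite -integral_itv_bndo_bndc; last exact: measurable_funTS.
transitivity (\int[mu]_(s in `[0%R, b[) (pi%:E : \bar R))%E.
  apply: eq_integral => s; rewrite inE/= in_itv/= => /andP[s0 sb'].
  rewrite -(@integral_ker_t s); last by rewrite s0 (lt_le_trans sb').
  have mks A : measurable_fun A (fun t => (ker s t)%:E).
    by apply: measurable_funTS; rewrite /ker; meas.
  rewrite -[RHS]integral_itv_obnd_cbnd// -[RHS](@integral_setD1 _ _ 1)// -/D.
  by apply: eq_integral => t _; apply: kE; rewrite inE/= in_itv/= s0 ltW.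
rewrite integral_cst//= lebesgue_measure_itv/= lte_fin.
move: b0; rewrite le_eqVlt => /predU1P[<-|->]; last by rewrite oppr0 adde0 EFinM.
by rewrite ltxx mulr0 mule0.
Qed.

End sheppard_kernel.

(** * Logarithmic moments *)

Section log_ratio.
Context {R : realType}.
Local Notation mu := (@lebesgue_measure R).

Definition lnratio (x y t : R) : R := ln `|(x + t * y) / (x - t * y)| / t.

Lemma ln_normV (x : R) : ln `|x^-1| = - ln `|x|.
Proof.
have [->|x0] := eqVneq x 0; first by rewrite invr0 normr0 ln0// oppr0.
by rewrite normfV lnV// posrE normr_gt0.
Qed.

Lemma ln_sqr (x : R) : ln (x ^+ 2) = 2 * ln `|x|.
Proof.
have [->|x0] := eqVneq x 0; first by rewrite expr0n normr0 ln0// mulr0.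
by rewrite -(real_normK (num_real x)) lnXn ?normr_gt0// mulr_natl.
Qed.

(** The pair (1, 1) is the case of correlation 1, so its integral is that of the kernel at b = pi /
    2. *)
Lemma lnratio1 (t : R) : lnratio 1 1 t = lnker (sin (pi / 2)) t.
Proof.
rewrite /lnratio /lnker sin_pihalf !mulr1.
have -> : (1 + 2 * t + t ^+ 2) / (1 - 2 * t + t ^+ 2) = ((1 + t) / (1 - t)) ^+ 2.
  by rewrite expr_div_n; congr (_ / _); ring.
by rewrite ln_sqr; have [->|t0] := eqVneq t 0; [rewrite mulr0 invr0 !mulr0|field].
Qed.

Lemma lnratio1_ge0 (t : R) : 0 <= t -> 0 <= lnratio 1 1 t.
Proof.
move=> t0; rewrite /lnratio !mulr1 divr_ge0//.
have [->|t1] := eqVneq t 1; first by rewrite subrr invr0 mulr0 normr0 ln0.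
rewrite ln_ge0// normrM normfV ler_pdivlMr ?normr_gt0 ?subr_eq0 1?eq_sym//.
by rewrite mul1r [leRHS]ger0_norm ?ler_norml; lra.
Qed.

(** By homogeneity [lnratio x y] is [lnratio 1 1] rescaled by y / x; since dt / t is invariant under
    scaling, its integral depends only on the sign of y / x. *)
Lemma lnratio_homo (x y t : R) : x != 0 ->
  lnratio x y t = y / x * lnratio 1 1 (y / x * t).
Proof.
move=> x0; rewrite /lnratio !mulr1.
have [->|y0] := eqVneq y 0.
  by rewrite !mul0r !mulr0 addr0 subr0 divff// normr1 ln1 mul0r.
have [->|t0] := eqVneq t 0; first by rewrite !(mulr0, invr0).
have -> : (x + t * y) / (x - t * y) = (1 + y / x * t) / (1 - y / x * t).
  have -> : x + t * y = x * (1 + y / x * t) by field.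
  have -> : x - t * y = x * (1 - y / x * t) by field.
  by rewrite -mulf_div divff// mul1r.
by field; rewrite x0 y0 t0.
Qed.

Lemma lnratioN (x y t : R) : lnratio x (- y) t = - lnratio x y t.
Proof.
by rewrite /lnratio mulrN opprK -(invf_div (x + t * y)) ln_normV mulNr.
Qed.

Lemma measurable_lnratio d (T : measurableType d) (f g h : T -> R) :
  measurable_fun setT f -> measurable_fun setT g -> measurable_fun setT h ->
  measurable_fun setT (fun x => lnratio (f x) (g x) (h x)).
Proof. by move=> mf mg mh; rewrite /lnratio; meas. Qed.

Local Open Scope ereal_scope.

Lemma integral_lnratio_pos (x y : R) : (0 < x * y)%R ->
  \int[mu]_(t in `[0%R, +oo[) (lnratio x y t)%:E = (pi * (pi / 2))%:E.
Proof.
move=> xy; have x0 : x != 0%R by apply: contraTN xy => /eqP ->; rewrite mul0r ltxx.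
have q0 : (0 < y / x)%R.
  by rewrite -(@pmulr_lgt0 _ (x ^+ 2)) ?exprn_even_gt0// expr2 mulrA divfK// mulrC.
rewrite -(@integral_lnker _ (pi / 2)); last by rewrite lexx divr_ge0 ?pi_ge0.
pose L : R -> \bar R := (fun t => (lnker (sin (pi / 2)) t)%:E) \_ `[0%R, +oo[.
have mL : measurable_fun setT L.
  apply/(measurable_restrictT _ _).1 => //; apply: measurable_funTS.
  by apply/measurable_EFinP; exact: measurable_lnker.
have L0 t : 0 <= L t.
  rewrite erestrict_ge0// => u; rewrite /= in_itv/= andbT => u0.
  by rewrite lee_fin -lnratio1 lnratio1_ge0.
rewrite [RHS]integral_mkcond -/L (@ge0_integral_affine _ (y / x) 0 L)//; last first.
  by rewrite gt_eqF.
rewrite -ge0_integralZl//; last by apply: (measurableT_comp mL); meas.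
rewrite [LHS]integral_mkcond; apply: eq_integral => t _.
have LE (u : R) (h : R -> \bar R) :
    (h \_ (`[0%R, +oo[%classic : set R)) u = if (0 <= u)%R then h u else 0.
  by rewrite /patch mem_setE/= in_itv/= andbT.
rewrite addr0 [LHS]LE [L _]LE pmulr_rge0//.
case: ifPn => _; last by rewrite mule0.
by rewrite -EFinM lnratio_homo// lnratio1 gtr0_norm.
Qed.

Lemma integral_lnratio (x y : R) :
  \int[mu]_(t in `[0%R, +oo[) (lnratio x y t)%:E =
  (Num.sg (x * y) * (pi * (pi / 2)))%:E.
Proof.
have [xy|xy|xy0] := ltgtP (x * y)%R 0%R.
- rewrite ltr0_sg// mulN1r EFinN -(@integral_lnratio_pos x (- y)).
    rewrite -integral_ge0N.
      by apply: eq_integral => t _; rewrite -EFinN lnratioN opprK.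
    move=> t; rewrite /= in_itv/= andbT => t0; rewrite lee_fin.
    have x0 : x != 0%R by apply: contraTN xy => /eqP ->; rewrite mul0r ltxx.
    have q0 : (0 < (- y) / x)%R.
      rewrite -(@pmulr_lgt0 _ (x ^+ 2)) ?exprn_even_gt0// expr2 mulrA divfK//.
      by rewrite mulNr oppr_gt0 mulrC.
    by rewrite lnratio_homo// mulr_ge0 ?(ltW q0)// lnratio1_ge0// mulr_ge0// ltW.
  by rewrite mulrN oppr_gt0.
- by rewrite gtr0_sg// mul1r integral_lnratio_pos.
(* For x = 0 the quotient is -1, or 0 by the convention on division; the logarithm of its modulus is
   0 in both cases, as ln 0 = 0 here. *)
- rewrite xy0 sgr0 mul0r; apply: integral0_eq => t _; congr EFin.
  have [x0|x0] := eqVneq x 0%R.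
    rewrite /lnratio x0 add0r sub0r invrN mulrN normrN.
    have [ty|ty] := eqVneq (t * y)%R 0%R.
      by rewrite ty mul0r normr0 ln0// mul0r.
    by rewrite divff// normr1 ln1 mul0r.
  rewrite lnratio_homo//; suff -> : y = 0%R by rewrite !mul0r.
  by move/eqP: xy0; rewrite mulf_eq0 (negbTE x0) => /eqP.
Qed.

(** For fixed [x] and [y] the sign of [lnratio] is constant in t >= 0, so the absolute value costs
    nothing. This bound, uniform in [x] and [y], makes Fubini's theorem applicable in
    [orthant_probability]. *)
Lemma integral_abs_lnratio (x y : R) :
  \int[mu]_(t in `[0%R, +oo[) `|(lnratio x y t)%:E| <= (pi * (pi / 2))%:E.
Proof.
have p0 : (0 <= pi * (pi / 2) :> R)%R by rewrite mulr_ge0 ?divr_ge0 ?pi_ge0.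
have [x0|x0] := eqVneq x 0%R.
  rewrite integral0_eq ?lee_fin// => t _.
  rewrite /lnratio x0 add0r sub0r invrN mulrN normrN.
  have [ty|ty] := eqVneq (t * y)%R 0%R.
    by rewrite ty mul0r normr0 ln0// mul0r abse0.
  by rewrite divff// normr1 ln1 mul0r abse0.
have h (u v : R) : u != 0%R -> (0 <= v / u)%R ->
    \int[mu]_(t in `[0%R, +oo[) `|(lnratio u v t)%:E| <= (pi * (pi / 2))%:E.
  move=> u0 vu.
  under eq_integral => t.
    rewrite inE/= in_itv/= andbT => t0.
    rewrite ger0_norm; last first.
      by rewrite lnratio_homo// mulr_ge0// lnratio1_ge0// mulr_ge0.
    over.
  rewrite integral_lnratio lee_fin ler_piMl//.
  by case: sgrP.
have [q0|q0] := leP 0%R (y / x)%R; first exact: h.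
under eq_integral do rewrite -abseN -EFinN -lnratioN.
by apply: h => //; rewrite mulNr oppr_ge0 ltW.
Qed.

End log_ratio.

Section log_moment.
Context {R : realType}.
Local Notation mu := (@lebesgue_measure R).
Local Open Scope ereal_scope.

(* [ln ((1 + t) / (1 - t)) / t >= - ln (1 - t)] on ]0, 1[, so the integrability
   of the former at [1] yields that of [ln] at [0]. *)
Lemma integral_abs_ln01 :
  \int[mu]_(x in `]0%R, 1%R[) `|(ln x)%:E| < +oo.
Proof.
have mln : measurable_fun setT (fun x : R => `|(ln x)%:E|).
  by apply: measurableT_comp => //; meas.
pose h : R -> \bar R := (fun x => `|(ln x)%:E|) \_ `]0%R, 1%R[.
have mh : measurable_fun setT h.
  by apply/(measurable_restrictT _ _).1 => //; exact: measurable_funTS.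
have h0 x : 0 <= h x by rewrite erestrict_ge0.
rewrite integral_mkcond -/h (@ge0_integral_affine _ (-1) 1 h)//.
rewrite normrN1 mul1e.
apply: (@le_lt_trans _ _ (\int[mu]_(t in `[0%R, +oo[) (lnratio 1 1 t)%:E)); last first.
  by rewrite integral_lnratio ltry.
rewrite [leRHS]integral_mkcond; apply: ge0_le_integral_nomeas => t _ //.
rewrite /h /patch !mem_setE/= !in_itv/= mulN1r andbT.
case: ifPn => [/andP[t1 t0]|_]; last first.
  by case: ifPn => // t0; rewrite lee_fin lnratio1_ge0.
have {}t1 : (t < 1)%R by lra.
have {}t0 : (0 < t)%R by lra.
rewrite (ltW t0) lee_fin ler0_norm; last by rewrite ln_le0//; lra.
rewrite /lnratio !mulr1 ger0_norm; last by rewrite divr_ge0//; lra.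
rewrite ln_div ?posrE; [|lra|lra].
rewrite ler_pdivlMr// (addrC (- t)%R).
have h1 : (0 <= - ln (1 - t))%R by rewrite oppr_ge0 ln_le0//; lra.
have h2 : (0 <= ln (1 + t))%R by rewrite ln_ge0//; lra.
nra.
Qed.

(** On |x| < 1 the density is bounded and [ln] is integrable at 0; for |x| >= 1, |ln |x|| <= x^2 and
    the second moment is finite. *)
Lemma integrable_ln_phi :
  mu.-integrable setT (fun x => (ln `|x| * phi x)%:E).
Proof.
apply/integrableP; split.
  by apply/measurable_EFinP; apply: measurable_funM; [meas|exact: measurable_phi].
pose h : R -> \bar R := (fun x => `|(ln x)%:E|) \_ `]0%R, 1%R[.
have mh : measurable_fun setT h.
  apply/(measurable_restrictT _ _).1 => //; apply: measurable_funTS.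
  by apply: measurableT_comp => //; meas.
have h0 x : 0 <= h x by rewrite erestrict_ge0.
have mx2 : measurable_fun setT (fun x : R => (x ^+ 2)%:E * (phi x)%:E).
  apply: emeasurable_funM; first by meas.
  by apply/measurable_EFinP; exact: measurable_phi.
have hE x : h x = if (0 < x < 1)%R then `|(ln x)%:E| else 0.
  by rewrite /h /patch mem_setE/= in_itv/=.
have Ih : \int[mu]_x h x < +oo.
  by rewrite /h -integral_mkcond integral_abs_ln01.
pose pk : R := normal_peak 1.
have pk0 : (0 <= pk)%R by exact: normal_peak_ge0.
have mhN : measurable_fun setT (fun x : R => h (- x)%R).
  by apply: (measurableT_comp mh); meas.
have mA : measurable_fun setT (fun x : R => pk%:E * (h x + h (- x)%R)).
  by apply: emeasurable_funM => //; exact: emeasurable_funD.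
apply: (@le_lt_trans _ _ (\int[mu]_x (pk%:E * (h x + h (- x)%R) +
    (x ^+ 2)%:E * (phi x)%:E))).
  apply: ge0_le_integral_nomeas => x _ //.
  rewrite !hE.
  have px := phi_ge0 x; have pp := phi_le_peak x; rewrite -/pk in pp.
  have x2 := sqr_ge0 x.
  have b2 : (0 <= x ^+ 2 * phi x)%R by exact: mulr_ge0.
  have -> : `|(ln `|x| * phi x)%:E| = (`|ln `|x| | * phi x)%:E.
    by rewrite /= normrM (ger0_norm px).
  rewrite -(EFinM (x ^+ 2)).
  have big (y : R) : (1 <= y)%R -> (`|ln y| <= y ^+ 2)%R.
    move=> y1; rewrite ger0_norm ?ln_ge0//.
    have := @ln_sublinear R y; nra.
  have small y : `|x|%R = y ->
      (`|ln `|x| | * phi x)%:E <= pk%:E * `|(ln y)%:E|.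
    by move=> <-; rewrite -EFinM lee_fin mulrC; exact: ler_wpM2r.
  have [x0|x0|->] := ltgtP x 0%R.
  - rewrite /= add0e oppr_gt0 x0/=.
    case: ifPn => x1.
      apply: (le_trans (small (- x)%R (ltr0_norm x0))).
      by rewrite leeDl// lee_fin.
    rewrite mule0 add0e lee_fin ler_wpM2r//.
    by rewrite (ltr0_norm x0) -sqrrN big// leNgt.
  - rewrite /= oppr_gt0 (lt_gtF x0)/= adde0.
    case: ifPn => x1.
      apply: (le_trans (small x (gtr0_norm x0))).
      by rewrite leeDl// lee_fin.
    rewrite mule0 add0e lee_fin ler_wpM2r//.
    by rewrite (gtr0_norm x0) big// leNgt.
  - rewrite normr0 ln0// normr0 mul0r oppr0 ltxx/= expr0n mul0r.
    by rewrite adde_ge0 ?mule_ge0 ?adde_ge0.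
rewrite ge0_integralD//; last 2 first.
- by move=> x _; rewrite mule_ge0 ?lee_fin// adde_ge0.
- by move=> x _; rewrite mule_ge0// lee_fin ?sqr_ge0 ?phi_ge0.
rewrite lte_add_pinfty ?phi_sqr_lty//.
rewrite ge0_integralZl//; last 2 first.
- exact: emeasurable_funD.
- by move=> x _; rewrite adde_ge0.
rewrite ge0_integralD// lte_mul_pinfty ?lee_fin// lte_add_pinfty//.
rewrite (@ge0_integral_affine _ (-1) 0 h) in Ih => //.
rewrite normrN1 mul1e in Ih; apply: le_lt_trans Ih.
by rewrite le_eqVlt; apply/orP; left; apply/eqP; apply: eq_integral => x _;
  rewrite mulN1r addr0.
Qed.

(** This constant cancels in E ln |U + t V| - E ln |U - t V|. *)
Definition ln_phi_mean : R := fine (\int[mu]_x (ln `|x| * phi x)%:E).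

Lemma ln_phi_meanE : \int[mu]_x (ln `|x| * phi x)%:E = ln_phi_mean%:E.
Proof.
by rewrite fineK//; apply: integrable_fin_num => //; exact: integrable_ln_phi.
Qed.

End log_moment.

(** * Probability of a sign change *)

Section normal_law_consequences.
Context d (Omega : measurableType d) (R : realType) (P : probability Omega R).
Local Notation mu := (@lebesgue_measure R).
Local Open Scope ereal_scope.

(** The density of [Z] is at most [normal_peak 1 / s], and the interval has length 2 e. *)
Lemma normal_law_small (Z : Omega -> R) (s e : R) : measurable_fun setT Z ->
  (0 < s)%R -> (0 <= e)%R -> normal_law P Z 0 s ->
  P [set w | `|Z w| <= e]%R <= (2 * normal_peak 1 / s * e)%:E.
Proof.
move=> mZ s0 e0 hZ.
pose h (x : measurableTypeR R) : \bar R := (\1_[set x : R | `|x| <= e]%R x)%:E.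
have mA : measurable [set x : R | (`|x| <= e)%R].
  rewrite (_ : [set _ | _] = `[(- e)%R, e]%classic)//.
  by apply/seteqP; split => x /=; rewrite in_itv/= ler_norml.
have mh : measurable_fun setT h.
  by apply/measurable_EFinP; exact: measurable_indic.
have -> : P [set w | `|Z w| <= e]%R = \int[P]_w h (Z w).
  rewrite -[X in P X](setIT) -integral_indic//.
  by rewrite -[X in measurable X]setTI; exact: (mZ measurableT _ mA).
have h0 x : 0 <= h x by rewrite lee_fin.
rewrite hZ//.
apply: (@le_trans _ _ (\int[mu]_(x in `[(- (e / s))%R, (e / s)%R]) (normal_peak 1)%:E)).
  rewrite [leRHS]integral_mkcond; apply: ge0_le_integral_nomeas => x _.
    by rewrite mule_ge0// lee_fin phi_ge0.
  have hE u : h u = (if `|u| <= e then 1 else 0)%R%:E.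
    rewrite /h indicE; case: ifPn => hu; first by rewrite mem_set.
    by rewrite memNset//; exact/negP.
  rewrite add0r hE /patch mem_setE/= in_itv/= -ler_norml.
  rewrite normrM (gtr0_norm s0) ler_pdivlMr// muleC (mulrC s).
  case: ifPn => _; last by rewrite mule0.
  by rewrite mule1 lee_fin phi_le_peak.
rewrite integral_cst//= lebesgue_measure_itv/= lte_fin.
have si0 : (0 <= s^-1)%R by rewrite invr_ge0 ltW.
have pk0 := @normal_peak_ge0 R 1.
case: ifPn => _; last by rewrite mule0 lee_fin !mulr_ge0.
by rewrite -EFinB -EFinM lee_fin le_eqVlt; apply/orP; left; apply/eqP; field; rewrite gt_eqF.
Qed.

Lemma normal_law_eq0 (Z : Omega -> R) (s : R) : measurable_fun setT Z ->
  (0 < s)%R -> normal_law P Z 0 s -> P [set w | Z w = 0%R] = 0.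
Proof.
move=> mZ s0 hZ; apply/eqP; rewrite -measure_le0.
have := normal_law_small mZ s0 (lexx _) hZ; rewrite mulr0.
rewrite (_ : [set _ | _] = [set w | Z w = 0%R])//.
by apply/seteqP; split => w /=; rewrite normr_le0 => /eqP.
Qed.

Lemma ae_neq0 (Z : Omega -> R) (s : R) : measurable_fun setT Z ->
  (0 < s)%R -> normal_law P Z 0 s -> {ae P, forall w, Z w != 0%R}.
Proof.
move=> mZ s0 hZ; exists [set w | Z w = 0%R]; split.
- rewrite (_ : [set _ | _] = setT `&` Z @^-1` [set 0%R]); last by rewrite setTI.
  exact: mZ.
- exact: normal_law_eq0 hZ.
- by move=> w /= /negP; rewrite negbK => /eqP.
Qed.

(** ln |s x| = ln s + ln |x| off the null point x = 0, where the convention ln 0 = 0 would break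
    it. *)
Lemma normal_law_ln (Z : Omega -> R) (s : R) : measurable_fun setT Z ->
  (0 < s)%R -> normal_law P Z 0 s ->
  P.-integrable setT (fun w => (ln `|Z w|)%:E) /\
  \int[P]_w (ln `|Z w|)%:E = (ln s + @ln_phi_mean R)%:E.
Proof.
move=> mZ s0 hZ.
have mphi := @measurable_phi R.
pose g (x : R) : R := (ln s * phi x + ln `|x| * phi x)%R.
have mg : measurable_fun setT (fun x => (g x)%:E).
  by apply/measurable_EFinP; apply: measurable_funD;
    apply: measurable_funM => //; meas.
have ig : mu.-integrable setT (fun x => (g x)%:E).
  under eq_fun do rewrite EFinD.
  apply: integrableD => //; last exact: integrable_ln_phi.
  under eq_fun do rewrite EFinM.
  by apply: integrableZl => //; exact: integrable_phi.
have hg x : x != 0%R -> (ln `|0 + s * x| * phi x = g x)%R.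
  move=> x0; rewrite add0r normrM lnM ?posrE ?normr_gt0 ?(gt_eqF s0)//.
  by rewrite mulrDl gtr0_norm.
have aex (Q : measurableTypeR R -> Prop) :
    (forall x, x != 0%R -> Q x) -> {ae mu, forall x, Q x}.
  move=> h; exists [set 0%R]; split => //; first exact: lebesgue_measure_set1.
  by move=> x /= nQ; apply: contrapT => /eqP x0; exact/nQ/h.
split.
  apply/integrableP; split.
    by apply/measurable_EFinP; apply: measf_ln; exact: measf_norm.
  rewrite (hZ (fun x => `|(ln `|x|)%:E|))//; last first.
    by apply: measurableT_comp => //; meas.
  have /integrableP[_] := ig; apply: le_lt_trans.
  rewrite le_eqVlt; apply/orP; left; apply/eqP.
  apply: ae_eq_integral => //.
  - apply: emeasurable_funM; last exact/measurable_EFinP.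
    by apply: measurableT_comp => //; meas.
  - exact: measurableT_comp.
  - apply: aex => x x0 _.
    by rewrite -(hg x x0) EFinM abseM (gee0_abs (x := (phi x)%:E))// lee_fin phi_ge0.
rewrite (normal_law_integral (h := fun x => ln `|x|) hZ); last by meas.
transitivity (\int[mu]_x (g x)%:E).
  apply: ae_eq_integral => //.
    apply: emeasurable_funM; last exact/measurable_EFinP.
    by meas.
  by apply: aex => x x0 _; rewrite -(hg x x0).
under eq_integral do rewrite EFinD.
rewrite integralD//=; last 2 first.
- under eq_fun do rewrite EFinM.
  by apply: integrableZl => //; exact: integrable_phi.
- exact: integrable_ln_phi.
rewrite ln_phi_meanE EFinD; congr (_ + _).
under eq_integral do rewrite EFinM.
by rewrite integralZl//; [rewrite integral_phi mule1|exact: integrable_phi].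
Qed.

End normal_law_consequences.

Section sheppard.
Context d (Omega : measurableType d) (R : realType) (P : probability Omega R).
Local Notation mu := (@lebesgue_measure R).
Local Open Scope ereal_scope.

(** [lnker (sin b) t] is odd in [b], which extends [integral_lnker] to negative correlations. *)
Lemma integral_lnker_asin (b : R) : (- (pi / 2) < b < pi / 2)%R ->
  \int[mu]_(t in `[0%R, +oo[) (lnker (sin b) t)%:E = (pi * b)%:E.
Proof.
move=> bp; have [b0|b0] := leP 0%R b.
  by rewrite integral_lnker// b0/=; case/andP: bp => _ /ltW.
have lnkerN t : lnker (sin b) t = (- lnker (sin (- b)) t)%R.
  have c0 : (0 < cos b)%R by rewrite cos_gt0_pihalf.
  have dp : (0 < 1 + 2 * t * sin b + t ^+ 2)%R.
    by rewrite den_plus ltr_pwDl ?sqr_ge0// exprn_gt0.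
  have dm : (0 < 1 - 2 * t * sin b + t ^+ 2)%R.
    by rewrite den_minus ltr_pwDl ?sqr_ge0// exprn_gt0.
  by rewrite /lnker sinN !mulrN opprK !ln_div ?posrE//; ring.
have nb : (0 <= - b <= pi / 2)%R by lra.
under eq_integral do rewrite lnkerN EFinN.
rewrite integral_ge0N ?integral_lnker//; first by rewrite mulrN EFinN oppeK.
move=> t; rewrite /= in_itv/= andbT => t0; rewrite lee_fin /lnker.
have s0 : (0 <= sin (- b))%R by rewrite sin_ge0_pi//; have := @pi_ge0 R; lra.
have c0 : (0 < cos (- b))%R by rewrite cosN cos_gt0_pihalf.
have d0 : (0 < 1 - 2 * t * sin (- b) + t ^+ 2)%R.
  by rewrite den_minus ltr_pwDl ?sqr_ge0// exprn_gt0.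
rewrite divr_ge0 ?mulr_ge0// ln_ge0// ler_pdivlMr// mul1r.
by rewrite lerD2r lerD2l; have := mulr_ge0 t0 s0; nra.
Qed.

(* [int_0^oo ln |(x + t y) / (x - t y)| / t dt = (pi^2 / 2) sgn (x y)]: taking
   expectations and exchanging the integrals turns the laws of the [X + t Y]
   into the probability that [X Y] is negative. *)
Lemma orthant_probability (X Y : Omega -> R) (b : R) :
  measurable_fun setT X -> measurable_fun setT Y -> (- (pi / 2) < b < pi / 2)%R ->
  (forall t, (0 < t)%R ->
    \int[P]_w (lnratio (X w) (Y w) t)%:E = (lnker (sin b) t)%:E) ->
  P [set w | X w * Y w = 0]%R = 0 ->
  P [set w | X w * Y w < 0]%R = (2^-1 - b / pi)%:E.
Proof.
move=> mX mY bp XY XY0.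
have mXY : measurable_fun setT (fun w => X w * Y w)%R by exact: measurable_funM.
pose K : R := (pi * (pi / 2))%R.
have K0 : (0 < K)%R by rewrite mulr_gt0 ?divr_gt0 ?pi_gt0.
pose f : Omega * measurableTypeR R -> \bar R :=
  (fun p => (lnratio (X p.1) (Y p.1) p.2)%:E) \_ (setT `*` `[0%R, +oo[).
have mf : measurable_fun setT f.
  apply/(measurable_restrictT _ _).1; first exact: measurableX.
  apply: measurable_funTS; apply/measurable_EFinP.
  apply: measurable_lnratio => //.
    exact: (measurableT_comp mX).
  exact: (measurableT_comp mY).
have fE w t : f (w, t) =
    ((fun t => (lnratio (X w) (Y w) t)%:E) \_ (`[0%R, +oo[ : set R)) t.
  by rewrite /f /patch in_setX in_setT.
have fin : (P \x mu).-integrable setT f.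
  apply/integrable12ltyP; first exact: mf.
  apply: (@le_lt_trans _ _ (\int[P]_w (K%:E))).
    apply: ge0_le_integral_nomeas => w _.
      by apply: integral_ge0 => t _; exact: abse_ge0.
    apply: le_trans (integral_abs_lnratio (X w) (Y w)).
    rewrite [leRHS]integral_mkcond le_eqVlt; apply/orP; left; apply/eqP.
    apply: eq_integral => t _; rewrite fE /patch; case: ifPn => // _.
    by rewrite abse0.
  by rewrite integral_cst// lte_mul_pinfty ?lee_fin ?(ltW K0)// fin_num_fun_lty.
have intT : \int[mu]_t \int[P]_w f (w, t) = (pi * b)%:E.
  rewrite -integral_lnker_asin// [RHS]integral_mkcond.
  apply: eq_integral => t _.
  transitivity (((fun t => \int[P]_w (lnratio (X w) (Y w) t)%:E)
      \_ (`[0%R, +oo[ : set R)) t).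
    rewrite [RHS]/patch; case: ifPn => t0.
      by apply: eq_integral => w _; rewrite fE /patch t0.
    by rewrite integral0_eq// => w _; rewrite fE /patch (negbTE t0).
  rewrite /patch mem_setE/= in_itv/= andbT; case: ifPn => // t0.
  (* t = 0 belongs to the domain; both sides are 0 there by the convention on division. *)
  have [->|tn0] := eqVneq t 0%R; last by apply: XY; rewrite lt_neqAle eq_sym tn0.
  rewrite /lnker mulr0 invr0 mulr0; apply: integral0_eq => w _.
  by rewrite /lnratio invr0 mulr0.
pose A : set Omega := [set w | (0 < X w * Y w)%R].
pose B : set Omega := [set w | (X w * Y w < 0)%R].
have mA : measurable A.
  rewrite (_ : A = setT `&` (fun w => X w * Y w)%R @^-1` `]0%R, +oo[%classic).
    exact: mXY.
  by rewrite setTI; apply/seteqP; split => w; rewrite /A/= in_itv/= andbT.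
have mB : measurable B.
  rewrite (_ : B = setT `&` (fun w => X w * Y w)%R @^-1` `]-oo, 0%R[%classic).
    exact: mXY.
  by rewrite setTI; apply/seteqP; split => w; rewrite /B/= in_itv/=.
have intW : \int[P]_w \int[mu]_t f (w, t) = K%:E * (P A - P B).
  transitivity (\int[P]_w (K%:E * ((\1_A w)%:E - (\1_B w)%:E))).
    apply: eq_integral => w _.
    transitivity (\int[mu]_(t in `[0%R, +oo[) (lnratio (X w) (Y w) t)%:E).
      by rewrite [RHS]integral_mkcond; apply: eq_integral => t _; rewrite fE.
    rewrite integral_lnratio mulrC EFinM -/K -EFinB; congr (_ * _%:E).
    rewrite !indicE.
    case: (ltgtP (X w * Y w)%R 0%R) => h.
    - rewrite memNset ?mem_set ?ltr0_sg ?sub0r//.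
      by apply/negP; rewrite /= -leNgt ltW.
    - rewrite mem_set ?memNset ?gtr0_sg ?subr0//.
      by apply/negP; rewrite /= -leNgt ltW.
    - by rewrite h sgr0 !memNset ?subr0// /A /B/= h ltxx.
  rewrite integralZl//; last by apply: integrableB => //; exact: integrable_indic.
  rewrite integralB//; try exact: integrable_indic.
  by rewrite !integral_indic// !setIT.
(* The two orders of integration give (pi^2 / 2) (P A - P B) = pi b; together with P A + P B = 1
   this determines P B. *)
have F := Fubini fin; rewrite intW intT in F.
have AB : P A + P B = 1.
  rewrite -measureU//; last first.
    by apply/seteqP; split => // w [] /=; rewrite /A /B/=; move/lt_trans/[apply]; rewrite ltxx.
  have m0 : measurable [set w | X w * Y w = 0]%R.
    rewrite (_ : [set w | _] = setT `&` (fun w => X w * Y w)%R @^-1` [set 0%R]).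
      exact: mXY.
    by rewrite setTI.
  rewrite -[LHS]adde0 -XY0 -measureU//; last 2 first.
  - exact: measurableU.
  - apply/seteqP; split => // w [[]] /=; rewrite /A /B/= => + h; by rewrite h ltxx.
  rewrite (_ : _ `|` _ = setT); first exact: probability_setT.
  apply/seteqP; split => // w _; rewrite /A /B/=.
  by case: (ltgtP (X w * Y w)%R 0%R); [left; right|left; left|right].
move: F AB; rewrite -/B.
have /fineK <- : P A \is a fin_num by exact: fin_num_measure.
have /fineK <- : P B \is a fin_num by exact: fin_num_measure.
rewrite -EFinB -EFinD -EFinM => -[F] [AB]; congr EFin.
have p0 := @pi_gt0 R.
have E : (fine (P A) - fine (P B) = 2 * b / pi)%R.
  apply: (mulfI (lt0r_neq0 K0)); rewrite F /K.
  by move: (lt0r_neq0 p0); move: (pi : R) => q q0; field.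
have -> : (b / pi = (fine (P A) - fine (P B)) / 2)%R.
  by rewrite E; move: (lt0r_neq0 p0); move: (pi : R) => q q0; field.
lra.
Qed.

(** After normalization the logarithmic moments verify the hypothesis of [orthant_probability], from
    the laws of linear combinations alone. The correlation is written sin b, so that the result is
    its arccosine divided by pi; [b] in the open interval means that the pair is nondegenerate. *)
Lemma sign_change_probability (X Y : Omega -> R) (vX vY c b : R) :
  measurable_fun setT X -> measurable_fun setT Y ->
  (0 < vX)%R -> (0 < vY)%R -> (- (pi / 2) < b < pi / 2)%R ->
  (c = Num.sqrt vX * Num.sqrt vY * sin b)%R ->
  (forall u v : R, normal_law P (fun w => u * X w + v * Y w)%R 0
    (Num.sqrt (u ^+ 2 * vX + 2 * u * v * c + v ^+ 2 * vY))) ->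
  P [set w | X w * Y w < 0]%R = (2^-1 - b / pi)%:E.
Proof.
move=> mX mY vX0 vY0 bp cE law.
have cb : (0 < cos b)%R by rewrite cos_gt0_pihalf.
pose sX := Num.sqrt vX; pose sY := Num.sqrt vY.
have sX0 : (0 < sX)%R by rewrite sqrtr_gt0.
have sY0 : (0 < sY)%R by rewrite sqrtr_gt0.
have sXn : sX != 0%R by exact: lt0r_neq0.
have sYn : sY != 0%R by exact: lt0r_neq0.
have sXE : (sX ^+ 2 = vX)%R by rewrite sqr_sqrtr// ltW.
have sYE : (sY ^+ 2 = vY)%R by rewrite sqr_sqrtr// ltW.
pose U w := (X w / sX)%R; pose V w := (Y w / sY)%R.
have mU : measurable_fun setT U by apply: measurable_funM.
have mV : measurable_fun setT V by apply: measurable_funM.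
have UVlaw u v : normal_law P (fun w => u * U w + v * V w)%R 0
    (Num.sqrt (u ^+ 2 + 2 * u * v * sin b + v ^+ 2)).
  have := law (u / sX)%R (v / sY)%R.
  rewrite (_ : (u / sX) ^+ 2 * vX + 2 * (u / sX) * (v / sY) * c +
    (v / sY) ^+ 2 * vY = u ^+ 2 + 2 * u * v * sin b + v ^+ 2)%R; last first.
    by rewrite cE -/sX -/sY -sXE -sYE; field; rewrite sXn sYn.
  rewrite (_ : (fun w => _) = (fun w => u * U w + v * V w)%R)//.
  by apply/funext => w; rewrite /U /V; ring.
have -> : [set w | X w * Y w < 0]%R = [set w | U w * V w < 0]%R.
  apply/seteqP; split => w /=.
    rewrite /U /V mulrACA => h; rewrite pmulr_llt0//.
    by rewrite mulr_gt0 ?invr_gt0.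
  by rewrite /U /V mulrACA pmulr_llt0// mulr_gt0 ?invr_gt0.
have null0 u v : (0 < u ^+ 2 + 2 * u * v * sin b + v ^+ 2)%R ->
    {ae P, forall w, u * U w + v * V w != 0}%R.
  move=> s0; apply: (ae_neq0 (s := Num.sqrt (u ^+ 2 + 2 * u * v * sin b + v ^+ 2))).
  - by apply: measurable_funD; exact: measurable_funM.
  - by rewrite sqrtr_gt0.
  - exact: UVlaw.
apply: orthant_probability => // [t t0|].
- pose sp := (1 + 2 * t * sin b + t ^+ 2)%R.
  pose sm := (1 - 2 * t * sin b + t ^+ 2)%R.
  have sp0 : (0 < sp)%R by rewrite /sp den_plus ltr_pwDl ?sqr_ge0// exprn_gt0.
  have sm0 : (0 < sm)%R by rewrite /sm den_minus ltr_pwDl ?sqr_ge0// exprn_gt0.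
  have lp : normal_law P (fun w => U w + t * V w)%R 0 (Num.sqrt sp).
    have := UVlaw 1%R t; rewrite expr1n mulr1 -/sp.
    by under eq_fun do rewrite mul1r.
  have lm : normal_law P (fun w => U w - t * V w)%R 0 (Num.sqrt sm).
    have := UVlaw 1%R (- t)%R; rewrite expr1n mulr1 sqrrN.
    rewrite mulrN mulNr -/sm.
    by under eq_fun do rewrite mul1r mulNr.
  have mp : measurable_fun setT (fun w => U w + t * V w)%R.
    by apply: measurable_funD => //; exact: measurable_funM.
  have mm : measurable_fun setT (fun w => U w - t * V w)%R.
    by apply: measurable_funB => //; exact: measurable_funM.
  have [ip Ip] := normal_law_ln mp (etrans (sqrtr_gt0 _) sp0) lp.
  have [im Im] := normal_law_ln mm (etrans (sqrtr_gt0 _) sm0) lm.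
  have np := null0 1%R t; rewrite expr1n mulr1 -/sp in np.
  have nm := null0 1%R (- t)%R; rewrite expr1n mulr1 sqrrN mulrN mulNr -/sm in nm.
  transitivity (\int[P]_w (t^-1%:E *
      ((ln `|U w + t * V w|)%:E - (ln `|U w - t * V w|)%:E))).
    apply: ae_eq_integral => //.
    + by apply/measurable_EFinP; exact: measurable_lnratio.
    + by apply: measurable_funeM; apply: emeasurable_funB;
        apply/measurable_EFinP; apply: measf_ln; exact: measf_norm.
    + apply: filterS2 (np sp0) (nm sm0) => w; rewrite mul1r mulNr => h1 h2 _.
      rewrite -EFinB -EFinM /lnratio normrM normfV ln_div ?posrE ?normr_gt0//.
      by rewrite mulrC.
  rewrite integralZl//; last exact: integrableB.
  rewrite integralB// Ip Im -EFinB -EFinM; congr EFin.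
  rewrite /lnker -/sp -/sm ln_div ?posrE// -(sqr_sqrtr (ltW sp0)) -(sqr_sqrtr (ltW sm0)).
  rewrite !ln_sqr !(ger0_norm (sqrtr_ge0 _)) !sqr_sqrtr ?ltW//.
  by field; exact: lt0r_neq0.
- have n1 := null0 1%R 0%R; have n2 := null0 0%R 1%R.
  apply: (negligibleP _ _).1.
    rewrite (_ : [set w | _] = setT `&` (fun w => U w * V w)%R @^-1` [set 0%R]).
      exact: (measurable_funM mU mV).
    by rewrite setTI.
  have : {ae P, forall w, U w * V w != 0}%R.
    apply: filterS2 (n1 _) (n2 _) => [w||].
    + by rewrite mul1r mul0r addr0 mul1r mul0r add0r => *; exact: mulf_neq0.
    + by rewrite expr1n expr0n mulr0 mul0r !addr0.
    + by rewrite expr1n expr0n mulr0 !mul0r add0r.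
  by apply: negligibleS => w /= h; apply/negP; rewrite negbK; apply/eqP.
Qed.

End sheppard.

(** * Counting zeros through sign changes *)

Section zero_counting.
Context {R : realType}.
Local Notation mu := (@lebesgue_measure R).
Implicit Types (f : R -> R) (T h z : R).

(** For h >= 0 the range of [t] keeps both [t] and t + h in [0, T]. *)
Definition sign_changes f T h : set R :=
  [set t | 0 <= t <= T - h /\ f t * f (t + h) < 0].

Lemma measurable_sign_changes f T h : measurable_fun setT f ->
  measurable (sign_changes f T h).
Proof.
move=> mf.
have mg : measurable_fun setT (fun t => f t * f (t + h)).
  by apply: measurable_funM => //; apply: (measurableT_comp mf); meas.
rewrite (_ : sign_changes f T h =
    `[0, T - h]%classic `&` (fun t => f t * f (t + h)) @^-1` `]-oo, 0[%classic).
  apply: measurableI => //; rewrite -[X in measurable X]setTI.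
  exact: mg.
by apply/seteqP; split => t /=; rewrite /sign_changes/= !in_itv/=.
Qed.

Lemma sign_change_zero f a b : a <= b -> continuous f -> f a * f b < 0 ->
  exists2 z, a < z < b & f z = 0.
Proof.
move=> ab cf ffab.
have fn0 x : x = a \/ x = b -> f x != 0.
  by case=> ->; apply: contraTneq ffab => ->; rewrite ?mul0r ?mulr0 ltxx.
have f0 : Num.min (f a) (f b) <= 0 <= Num.max (f a) (f b).
  rewrite ge_min le_max.
  have [fa|fa|fa] := ltgtP (f a) 0.
  - by rewrite nmulr_rlt0// in ffab; rewrite (ltW ffab) orbT.
  - by rewrite pmulr_rlt0// in ffab; rewrite (ltW ffab) orbT.
  - by rewrite fa mul0r ltxx in ffab.
have [|c] := IVT ab _ f0; first exact: continuous_subspaceT.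
rewrite in_itv/= => /andP[ac cb] fc; exists c => //.
rewrite !lt_neqAle ac cb !andbT; apply/andP; split; apply/eqP => e.
  by have := fn0 a (or_introl erefl); rewrite e fc eqxx.
by have := fn0 b (or_intror erefl); rewrite -e fc eqxx.
Qed.

(** A sign change between [t] and t + h encloses a zero [z], so [t] lies in ]z - h, z[; these
    intervals of length [h] cover the set. *)
Lemma sign_changes_le f T h : continuous f -> 0 < h ->
  (mu (sign_changes f T h) <= h%:E * num_zeros f `[0%R, T])%E.
Proof.
move=> cf h0; rewrite /num_zeros /counting.
set Z := [set t | _ /\ _]; case: ifPn => [/asboolP finZ|_]; last first.
  by rewrite mulry gtr0_sg// mul1e leey.
have mf : measurable_fun setT f by exact: continuous_measurable_fun.
apply: (@le_trans _ _ (\sum_(z \in Z) mu `](z - h)%R, z[)%E).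
  apply: content_sub_fsum => //; first exact: measurable_sign_changes.
  move=> t [/andP[t0 tT] ft].
  have [|z /andP[tz zt] fz] := @sign_change_zero f t (t + h) _ cf ft; first lra.
  exists z; first by split => //=; rewrite in_itv/=; apply/andP; split; lra.
  by rewrite /= in_itv/=; apply/andP; split; lra.
rewrite fsbig_finite//=.
under eq_bigr => z _.
  rewrite lebesgue_measure_itv/= lte_fin ifT; last by lra.
  rewrite -EFinB opprB addrC subrK.
  over.
rewrite -EFinM sumEFin lee_fin.
by rewrite big_const_seq iter_addr_0 count_predT mulr_natr.
Qed.

(** The product form says that f (z + e) has the sign of e d, on both sides of [z] at once. *)
Lemma simple_zero_sign f z (d : R) : is_derive z 1 f d -> f z = 0 -> d != 0 ->
  exists2 delta, 0 < delta &
    forall e, 0 < `|e| < delta -> 0 < f (z + e) * e * d.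
Proof.
move=> [df fd] fz d0.
have : h^-1 *: (f (h *: 1 + z) - f z) @[h --> 0^'] --> d by rewrite -fd; exact: df.
move=> /cvgrPdist_lt /(_ `|d|); rewrite normr_gt0 => /(_ d0).
rewrite near_withinE => /nbhs_ballP[delta /= delta0 H].
exists delta => // e /andP[e0 ed].
have /H : ball (0 : R) delta e by rewrite /ball/= sub0r normrN.
rewrite normr_gt0 in e0 => /(_ e0).
rewrite fz subr0 [e *: 1]mulr1 (addrC e) -[_ *: _]/(e^-1 * f (z + e)).
set q := e^-1 * _ => hq.
have -> : f (z + e) = e * q by rewrite /q mulrA divff// mul1r.
have qd : 0 < q * d.
  have [d1|d1|d1] := ltgtP d 0.
  - rewrite (ltr0_norm d1) ltr_norml in hq.
    by rewrite nmulr_lgt0//; case/andP: hq; lra.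
  - rewrite (gtr0_norm d1) ltr_norml in hq.
    by rewrite pmulr_lgt0//; case/andP: hq; lra.
  - by rewrite d1 eqxx in d0.
have -> : e * q * e * d = e ^+ 2 * (q * d) by ring.
by rewrite mulr_gt0// exprn_even_gt0.
Qed.

Lemma simple_zero_sign_changes f T z (d : R) : is_derive z 1 f d -> f z = 0 ->
  d != 0 -> 0 < z < T ->
  exists2 delta, 0 < delta &
    forall h, 0 < h < delta -> `]z - h, z[%classic `<=` sign_changes f T h.
Proof.
move=> dz fz d0 /andP[z0 zT].
have [delta delta0 H] := simple_zero_sign dz fz d0.
exists (Num.min delta (Num.min z (T - z))).
  by rewrite !lt_min delta0 z0 subr_gt0.
move=> h /andP[h0]; rewrite !lt_min => /and3P[hd hz hT] t.
rewrite /= in_itv/= => /andP[t1 t2]; split; first by apply/andP; split; lra.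
have h1 := H (t - z); rewrite (addrC z) subrK in h1.
have h2 := H (t + h - z); rewrite (addrC z) subrK in h2.
have {}h1 : 0 < f t * (t - z) * d.
  apply: h1; rewrite ltr0_norm; last by lra.
  by apply/andP; split; lra.
have {}h2 : 0 < f (t + h) * (t + h - z) * d.
  apply: h2; rewrite gtr0_norm; last by lra.
  by apply/andP; split; lra.
have := mulr_gt0 h1 h2.
have -> : f t * (t - z) * d * (f (t + h) * (t + h - z) * d) =
  f t * f (t + h) * (((t - z) * (t + h - z)) * d ^+ 2) by ring.
rewrite nmulr_lgt0// nmulr_rlt0 ?exprn_even_gt0//.
by rewrite nmulr_rlt0; lra.
Qed.

(** Counterpart of [sign_changes_le]: for small [h] the intervals ]z - h, z[ are disjoint and
    consist of sign changes. *)
Lemma zeros_le_sign_changes f (f' : R -> R) T (s : seq R) :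
  measurable_fun setT f -> uniq s ->
  (forall z, z \in s -> [/\ is_derive z 1 f (f' z), f z = 0, f' z != 0 & 0 < z < T]) ->
  exists2 delta, 0 < delta & forall h, 0 < h < delta ->
    (((size s)%:R * h)%:E <= mu (sign_changes f T h))%E.
Proof.
move=> mf us hs.
suff [delta delta0 H] : exists2 delta, 0 < delta & forall h, 0 < h < delta ->
    \bigcup_(z in [set` s]) `]z - h, z[%classic `<=` sign_changes f T h /\
    mu (\bigcup_(z in [set` s]) `]z - h, z[%classic) = ((size s)%:R * h)%:E.
  exists delta => // h /H[H1 <-]; apply: le_measure => //; rewrite inE.
    by apply: fin_bigcup_measurable => //; exact: finite_seq.
  exact: measurable_sign_changes.
elim: s us hs => [_ _|z s IH /= /andP[zs us] hs].
  exists 1 => // h h0; rewrite mul0r set_nil bigcup_set0 measure0; split => //.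
have [|d1 d10 H1] := IH us; first by move=> y ys; apply: hs; rewrite inE ys orbT.
have [dz fz f'z zT] := hs z (mem_head _ _).
have [d2 d20 H2] := simple_zero_sign_changes dz fz f'z zT.
(* Below the distance from [z] to the other zeros, the interval of [z] is disjoint from theirs. *)
have [d3 d30 H3] : exists2 d3, 0 < d3 & forall y, y \in s -> d3 <= `|z - y|.
  elim: s zs {us hs IH H1} => [_|y s IH]; first by exists 1.
  rewrite inE negb_or => /andP[zy zs]; have [d3 d30 H3] := IH zs.
  exists (Num.min d3 `|z - y|); first by rewrite lt_min d30 normr_gt0 subr_eq0.
  move=> x; rewrite inE => /predU1P[->|xs]; rewrite ge_min ?lexx ?orbT//.
  by rewrite H3.
exists (Num.min d1 (Num.min d2 d3)); first by rewrite !lt_min d10 d20.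
move=> h /andP[h0]; rewrite !lt_min => /and3P[hd1 hd2 hd3].
have [|H11 H12] := H1 h; first by rewrite h0.
have -> : [set` z :: s] = z |` [set` s].
  apply/seteqP; split => x; rewrite /mkset inE.
    by move=> /predU1P[->|xs]; [left|right].
  by case=> [->|xs]; apply/predU1P; [left|right].
rewrite bigcup_setU1; split.
  by move=> t [|/H11//]; apply: H2; rewrite h0.
set U := \bigcup_(y in _) _ in H11 H12 *.
have mU : measurable U by apply: fin_bigcup_measurable => //; exact: finite_seq.
have -> : mu (`]z - h, z[%classic `|` U) = (mu `](z - h)%R, z[ + mu U)%E.
  apply: measureU => //.
  apply/seteqP; split => // t [/=]; rewrite in_itv/= => /andP[t1 t2] [y /= ys].
  rewrite in_itv/= => /andP[t3 t4]; have := H3 y ys.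
  by rewrite leNgt => /negP; apply; rewrite ltr_norml; apply/andP; split; lra.
rewrite H12 lebesgue_measure_itv/= lte_fin ifT; last by lra.
by rewrite -EFinB -EFinD; congr EFin; rewrite -natr1; ring.
Qed.

End zero_counting.

(** * Expected number of zeros as a limit of sign-change probabilities *)

Section expected_zeros.
Context {R : realType}.
Local Notation mu := (@lebesgue_measure R).
Local Open Scope ereal_scope.

Lemma limn_einf_ge (u : (\bar R)^nat) (c : \bar R) :
  (\forall n \near \oo, c <= u n) -> c <= limn_einf u.
Proof.
move=> [N _ cu]; rewrite limn_einf_lim; apply: lime_ge; first exact: is_cvg_einfs.
near=> n; apply: le_ereal_inf_tmp => _ [m /= nm <-]; apply: cu => /=.
by apply: leq_trans nm; near: n; exact: nbhs_infty_ge.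
Unshelve. all: by end_near. Qed.

(** Every finite set of zeros bounds the lower limit from below, which also covers the case of
    infinitely many zeros. A zero at 0 or T would have no interval ]z - h, z[ inside [0, T - h],
    hence 0 < t < T. *)
Lemma num_zeros_le_liminf (f f' : R -> R) (T : R) :
  measurable_fun setT f -> (forall t : R, is_derive t (1 : R)%R f (f' t)) ->
  (forall t, (0 <= t <= T)%R -> f t = 0%R -> f' t != 0%R /\ (0 < t < T)%R) ->
  num_zeros f `[0%R, T] <=
  limn_einf (fun k => k.+1%:R%:E * mu (sign_changes f T k.+1%:R^-1)).
Proof.
move=> mf df good; rewrite /num_zeros /counting.
set Z := [set t | _ /\ _].
have H (s : seq R) : uniq s -> (forall z, z \in s -> Z z) ->
    (size s)%:R%:E <=
    limn_einf (fun k => k.+1%:R%:E * mu (sign_changes f T k.+1%:R^-1)).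
  move=> us sZ; have [|delta d0 hd] := @zeros_le_sign_changes R f f' T s mf us.
    move=> z /sZ [/= zT fz].
    rewrite in_itv/= in zT; have [f'z zT'] := good z zT fz.
    by split => //; exact: df.
  apply: limn_einf_ge; near=> k.
  have k0 : (0 < k.+1%:R :> R)%R by rewrite ltr0n.
  have /hd : (0 < (k.+1%:R^-1 : R) < delta)%R.
    rewrite invr_gt0 k0/=; near: k; exact: near_infty_natSinv_lt (PosNum d0).
  move=> /(@lee_wpmul2l _ k.+1%:R%:E); rewrite lee_fin (ltW k0) => /(_ isT).
  by apply: le_trans; rewrite -EFinM lee_fin mulrCA mulfV ?mulr1.
case: ifPn => [/asboolP finZ|/asboolPn infZ].
  apply: H => [|z]; first exact: finmap.fset_uniq.
  by move=> zZ; have := in_fset_set finZ z; rewrite zZ => /esym/set_mem.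
rewrite leye_eq; apply/eqP/eqyP => A A0.
have [B BZ AB] := infinite_set_fset (Num.bound A) infZ.
apply: (@le_trans _ _ ((size (finmap.enum_fset B))%:R%:E)); last first.
  by apply: H => [|z zB]; [exact: finmap.fset_uniq|exact: BZ].
rewrite lee_fin; apply: (@le_trans _ _ (Num.bound A)%:R).
  by apply/ltW/archi_boundP/ltW.
by rewrite ler_nat.
Unshelve. all: by end_near. Qed.

Context d (Omega : measurableType d) (P : probability Omega R).
Variables (F F' : Omega -> R -> R) (T : R) (L : \bar R).
Hypothesis mF : measurable_fun setT (fun p : Omega * R => F p.1 p.2).
Hypothesis dF : forall w (t : R), is_derive t (1 : R)%R (F w) (F' w t).

Let mFw w : measurable_fun setT (F w).
Proof. exact: (measurableT_comp mF (pair1_measurable w)). Qed.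

Let cFw w : continuous (F w).
Proof. by move=> t; exact: isd_continuous (dF w t). Qed.

Let mneg h : measurable [set p : Omega * R | (F p.1 p.2 * F p.1 (p.2 + h) < 0)%R].
Proof.
have m : measurable_fun setT (fun p : Omega * R => F p.1 p.2 * F p.1 (p.2 + h))%R.
  apply: measurable_funM => //.
  rewrite (_ : (fun p => _) = (fun p : Omega * R => F p.1 p.2) \o
    (fun p : Omega * R => (p.1, p.2 + h)%R))//.
  apply: measurableT_comp mF _.
  by apply: measurable_fun_pair; meas.
rewrite (_ : [set p | _] = setT `&`
    (fun p : Omega * R => F p.1 p.2 * F p.1 (p.2 + h))%R @^-1` `]-oo, 0%R[%classic).
  exact: m.
by rewrite setTI; apply/seteqP; split => p; rewrite /= in_itv/=.
Qed.

Let measurable_neg h : measurable_fun setT (fun p : Omega * R =>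
  (\1_[set p : Omega * R | (F p.1 p.2 * F p.1 (p.2 + h) < 0)%R] p)%:E : \bar R).
Proof. by apply/measurable_EFinP; apply: measurable_indic; exact: mneg. Qed.

Let sign_changesE h w : mu (sign_changes (F w) T h) =
  \int[mu]_(t in `[0%R, (T - h)%R])
    (\1_[set p : Omega * R | (F p.1 p.2 * F p.1 (p.2 + h) < 0)%R] (w, t))%:E.
Proof.
set A := [set p : Omega * R | _].
have mA : measurable [set t | A (w, t)].
  by have := pair1_measurable w measurableT (mneg h); rewrite setTI.
rewrite (_ : sign_changes (F w) T h = [set t | A (w, t)] `&` `[0%R, (T - h)%R]).
  by rewrite -integral_indic.
by apply/seteqP; split => t /=; rewrite /sign_changes/A/= in_itv/= => -[].
Qed.

Let measurable_mu_sign_changes h :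
  measurable_fun setT (fun w => mu (sign_changes (F w) T h)).
Proof.
under eq_fun do rewrite sign_changesE.
apply: (@measurable_integral_section _ _ _ _ _ mu _
  (fun p => (\1_[set p : Omega * R | (F p.1 p.2 * F p.1 (p.2 + h) < 0)%R] p)%:E)) => //.
exact: measurable_neg.
Qed.

Lemma expected_sign_changes h :
  \int[P]_w mu (sign_changes (F w) T h) =
  \int[mu]_(t in `[0%R, (T - h)%R]) P [set w | F w t * F w (t + h) < 0]%R.
Proof.
under eq_integral do rewrite sign_changesE.
rewrite (@ge0_fubini_setX _ _ _ _ _ P mu setT _
  (fun p => (\1_[set p : Omega * R | (F p.1 p.2 * F p.1 (p.2 + h) < 0)%R] p)%:E))//.
  apply: eq_integral => t _.
  rewrite -[X in _ = P X]setIT -integral_indic//.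
  by have := pair2_measurable t measurableT (mneg h); rewrite setTI.
exact: measurable_neg.
Qed.

Hypothesis good : {ae P, forall w, forall t, (0 <= t <= T)%R -> F w t = 0%R ->
  F' w t != 0%R /\ (0 < t < T)%R}.
Hypothesis limL : (fun k => k.+1%:R%:E * \int[mu]_(t in `[0%R, (T - k.+1%:R^-1)%R])
  P [set w | F w t * F w (t + k.+1%:R^-1) < 0]%R) @ \oo --> L.

(** One inequality is [sign_changes_le] integrated; the other combines [num_zeros_le_liminf] with
    Fatou's lemma. The number of zeros enters only through monotonicity of the integral, so its
    measurability does not arise. *)
Lemma expected_num_zeros : \int[P]_w num_zeros (F w) `[0%R, T] = L.
Proof.
pose M k w := k.+1%:R%:E * mu (sign_changes (F w) T k.+1%:R^-1).
have mM k : measurable_fun setT (M k).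
  by apply: measurable_funeM; exact: measurable_mu_sign_changes.
have M0 k w : 0 <= M k w by rewrite mule_ge0.
have IM k : \int[P]_w M k w = k.+1%:R%:E * \int[mu]_(t in `[0%R, (T - k.+1%:R^-1)%R])
    P [set w | F w t * F w (t + k.+1%:R^-1) < 0]%R.
  by rewrite /M ge0_integralZl ?expected_sign_changes//; exact: measurable_mu_sign_changes.
have limM : (fun k => \int[P]_w M k w) @ \oo --> L.
  by under eq_fun do rewrite IM.
have N0 w : 0 <= (num_zeros (F w) `[0%R, T] : \bar R).
  by rewrite /num_zeros /counting; case: ifP.
apply/eqP; rewrite eq_le; apply/andP; split; last first.
  rewrite -(cvg_lim _ limM)//; apply: lime_le; first by apply/cvg_ex; exists L.
  apply: nearW => k; apply: ge0_le_integral_nomeas => // w _.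
  have k0 : (0 < k.+1%:R :> R)%R by rewrite ltr0n.
  have kv0 : (0 < (k.+1%:R)^-1 :> R)%R by rewrite invr_gt0.
  have := @sign_changes_le R (F w) T _ (@cFw w) kv0.
  move=> /(@lee_wpmul2l _ k.+1%:R%:E); rewrite lee_fin (ltW k0) => /(_ isT).
  by rewrite muleA -EFinM mulfV ?gt_eqF// mul1e.
case: good => B [mB PB0 Bgood].
pose g w := limn_einf (M ^~ w).
have mg : measurable_fun setT g.
  rewrite (_ : g = (fun w => - limn_esup (fun k => - M k w))); last first.
    by apply/funext => w; have := limn_esupN (M ^~ w); rewrite /comp => ->; rewrite oppeK.
  apply/measurableT_comp => //; apply: measurable_fun_limn_esup => k.
  exact: measurableT_comp (mM k).
have g0 w : 0 <= g w by apply: limn_einf_ge; exact: nearW.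
(* The bound by [g] holds off the null set [B]; adding +oo on [B] makes it hold everywhere without
   changing the integral. *)
apply: (@le_trans _ _ (\int[P]_w (g w + (((fun=> +oo) \_ B) w)))).
  apply: ge0_le_integral_nomeas => // w _.
  have [wB|wB] := pselect (B w).
    by rewrite /patch mem_set// addey ?leey// gt_eqF// (lt_le_trans _ (g0 w))// ltNy0.
  rewrite /patch memNset// adde0; apply: (num_zeros_le_liminf (f' := F' w)) => //.
  by apply: contrapT => h; exact/wB/Bgood.
rewrite ge0_integralD//; last 2 first.
- by move=> w _; rewrite erestrict_ge0.
- by apply/(measurable_restrictT _ _).1.
have -> : \int[P]_w (((fun=> +oo) \_ B) w) = 0.
  by rewrite -integral_mkcond integral_cst//; apply: (etrans (congr1 (mule +oo) PB0)); rewrite mule0.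
rewrite adde0.
apply: (le_trans (fatou _ measurableT mM _)) => //.
by rewrite is_cvg_limn_einfE ?(cvg_lim _ limM)//; apply/cvg_ex; exists L.
Qed.

End expected_zeros.

(** * The Dirichlet kernel *)

Lemma isd_sum {R : realType} (I : Type) (r : seq I) (f : I -> R -> R) (d : I -> R) (x : R) :
  (forall i, is_derive x 1 (f i) (d i)) ->
  is_derive x 1 (fun t => \sum_(i <- r) f i t) (\sum_(i <- r) d i).
Proof.
move=> fd; elim: r => [|i r IH].
  rewrite big_nil; under eq_fun do rewrite big_nil; exact: isd_cst.
by rewrite big_cons; under eq_fun do rewrite big_cons; exact: isdD.
Qed.

Section dirichlet_kernel.
Context {R : realType}.
Variable n : nat.
Implicit Types (t u alpha : R).

(** The reversal k -> n + 1 - k changes the sign of these centred frequencies, so the sum of the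
    corresponding exponentials is real and equals [dker]. *)
Definition freq (k : nat) : R := k%:R - n.+1%:R / 2.

Definition dker t : R := \sum_(1 <= k < n.+1) cos (freq k * t).

Definition ddker t : R := - \sum_(1 <= k < n.+1) freq k * sin (freq k * t).

Lemma sum_sin_freq t : \sum_(1 <= k < n.+1) sin (freq k * t) = 0.
Proof.
suff h : \sum_(1 <= k < n.+1) sin (freq k * t) =
         - \sum_(1 <= k < n.+1) sin (freq k * t) by lra.
rewrite [LHS]big_nat_rev -sumrN; apply: eq_big_nat => k /andP[k1 kn].
rewrite -sinN -mulNr; congr (sin (_ * t)); rewrite /freq.
rewrite add1n subSS.
by rewrite natrB 1?ltnW//; lra.
Qed.

Lemma sum_cos_nat t :
  \sum_(1 <= k < n.+1) cos (k%:R * t) = cos (n.+1%:R / 2 * t) * dker t.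
Proof.
under eq_bigr => k _.
  rewrite (_ : k%:R * t = freq k * t + n.+1%:R / 2 * t); last by rewrite /freq; ring.
  rewrite cosD; over.
rewrite big_split/= -mulr_suml sumrN -mulr_suml sum_sin_freq mul0r subr0.
by rewrite mulrC.
Qed.

Lemma sum_sin_nat t :
  \sum_(1 <= k < n.+1) sin (k%:R * t) = sin (n.+1%:R / 2 * t) * dker t.
Proof.
under eq_bigr => k _.
  rewrite (_ : k%:R * t = freq k * t + n.+1%:R / 2 * t); last by rewrite /freq; ring.
  rewrite sinD; over.
by rewrite big_split/= -!mulr_suml sum_sin_freq mul0r add0r mulrC.
Qed.

(** The real part of e^(i (n + 1) t / 2) D (t) times the conjugate of the same expression in [u]. *)
Lemma sum_cos_sub t u :
  \sum_(1 <= k < n.+1) \sum_(1 <= l < n.+1) cos (k%:R * t - l%:R * u) =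
  cos (n.+1%:R / 2 * (t - u)) * (dker t * dker u).
Proof.
under eq_bigr do under eq_bigr do rewrite cosB.
under eq_bigr do rewrite big_split/= -!mulr_sumr.
rewrite big_split/= -!mulr_suml !sum_cos_nat !sum_sin_nat.
by rewrite mulrBr cosB; ring.
Qed.

(** The closed form of the Dirichlet kernel, obtained by telescoping and kept multiplied out so as
    to hold also at the zeros of sin (t / 2). *)
Lemma dker_sin t : dker t * sin (t / 2) = sin (n%:R * t / 2).
Proof.
have h k : cos (freq k * t) * sin (t / 2) =
    sin ((k.+1%:R - n.+1%:R / 2 - 2^-1) * t) / 2 -
    sin ((k%:R - n.+1%:R / 2 - 2^-1) * t) / 2.
  rewrite (_ : (k.+1%:R - _ - _) * t = freq k * t + t / 2); last first.
    by rewrite /freq -natr1; lra.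
  rewrite (_ : (k%:R - _ - _) * t = freq k * t - t / 2); last by rewrite /freq; lra.
  by rewrite sinD sinB; lra.
rewrite /dker mulr_suml; under eq_bigr do rewrite h.
rewrite telescope_sumr//.
rewrite (_ : (n.+1%:R - _ - _) * t = n%:R * t / 2); last by rewrite -natr1; lra.
rewrite (_ : (1 - _ - _) * t = - (n%:R * t / 2)); last by rewrite -natr1; lra.
by rewrite sinN; lra.
Qed.

Lemma dker_ge_sin t : `|sin (n%:R * t / 2)| <= `|dker t|.
Proof.
rewrite -dker_sin normrM ler_piMr//.
by rewrite ler_norml sin_geN1 sin_le1.
Qed.

Lemma freq_le k : (1 <= k <= n)%N -> `|freq k| <= n%:R.
Proof.
move=> /andP[k1 kn]; rewrite ler_norml /freq -natr1.
have k1' : 1 <= k%:R :> R by rewrite ler1n.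
have kn' : k%:R <= n%:R :> R by rewrite ler_nat.
by apply/andP; split; lra.
Qed.

Lemma is_derive_dker t : is_derive t 1 dker (ddker t).
Proof.
rewrite /dker /ddker -sumrN; apply: isd_sum => k.
by isde; ring.
Qed.

Lemma ddker_le t : `|ddker t| <= n%:R ^+ 2.
Proof.
rewrite /ddker normrN (le_trans (ler_norm_sum _ _ _))//.
apply: (@le_trans _ _ (\sum_(1 <= k < n.+1) n%:R)).
  rewrite ler_sum_nat// => k kn; rewrite normrM -[leRHS]mulr1.
  by rewrite ler_pM// ?freq_le// ler_norml sin_geN1 sin_le1.
by rewrite sumr_const_nat subn1/= -[leLHS]mulr_natr expr2.
Qed.

Lemma continuous_ddker : continuous ddker.
Proof.
move=> t; rewrite /ddker; apply: isd_continuous.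
by apply: isdN; apply: isd_sum => k; isd.
Qed.

End dirichlet_kernel.

(** * Elementary bounds *)

Section real_bounds.
Context {R : realType}.
Implicit Types (f : R -> R) (x y M t : R).

Lemma is_derive_MVT f (f' : R -> R) x y : x <= y ->
  (forall z : R, is_derive z (1 : R) f (f' z)) ->
  exists2 c, x <= c <= y & f y - f x = f' c * (y - x).
Proof.
move=> xy df; have [|c cxy ->] := @MVT_segment R f f' x y xy (fun z _ => df z).
  by apply: continuous_subspaceT => z; exact: isd_continuous (df z).
by exists c => //; rewrite in_itv in cxy.
Qed.

Lemma lipschitz_derive f (f' : R -> R) M x y :
  (forall z : R, is_derive z (1 : R) f (f' z)) -> (forall z, `|f' z| <= M) ->
  `|f x - f y| <= M * `|x - y|.
Proof.
move=> df f'M; wlog yx : x y / y <= x.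
  move=> wl; have [/wl//|/ltW/wl] := leP y x.
  by rewrite distrC (distrC y).
have [c _ ->] := is_derive_MVT yx df.
by rewrite normrM ler_wpM2r.
Qed.

Lemma norm_sin_le1 x : `|sin x| <= 1.
Proof. by rewrite ler_norml sin_geN1 sin_le1. Qed.

Lemma norm_cos_le1 x : `|cos x| <= 1.
Proof. by rewrite ler_norml cos_geN1 cos_le1. Qed.

Lemma lipschitz_sin x y : `|sin x - sin y| <= `|x - y|.
Proof.
rewrite -[leRHS]mul1r; apply: (@lipschitz_derive _ cos) => z.
exact: norm_cos_le1.
Qed.

Lemma lipschitz_cos x y : `|cos x - cos y| <= `|x - y|.
Proof.
rewrite -[leRHS]mul1r; apply: (@lipschitz_derive _ (fun z => - sin z)) => z.
by rewrite normrN norm_sin_le1.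
Qed.

Lemma norm_sin_le x : `|sin x| <= `|x|.
Proof. by have := lipschitz_sin x 0; rewrite sin0 !subr0. Qed.

Lemma one_sub_cos x : 1 - cos x = 2 * sin (x / 2) ^+ 2.
Proof.
have -> : cos x = cos (x / 2 *+ 2) by congr cos; rewrite mulr2n; lra.
by rewrite cos_mulr2n cos2sin2; lra.
Qed.

Lemma one_add_cos x : 1 + cos x = 2 * cos (x / 2) ^+ 2.
Proof. by have := one_sub_cos x; have := cos2Dsin2 (x / 2); lra. Qed.

Lemma one_sub_cos_le x : 1 - cos x <= x ^+ 2 / 2.
Proof.
rewrite one_sub_cos; have : sin (x / 2) ^+ 2 <= (x / 2) ^+ 2.
  by rewrite -real_normK ?num_real// -[leRHS]real_normK ?num_real// lerXn2r ?nnegrE// norm_sin_le.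
by lra.
Qed.

(** For r = cos a the left side is the chord 2 sin (a / 2) of the arc a. *)
Lemma acos_ge_sqrt (r : R) : -1 <= r <= 1 -> Num.sqrt (2 * (1 - r)) <= acos r.
Proof.
move=> r1; have a0 := acos_ge0 r1.
have cr : cos (acos r) = r by rewrite acosK// in_itv.
rewrite -(ger0_norm a0) -sqrtr_sqr ler_wsqrtr//.
by have := one_sub_cos_le (acos r); rewrite cr; lra.
Qed.

Lemma cos_le_sinc x : 0 <= x <= pi -> x * cos x <= sin x.
Proof.
move=> /andP[x0 xp]; have [c /andP[c0 cx]] := is_derive_MVT x0 (@is_derive_sin R).
rewrite sin0 !subr0 => ->; rewrite mulrC ler_wpM2r//.
rewrite leNgt ltr_cos ?in_itv/= -?leNgt//; apply/andP; split => //.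
- exact: le_trans cx xp.
Qed.

(** This is x cos x <= sin x at x = a / 2, where r = cos a. Together with [acos_ge_sqrt] it brackets
    acos r near r = 1, where acos is not differentiable, between quantities whose ratio tends to
    1. *)
Lemma acos_le_sqrt (r : R) : 0 <= r <= 1 ->
  acos r * Num.sqrt ((1 + r) / 2) <= Num.sqrt (2 * (1 - r)).
Proof.
move=> /andP[r0 r1]; have rr : -1 <= r <= 1 by apply/andP; split; lra.
have a0 := acos_ge0 rr; have ap := acos_lepi rr.
have cr : cos (acos r) = r by rewrite acosK// in_itv.
have h0 : 0 <= sin (acos r / 2) by apply: sin_ge0_pi; apply/andP; split; lra.
have c0 : 0 <= cos (acos r / 2).
  by apply: cos_ge0_pihalf; apply/andP; split; have := @pi_ge0 R; lra.
have -> : (1 + r) / 2 = cos (acos r / 2) ^+ 2.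
  by have := one_add_cos (acos r); rewrite cr; lra.
have -> : 2 * (1 - r) = (2 * sin (acos r / 2)) ^+ 2.
  by have := one_sub_cos (acos r); rewrite cr exprMn; lra.
rewrite !sqrtr_sqr !ger0_norm ?mulr_ge0//.
have : acos r / 2 * cos (acos r / 2) <= sin (acos r / 2).
  by apply: cos_le_sinc; apply/andP; split; lra.
lra.
Qed.

Lemma is_derive_cvg_quotient f (d x : R) (h : R^nat) : is_derive x 1 f d ->
  (forall k, h k != 0) -> h @ \oo --> 0 ->
  (f (x + h k) - f x) / h k @[k --> \oo] --> d.
Proof.
move=> [df fd] h0 hl.
have H : e^-1 *: (f (e *: 1 + x) - f x) @[e --> 0^'] --> d by rewrite -fd; exact: df.
have hw : h @ \oo --> 0^'.
  move=> A; rewrite /= => -[e /= e0 eA].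
  move/cvgrPdist_lt : hl => /(_ e e0); apply: filterS => k.
  by rewrite sub0r normrN => hk; apply: eA => //=; rewrite sub0r normrN.
have := cvg_comp _ _ hw H; apply: cvg_trans; apply: near_eq_cvg; apply: nearW => k.
by rewrite /= [h k *: 1]mulr1 (addrC x) mulrC.
Qed.

End real_bounds.

(** * Correlation of two nearby values *)

Section correlation.
Context {R : realType}.
Variables (n : nat) (alpha : R).
Implicit Types (t u h : R).

(** With v t = (D (t + alpha), D (t - alpha)), [qform] is |v t|^2, [dotp] and [crossp] are the
    scalar and cross products of v t and v u, and [wronskian t / qform t] is the angular speed of
    v. *)
Definition qform t : R := dker n (t + alpha) ^+ 2 + dker n (t - alpha) ^+ 2.

Definition dotp t u : R :=
  dker n (t + alpha) * dker n (u + alpha) + dker n (t - alpha) * dker n (u - alpha).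

Definition crossp t u : R :=
  dker n (t + alpha) * dker n (u - alpha) - dker n (t - alpha) * dker n (u + alpha).

Definition wronskian t : R :=
  dker n (t + alpha) * ddker n (t - alpha) - dker n (t - alpha) * ddker n (t + alpha).

Definition speed t : R :=
  Num.sqrt ((n.+1%:R / 2) ^+ 2 + (wronskian t / qform t) ^+ 2).

(** The correlation of f t and f (t + h): the cosine of the angle between v t and v (t + h), times
    the factor due to the central frequency. *)
Definition rho h t : R :=
  cos (n.+1%:R / 2 * h) * (dotp t (t + h) / Num.sqrt (qform t * qform (t + h))).

(** Each |D (y)| is at least |sin (n y / 2)|, and sin^2 x + sin^2 y = 1 - cos (x + y) cos (x - y),
    where x - y = n alpha. *)
Lemma qform_ge t : 1 - `|cos (n%:R * alpha)| <= qform t.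
Proof.
apply: (@le_trans _ _ (sin (n%:R * (t + alpha) / 2) ^+ 2 + sin (n%:R * (t - alpha) / 2) ^+ 2)).
  set x := n%:R * (t + alpha) / 2; set y := n%:R * (t - alpha) / 2.
  have -> : sin x ^+ 2 + sin y ^+ 2 = 1 - cos (x + y) * cos (x - y).
    rewrite cosD cosB; have := cos2Dsin2 x; have := cos2Dsin2 y.
    move: (cos x) (cos y) (sin x) (sin y) => a b c d h1 h2.
    have -> : c ^+ 2 = 1 - a ^+ 2 by lra.
    have -> : d ^+ 2 = 1 - b ^+ 2 by lra.
    have -> : 1 - (a * b - c * d) * (a * b + c * d) = 1 - (a ^+ 2 * b ^+ 2 - c ^+ 2 * d ^+ 2) by ring.
    have -> : c ^+ 2 = 1 - a ^+ 2 by lra.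
    have -> : d ^+ 2 = 1 - b ^+ 2 by lra.
    ring.
  have -> : x - y = n%:R * alpha by rewrite /x /y; lra.
  rewrite lerD2l lerN2 (le_trans (ler_norm _))// normrM ler_piMl// norm_cos_le1//.
have sq (a b : R) : `|a| <= `|b| -> a ^+ 2 <= b ^+ 2.
  by move=> ab; rewrite -[leLHS]real_normK ?num_real// -[leRHS]real_normK ?num_real// lerXn2r ?nnegrE.
by apply: lerD; apply: sq; rewrite dker_ge_sin.
Qed.

Lemma lagrange_identity t u : dotp t u ^+ 2 + crossp t u ^+ 2 = qform t * qform u.
Proof. by rewrite /dotp /crossp /qform; ring. Qed.

Lemma isd_dker (f : R -> R) (x a : R) : is_derive x 1 f a ->
  is_derive x 1 (fun t => dker n (f t)) (ddker n (f x) * a).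
Proof. by move=> hf; apply: (isd_comp (f := @dker R n)) => //; exact: is_derive_dker. Qed.

Lemma continuous_qform : continuous qform.
Proof.
move=> t; apply: (@isd_continuous _ _ _ _); rewrite /qform.
by apply: isdD; apply: isdX; apply: isd_dker; isd.
Qed.

Lemma continuous_dotp h : continuous (fun t => dotp t (t + h)).
Proof.
move=> t; apply: (@isd_continuous _ _ _ _); rewrite /dotp.
by apply: isdD; apply: isdM; apply: isd_dker; isd.
Qed.

Lemma continuous_dotpr t : continuous (dotp t).
Proof.
move=> u; apply: (@isd_continuous _ _ _ _); rewrite /dotp.
by apply: isdD; apply: isdM; try exact: isd_cst; apply: isd_dker; isd.
Qed.

Lemma is_derive_crossp t : is_derive t 1 (crossp t) (wronskian t).
Proof.
rewrite /crossp; eapply is_derive_eq.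
  by apply: isdD; [|apply: isdN]; apply: isdM; try exact: isd_cst; apply: isd_dker; isd.
by cbv beta; rewrite /wronskian; ring.
Qed.

Lemma crossptt t : crossp t t = 0.
Proof. by rewrite /crossp; ring. Qed.

Lemma dotptt t : dotp t t = qform t.
Proof. by rewrite /dotp /qform; ring. Qed.

(** The left side is |v t - v (t + h)|^2, and each coordinate of v is Lipschitz with constant
    n^2. *)
Lemma dotp_ge t h : qform t + qform (t + h) - 2 * dotp t (t + h) <= 2 * (n%:R ^+ 2 * h) ^+ 2.
Proof.
have sq u : (dker n (u + h) - dker n u) ^+ 2 <= (n%:R ^+ 2 * h) ^+ 2.
  rewrite -[leLHS]real_normK ?num_real// -[leRHS]real_normK ?num_real// lerXn2r ?nnegrE//.
  rewrite (le_trans (lipschitz_derive _ _ (is_derive_dker n) (ddker_le n)))//.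
  by rewrite addrC addKr normrM ger0_norm.
have := sq (t + alpha); have := sq (t - alpha).
rewrite /qform /dotp (addrAC t h) (addrAC t h).
move: (dker n _) (dker n _) (dker n _) (dker n _) ((n%:R ^+ 2 * h) ^+ 2) => a b c d e; nra.
Qed.

Hypothesis hna : 0 < 1 - `|cos (n%:R * alpha)|.

Lemma qform_gt0 t : 0 < qform t.
Proof. exact: lt_le_trans (qform_ge t). Qed.

Let N t h := Num.sqrt (qform t * qform (t + h)).

Lemma sqrt_qform_ge t h : 1 - `|cos (n%:R * alpha)| <= N t h.
Proof.
rewrite -[leLHS]ger0_norm ?(ltW hna)// -sqrtr_sqr ler_wsqrtr// expr2.
by rewrite ler_pM ?(ltW hna) ?qform_ge.
Qed.

Lemma sqrt_qform_gt0 t h : 0 < N t h.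
Proof. exact: lt_le_trans (sqrt_qform_ge t h). Qed.

Lemma norm_dotp_le t h : `|dotp t (t + h)| <= N t h.
Proof.
rewrite -sqrtr_sqr ler_wsqrtr// -lagrange_identity lerDl.
exact: sqr_ge0.
Qed.

Lemma norm_cosangle_le t h : `|dotp t (t + h) / N t h| <= 1.
Proof.
rewrite normrM normfV (gtr0_norm (sqrt_qform_gt0 t h)) ler_pdivrMr ?sqrt_qform_gt0//.
by rewrite mul1r norm_dotp_le.
Qed.

Lemma rho_lt1 h t : 0 < n.+1%:R / 2 * h < pi -> `|rho h t| < 1.
Proof.
move=> /andP[h0 hp]; rewrite /rho normrM.
apply: (@le_lt_trans _ _ `|cos (n.+1%:R / 2 * h)|).
  by rewrite ler_piMr// norm_cosangle_le.
have s0 : 0 < sin (n.+1%:R / 2 * h) by rewrite sin_gt0_pi// h0.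
have := cos2Dsin2 (n.+1%:R / 2 * h).
move: (cos _) (sin _) s0 => c s s0 cs; rewrite ltr_norml; apply/andP; split; nra.
Qed.

Lemma one_sub_cosangle t h :
  1 - dotp t (t + h) / N t h <= (n%:R ^+ 2 * h) ^+ 2 / (1 - `|cos (n%:R * alpha)|).
Proof.
have N0 := sqrt_qform_gt0 t h.
apply: (@le_trans _ _ ((n%:R ^+ 2 * h) ^+ 2 / N t h)); last first.
  by rewrite ler_wpM2l ?sqr_ge0// lef_pV2 ?posrE// sqrt_qform_ge.
rewrite ler_pdivlMr// mulrBl mul1r divfK ?gt_eqF//.
(* The arithmetic-geometric mean inequality for |v t|^2 and |v (t + h)|^2. *)
have := dotp_ge t h; have : 2 * N t h <= qform t + qform (t + h).
  rewrite /N sqrtrM ?(ltW (qform_gt0 _))//.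
  have := sqr_ge0 (Num.sqrt (qform t) - Num.sqrt (qform (t + h))).
  by rewrite sqrrB !sqr_sqrtr ?(ltW (qform_gt0 _))//; lra.
lra.
Qed.

(** A bound of order h^2, uniform in [t] for fixed [n], as dominated convergence requires. *)
Lemma one_sub_rho h t : 1 - rho h t <=
  ((n.+1%:R / 2) ^+ 2 / 2 + n%:R ^+ 4 / (1 - `|cos (n%:R * alpha)|)) * h ^+ 2.
Proof.
have -> : 1 - rho h t = (1 - dotp t (t + h) / N t h) +
    (1 - cos (n.+1%:R / 2 * h)) * (dotp t (t + h) / N t h) by rewrite /rho -/(N t h); ring.
have h1 := one_sub_cosangle t h; have h2 := one_sub_cos_le (n.+1%:R / 2 * h).
have h3 : (1 - cos (n.+1%:R / 2 * h)) * (dotp t (t + h) / N t h) <= 1 - cos (n.+1%:R / 2 * h).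
  rewrite ler_piMr ?subr_ge0 ?cos_le1//.
  by apply: le_trans (norm_cosangle_le t h); rewrite ler_norm.
apply: (le_trans (lerD h1 (le_trans h3 h2))); rewrite le_eqVlt; apply/orP; left; apply/eqP.
ring.
Qed.

Lemma continuous_rho h : continuous (rho h).
Proof.
move=> t; rewrite /rho; apply: cvgM; first exact: cvg_cst.
apply: cvgM; first exact: continuous_dotp.
apply: cvgV; first by rewrite gt_eqF// (sqrt_qform_gt0 t h).
apply: continuous_comp; last exact: sqrt_continuous.
apply: cvgM; first exact: continuous_qform.
apply: (@continuous_comp _ _ _ (fun t : R => t + h) qform); last exact: continuous_qform.
by apply: cvgD => //; exact: cvg_cst.
Qed.

Section limit.
Variable h : R^nat.
Hypotheses (h0 : forall k, 0 < h k) (hl : h @ \oo --> 0).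

Let hN0 k : h k != 0. Proof. by rewrite gt_eqF. Qed.

Let cvg_shift (g : R -> R) t : {for t, continuous g} -> g (t + h k) @[k --> \oo] --> g t.
Proof.
move=> cg; apply: continuous_cvg => //.
by rewrite -[X in _ --> X]addr0; apply: cvgD => //; exact: cvg_cst.
Qed.

Let cvgN0 t : N t (h k) @[k --> \oo] --> qform t.
Proof.
rewrite -[X in _ --> X](ger0_norm (ltW (qform_gt0 t))) -sqrtr_sqr expr2 /N.
apply: continuous_cvg; first exact: sqrt_continuous.
by apply: cvgM; [exact: cvg_cst|apply: cvg_shift; exact: continuous_qform].
Qed.

Let cvgdot t : dotp t (t + h k) @[k --> \oo] --> qform t.
Proof. by rewrite -(dotptt t); apply: cvg_shift; exact: continuous_dotpr. Qed.

Let cvg_crossp t : crossp t (t + h k) / h k @[k --> \oo] --> wronskian t.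
Proof.
have := is_derive_cvg_quotient (is_derive_crossp t) hN0 hl.
by under eq_fun do rewrite crossptt subr0.
Qed.

(** Writing 1 - cos as 2 sin^2 and, by Lagrange's identity, 1 - d / N = c^2 / (N (N + d)) with c the
    cross product, reduces the second-order expansion of the correlation to first derivatives of sin
    and of [crossp]. *)
Lemma cvg_one_sub_rho t : (2 * (1 - rho (h k) t)) / h k ^+ 2 @[k --> \oo] -->
  (n.+1%:R / 2) ^+ 2 + (wronskian t / qform t) ^+ 2.
Proof.
set m : R := n.+1%:R / 2.
have Q0 := qform_gt0 t.
have Nd0 k : N t (h k) + dotp t (t + h k) >= 0.
  by have := norm_dotp_le t (h k); rewrite ler_norml -/(N t (h k)) => /andP[]; lra.
have sinl : sin (m * h k / 2) / h k @[k --> \oo] --> m / 2.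
  have dsin : is_derive (0 : R) 1 (fun x => sin (m * x / 2)) (m / 2).
    by isde; rewrite !(mulr0,mul0r) cos0; ring.
  have := is_derive_cvg_quotient dsin hN0 hl.
  by under eq_fun do rewrite mulr0 mul0r sin0 subr0 add0r.
have Gl : dotp t (t + h k) / N t (h k) @[k --> \oo] --> (1 : R).
  rewrite -(mulfV (lt0r_neq0 Q0)); apply: cvgM; first exact: cvgdot.
  by apply: cvgV; [rewrite gt_eqF|exact: cvgN0].
have -> : m ^+ 2 + (wronskian t / qform t) ^+ 2 = 4 * (m / 2) ^+ 2 * 1 +
    2 * wronskian t ^+ 2 / (qform t * (qform t + qform t)).
  move: (m) (wronskian t) (qform t) Q0 => x w q q0.
  have -> : q + q = 2 * q by ring.
  by field; rewrite gt_eqF.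
have : (4 * (sin (m * h k / 2) / h k) ^+ 2 * (dotp t (t + h k) / N t (h k)) +
    2 * (crossp t (t + h k) / h k) ^+ 2 / (N t (h k) * (N t (h k) + dotp t (t + h k))))
    @[k --> \oo] --> 4 * (m / 2) ^+ 2 * 1 +
    2 * wronskian t ^+ 2 / (qform t * (qform t + qform t)).
  apply: cvgD; apply: cvgM => //.
  - by apply: cvgM; [exact: cvg_cst|apply: cvgM].
  - by apply: cvgM; [exact: cvg_cst|apply: cvgM].
  - apply: cvgV; first by apply: lt0r_neq0; apply: mulr_gt0 => //; exact: addr_gt0.
    by apply: cvgM; [exact: cvgN0|apply: cvgD; [exact: cvgN0|exact: cvgdot]].
apply: cvg_trans; apply: near_eq_cvg.
have : \forall k \near \oo, 0 < dotp t (t + h k) by exact: (@cvgr_gt R _ _ _ _ _ (@cvgdot t) 0 Q0).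
apply: filterS => k d0.
have N0 := sqrt_qform_gt0 t (h k); rewrite -/(N t (h k)) in N0.
have N2 : N t (h k) ^+ 2 = dotp t (t + h k) ^+ 2 + crossp t (t + h k) ^+ 2.
  by rewrite lagrange_identity sqr_sqrtr// mulr_ge0// ltW// qform_gt0.
have := one_sub_cos (m * h k); rewrite /rho -/(N t (h k)) -/m => e.
have {e}-> : cos (m * h k) = 1 - 2 * sin (m * h k / 2) ^+ 2 by lra.
move: (h k) (hN0 k) (dotp _ _) (crossp _ _) (N _ _) (sin _) N0 N2 d0 => hk hk0 d c N1 s N0 N2 d0.
have Nd : N1 + d != 0 by rewrite gt_eqF// addr_gt0.
have -> : 2 * (c / hk) ^+ 2 / (N1 * (N1 + d)) = 2 * (N1 ^+ 2 - d ^+ 2) / hk ^+ 2 / (N1 * (N1 + d)).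
  by rewrite N2; field; rewrite Nd gt_eqF.
by field; rewrite Nd hk0 gt_eqF.
Qed.

Let cvg_rho1 t : rho (h k) t @[k --> \oo] --> (1 : R).
Proof.
have : (1 - (2 * (1 - rho (h k) t)) / h k ^+ 2 * (h k * h k) / 2) @[k --> \oo] -->
    1 - ((n.+1%:R / 2) ^+ 2 + (wronskian t / qform t) ^+ 2) * (0 * 0) / 2.
  apply: cvgB; first exact: cvg_cst.
  apply: cvgM; last exact: cvg_cst.
  by apply: cvgM; [exact: cvg_one_sub_rho|apply: cvgM].
rewrite mulr0 mulr0 mul0r subr0; apply: cvg_trans; apply: near_eq_cvg; apply: nearW => k.
by field; rewrite hN0.
Qed.

Lemma cvg_acos_rho t : acos (rho (h k) t) / h k @[k --> \oo] --> speed t.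
Proof.
have lim1 : Num.sqrt (2 * (1 - rho (h k) t) / h k ^+ 2) @[k --> \oo] --> speed t.
  by apply: continuous_cvg; [exact: sqrt_continuous|exact: cvg_one_sub_rho].
have c1 : Num.sqrt ((1 + rho (h k) t) / 2) @[k --> \oo] --> (1 : R).
  rewrite -[X in _ --> X]sqrtr1; apply: continuous_cvg; first exact: sqrt_continuous.
  rewrite -[X in _ --> X](_ : (1 + 1) / 2 = 1 :> R); last by lra.
  apply: cvgM; last exact: cvg_cst.
  by apply: cvgD; [exact: cvg_cst|exact: cvg_rho1].
have lim2 : Num.sqrt (2 * (1 - rho (h k) t) / h k ^+ 2) /
    Num.sqrt ((1 + rho (h k) t) / 2) @[k --> \oo] --> speed t.
  rewrite -[X in _ --> X]mulr1 -[X in _ * X]invr1.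
  by apply: cvgM => //; apply: cvgV => //; rewrite oner_neq0.
apply: (squeeze_cvgr _ lim1 lim2).
have [H1 H2] : (\forall k \near \oo, 0 < rho (h k) t) /\
    (\forall k \near \oo, n.+1%:R / 2 * h k < pi).
  split; first exact: (@cvgr_gt R _ _ _ _ _ (@cvg_rho1 t) 0 ltr01).
  have hm : n.+1%:R / 2 * h k @[k --> \oo] --> n.+1%:R / 2 * (0 : R).
    by apply: cvgM => //; exact: cvg_cst.
  by apply: (@cvgr_lt R _ _ _ _ _ hm); rewrite mulr0 pi_gt0.
near=> k.
have r0 : 0 < rho (h k) t by near: k.
have r1 : rho (h k) t <= 1.
  apply/ltW/(le_lt_trans (ler_norm _))/rho_lt1; rewrite mulr_gt0 ?divr_gt0 ?ltr0n//=.
  by near: k.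
have hk := h0 k.
have -> : Num.sqrt (2 * (1 - rho (h k) t) / h k ^+ 2) = Num.sqrt (2 * (1 - rho (h k) t)) / h k.
  by rewrite sqrtrM ?mulr_ge0 ?subr_ge0// sqrtrV ?sqr_ge0// sqrtr_sqr gtr0_norm.
rewrite ler_pM2r ?invr_gt0// acos_ge_sqrt/=; last by rewrite r1 andbT; lra.
rewrite ler_pdivlMr; last by rewrite sqrtr_gt0; lra.
rewrite mulrAC ler_pM2r ?invr_gt0//; apply: acos_le_sqrt.
by rewrite r1 ltW.
Unshelve. all: by end_near. Qed.

End limit.

(** With C the constant of [one_sub_rho], sqrt (2 (1 - rho)) <= sqrt (2 C) h; the factor 2 comes
    from sqrt ((1 + rho) / 2) >= 1 / 2 when rho >= 0. *)
Definition acos_rho_bound : R := 2 * Num.sqrt (2 *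
  ((n.+1%:R / 2) ^+ 2 / 2 + n%:R ^+ 4 / (1 - `|cos (n%:R * alpha)|))).

Lemma acos_rho_le h t : 0 < h -> n.+1%:R / 2 * h < pi ->
  ((n.+1%:R / 2) ^+ 2 / 2 + n%:R ^+ 4 / (1 - `|cos (n%:R * alpha)|)) * h ^+ 2 <= 1 ->
  acos (rho h t) / h <= acos_rho_bound.
Proof.
move=> h0 hp; have := one_sub_rho h t; rewrite /acos_rho_bound.
set C := (_ ^+ 2 / 2 + _) => hC C1.
have C0 : 0 <= C by rewrite addr_ge0// divr_ge0// ?sqr_ge0// ?exprn_ge0// ltW.
have r0 : 0 <= rho h t by lra.
have r1 : rho h t <= 1.
  apply/ltW/(le_lt_trans (ler_norm _))/rho_lt1; rewrite mulr_gt0 ?divr_gt0 ?ltr0n//=.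
have a0 : 0 <= acos (rho h t) by apply: acos_ge0; rewrite r1 andbT; lra.
have : acos (rho h t) * Num.sqrt ((1 + rho h t) / 2) <= Num.sqrt (2 * (1 - rho h t)).
  by apply: acos_le_sqrt; rewrite r0.
have s1 : 2^-1 <= Num.sqrt ((1 + rho h t) / 2).
  rewrite -[leLHS]ger0_norm// -sqrtr_sqr ler_wsqrtr//.
  by rewrite expr2; lra.
have s2 : Num.sqrt (2 * (1 - rho h t)) <= Num.sqrt (2 * C) * h.
  rewrite -[X in _ <= _ * X](gtr0_norm h0) -(sqrtr_sqr h) -sqrtrM ?mulr_ge0//.
  by rewrite ler_wsqrtr//; lra.
rewrite ler_pdivrMr//.
move: (acos _) (Num.sqrt _) (Num.sqrt _) (Num.sqrt _) a0 s1 s2 => a x y z a0 s1 s2 s3.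
nra.
Qed.

End correlation.

(** * Double zeros *)

Section double_zeros.
Context d (Omega : measurableType d) (R : realType) (P : probability Omega R).
Variables (F F' : Omega -> R -> R) (M : Omega -> R) (T C : R).
Hypothesis T0 : 0 < T.
Hypothesis C0 : 0 <= C.
Hypothesis mF : forall t, measurable_fun setT (F ^~ t).
Hypothesis dF : forall w (t : R), is_derive t (1 : R) (F w) (F' w t).
Hypothesis F'M : forall w t u, `|F' w t - F' w u| <= M w * `|t - u|.
Hypothesis M0 : forall w, 0 <= M w.
Hypothesis Fsmall : forall t e : R, 0 <= e ->
  (P [set w | (`|F w t| <= e)%R] <= (C * e)%:E)%E.

Lemma double_zero_bound w t u : F w t = 0 -> F' w t = 0 -> `|F w u| <= M w * (u - t) ^+ 2.
Proof.
move=> Ft F't.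
suff [c ctu e] : exists2 c, `|c - t| <= `|u - t| & `|F w u| = `|F' w c| * `|u - t|.
  rewrite e -real_normK ?num_real// expr2 mulrA ler_wpM2r//.
  apply: (@le_trans _ _ (M w * `|c - t|)); last by rewrite ler_wpM2l.
  by have := F'M w c t; rewrite F't subr0.
have [tu|/ltW ut] := leP t u.
  have [c /andP[tc cu] e] := is_derive_MVT tu (@dF w).
  exists c; first by rewrite !ger0_norm ?subr_ge0 ?lerD2r.
  by rewrite -normrM -e Ft subr0.
have [c /andP[uc ct] e] := is_derive_MVT ut (@dF w).
exists c; first by rewrite !ler0_norm ?subr_le0 ?lerN2 ?lerD2r.
by rewrite distrC -normrM -e Ft sub0r normrN.
Qed.

Let grid (m j : nat) : R := T * j%:R / m.+1%:R.

Let near_zero (L m j : nat) : set Omega :=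
  [set w | `|F w (grid m j)| <= L%:R * (T / m.+1%:R) ^+ 2].

Let measurable_near_zero L m j : measurable (near_zero L m j).
Proof.
have mn : measurable_fun setT (fun w => `|F w (grid m j)|).
  by apply: measurableT_comp => //; exact: normr_measurable.
rewrite (_ : near_zero L m j = setT `&` (fun w => `|F w (grid m j)|) @^-1`
    `]-oo, (L%:R * (T / m.+1%:R) ^+ 2)]%classic).
  exact: mn.
by rewrite setTI; apply/seteqP; split => w; rewrite /near_zero/= in_itv.
Qed.

(** The indices j <= m + 1 make both endpoints of [0, T] grid points. *)
Let close_grid (L m : nat) : set Omega := \big[setU/set0]_(j < m.+2) near_zero L m j.

Let measurable_close_grid L m : measurable (close_grid L m).
Proof. by apply: bigsetU_measurable => j _. Qed.

Let close_grid_le L m :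
  (P (close_grid L m) <= (2 * C * L%:R * T ^+ 2 / m.+1%:R)%:E)%E.
Proof.
apply: (le_trans (Boole_inequality _ _)) => //.
apply: (@le_trans _ _ (\sum_(j < m.+2) (C * (L%:R * (T / m.+1%:R) ^+ 2))%:E)%E).
  by apply: lee_sum => j _; apply: Fsmall; rewrite mulr_ge0 ?sqr_ge0.
rewrite sumEFin lee_fin sumr_const card_ord -[leLHS]mulr_natr.
have m0 : 0 < m.+1%:R :> R by rewrite ltr0n.
have -> : C * (L%:R * (T / m.+1%:R) ^+ 2) * m.+2%:R =
    C * L%:R * T ^+ 2 / m.+1%:R * (m.+2%:R / m.+1%:R) by field; rewrite gt_eqF.
have -> : 2 * C * L%:R * T ^+ 2 / m.+1%:R = C * L%:R * T ^+ 2 / m.+1%:R * 2 by ring.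
rewrite ler_wpM2l ?divr_ge0 ?mulr_ge0 ?sqr_ge0 ?(ltW T0)//.
by rewrite ler_pdivrMr// -!natrM ler_nat mul2n -addnn addSn ltnS leq_addl.
Qed.

(** Bulinskaya's argument: a double zero makes |F| at most M (T / (m + 1))^2 at the grid point just
    below it. For each integer bound [L] on [M], some grid point among m + 2 has such a small value
    with probability O (1 / m), and this holds for every m. *)
Lemma ae_no_double_zero :
  {ae P, forall w, forall t, 0 <= t <= T -> F w t = 0 -> F' w t != 0}.
Proof.
pose U := \bigcup_L \bigcap_m close_grid L m.
apply: (@negligibleS _ _ _ P U).
  move=> w /= /existsNP[t /not_implyP[/andP[t0 tT]] /not_implyP[Ft]] /negP.
  rewrite negbK => /eqP F't.
  exists (Num.bound (M w)) => // m _; rewrite /close_grid.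
  have m0 : 0 < m.+1%:R :> R by rewrite ltr0n.
  have x0 : 0 <= t * m.+1%:R / T by rewrite divr_ge0 ?mulr_ge0// ltW.
  have /andP[j1 j2] := truncn_itv x0.
  set j := Num.truncn _ in j1 j2.
  have jm : (j < m.+2)%N.
    rewrite ltnS -(ler_nat R) (le_trans j1)// ler_pdivrMr//.
    by rewrite mulrC ler_wpM2l// ltW.
  rewrite -bigcup_mkord; exists j => //=.
  have gt : 0 <= t - grid m j <= T / m.+1%:R.
    have -> : t - grid m j = (T / m.+1%:R) * (t * m.+1%:R / T - j%:R).
      by rewrite /grid; field; rewrite !gt_eqF.
    have d0 : 0 <= T / m.+1%:R by rewrite divr_ge0// ltW.
    rewrite mulr_ge0 ?subr_ge0//= ler_piMr// lerBlDr.
    by rewrite addrC natr1 ltW.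
  rewrite /near_zero/=; apply: (le_trans (double_zero_bound (grid m j) Ft F't)).
  apply: ler_pM => //; first exact: sqr_ge0.
    by apply/ltW/archi_boundP.
  case/andP: gt => g1 g2.
  by rewrite -sqrrN opprB lerXn2r ?nnegrE// (le_trans g1).
apply: negligible_bigcup => L.
have mN : measurable (\bigcap_m close_grid L m) by exact: bigcapT_measurable.
exists (\bigcap_m close_grid L m); split => //.
apply/eqP; rewrite -measure_le0.
have lim0 : (2 * C * L%:R * T ^+ 2 / m.+1%:R)%:E @[m --> \oo] --> (0 : \bar R)%E.
  apply/fine_cvgP; split; first exact: nearW.
  rewrite -[X in _ --> X](mulr0 (2 * C * L%:R * T ^+ 2)).
  by apply: cvgM; [exact: cvg_cst|exact: cvg_harmonic].
rewrite -(cvg_lim _ lim0)//; apply: lime_ge; first by apply/cvg_ex; exists 0%E.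
apply: nearW => m; apply: le_trans (close_grid_le L m).
by apply: le_measure; rewrite ?inE//; exact: bigcap_inf.
Qed.

End double_zeros.

(** * Covariance of the random trigonometric polynomial *)

Section bounded_convergence.
Context {R : realType}.
Local Notation mu := (@lebesgue_measure R).
Local Open Scope ereal_scope.

Lemma bounded_cvg_integral (a b C : R) (f_ : nat -> R -> R) (f : R -> R) (N : set R) :
  (forall k, measurable_fun setT (f_ k)) -> measurable_fun setT f ->
  measurable N -> mu N = 0 ->
  (forall x, (a <= x <= b)%R -> ~ N x -> f_ k x @[k --> \oo] --> f x) ->
  (forall k x, (a <= x <= b)%R -> (`|f_ k x| <= C)%R) ->
  \int[mu]_(x in `[a, b]) (f_ k x)%:E @[k --> \oo] --> \int[mu]_(x in `[a, b]) (f x)%:E.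
Proof.
move=> mf_ mf mN N0 cvgf bound.
have mfE (g : R -> R) : measurable_fun setT g ->
    measurable_fun setT (fun x : measurableTypeR R => (g x)%:E).
  by move=> mg; apply/measurable_EFinP.
have mab : measurable (`[a, b]%classic : set R) by [].
have [||||//|_ _] := @dominated_convergence _ _ _ mu _ mab (fun k x => (f_ k x)%:E)
  (fun x => (f x)%:E) (fun=> C%:E).
- by move=> k; apply: measurable_funS (mfE _ (mf_ k)).
- by apply: measurable_funS (mfE _ mf).
- exists N; split => // x /= /not_implyP[]; rewrite in_itv/= => xab ncvg.
  by apply: contrapT => Nx; apply: ncvg; apply: cvg_EFin; [exact: nearW|exact: cvgf].
- apply/integrableP; split; first exact: measurable_cst.
  rewrite integral_cst//= lebesgue_measure_itv/=.
  by case: ifP => _; rewrite ?mule0 ?ltry// -EFinB -EFinM ltry.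
- exists set0; split => // x /= /existsNP[k] /not_implyP[]; rewrite in_itv/= => xab.
  by case; rewrite lee_fin bound.
exact.
Qed.

End bounded_convergence.

Section covariance.
Context {R : realType}.
Variables (n : nat) (alpha : R).
Local Notation C := (fun k l : nat => cos ((k%:R - l%:R) * alpha)).

(** By product-to-sum, the factor cos ((k - l) alpha) shifts both times by alpha and by - alpha:
    this is where the vector (D (t + alpha), D (t - alpha)) comes from. *)
Lemma sum_cos_cov (t u : R) :
  \sum_(1 <= k < n.+1) \sum_(1 <= l < n.+1)
    cos (k%:R * t - l%:R * u) * cos ((k%:R - l%:R) * alpha) =
  cos (n.+1%:R / 2 * (t - u)) * dotp n alpha t u / 2.
Proof.
transitivity ((\sum_(1 <= k < n.+1) \sum_(1 <= l < n.+1)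
    cos (k%:R * (t + alpha) - l%:R * (u + alpha)) +
  \sum_(1 <= k < n.+1) \sum_(1 <= l < n.+1)
    cos (k%:R * (t - alpha) - l%:R * (u - alpha))) / 2).
  rewrite -big_split mulr_suml; apply: eq_bigr => k _.
  rewrite -big_split mulr_suml; apply: eq_bigr => l _ /=.
  rewrite (_ : k%:R * (t + alpha) - l%:R * (u + alpha) =
    (k%:R * t - l%:R * u) + (k%:R - l%:R) * alpha); last by ring.
  rewrite (_ : k%:R * (t - alpha) - l%:R * (u - alpha) =
    (k%:R * t - l%:R * u) - (k%:R - l%:R) * alpha); last by ring.
  by move: (_ - _) (_ * alpha) => x y; rewrite cosD cosB; lra.
rewrite !sum_cos_sub.
have -> : t + alpha - (u + alpha) = t - u by ring.
have -> : t - alpha - (u - alpha) = t - u by ring.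
by rewrite -mulrDr.
Qed.

(** The variance of u f(t) + v f(t'), the two families of coefficients being those of [a] and of
    [b]. *)
Lemma quad_trig (u v t t' : R) : (0 < n)%N ->
  quad C n (fun k => (Num.sqrt n%:R)^-1 * (u * cos (k%:R * t) + v * cos (k%:R * t'))) +
  quad C n (fun k => (Num.sqrt n%:R)^-1 * (u * sin (k%:R * t) + v * sin (k%:R * t'))) =
  u ^+ 2 * (qform n alpha t / (2 * n%:R)) +
  2 * u * v * (cos (n.+1%:R / 2 * (t' - t)) * dotp n alpha t t' / (2 * n%:R)) +
  v ^+ 2 * (qform n alpha t' / (2 * n%:R)).
Proof.
move=> n0; have n0' : n%:R != 0 :> R by rewrite pnatr_eq0 -lt0n.
pose S (x y : R) := \sum_(1 <= k < n.+1) \sum_(1 <= l < n.+1)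
    cos (k%:R * x - l%:R * y) * cos ((k%:R - l%:R) * alpha).
transitivity (n%:R^-1 * (u ^+ 2 * S t t + u * v * S t t' + u * v * S t' t + v ^+ 2 * S t' t')).
  rewrite /quad /S !mulr_sumr -!big_split/= mulr_sumr.
  apply: eq_bigr => k _; rewrite !mulr_sumr -!big_split/= mulr_sumr.
  apply: eq_bigr => l _; rewrite !cosB.
  have -> : n%:R^-1 = (Num.sqrt n%:R)^-1 * (Num.sqrt n%:R)^-1 :> R.
    by rewrite -invfM -expr2 sqr_sqrtr.
  move: (cos _) (cos _) (cos _) (cos _) (cos _) (sin _) (sin _) (sin _) (sin _) (_^-1).
  move=> a b c d e a' b' c' d' s; ring.
rewrite /S !sum_cos_cov.
have -> : dotp n alpha t' t = dotp n alpha t t' by rewrite /dotp; ring.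
have -> : cos (n.+1%:R / 2 * (t - t')) = cos (n.+1%:R / 2 * (t' - t)).
  by rewrite -cosN; congr cos; ring.
rewrite !subrr mulr0 cos0 !dotptt.
by move: (cos _) (qform _ _ _) (qform _ _ _) (dotp _ _ _ _) => a b c e; field.
Qed.

End covariance.

(** * Expected number of zeros *)

Lemma measurable_speed {R : realType} (n : nat) (alpha : R) :
  measurable_fun setT (speed n alpha).
Proof.
have md (f : R -> R) : measurable_fun setT f -> measurable_fun setT (fun t => dker n (f t)).
  apply: measurableT_comp; apply: continuous_measurable_fun => x.
  exact: isd_continuous (is_derive_dker n x).
have mdd (f : R -> R) : measurable_fun setT f -> measurable_fun setT (fun t => ddker n (f t)).
  by apply: measurableT_comp; apply: continuous_measurable_fun; exact: continuous_ddker.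
by rewrite /speed /wronskian /qform; meas; (apply: md || apply: mdd); meas.
Qed.

Section random_trig_poly.
Context d (Omega : measurableType d) (R : realType) (P : probability Omega R).
Local Notation mu := (@lebesgue_measure R).
Variables (alpha : R) (a b : nat -> {RV P >-> R}).
Hypothesis gauss_a : gaussian_process a.
Hypothesis gauss_b : gaussian_process b.
Hypothesis centered_a : centered a.
Hypothesis centered_b : centered b.
Hypothesis indep_ab : independent_processes a b.
Hypothesis cov_a : forall k l : nat, (1 <= k)%N -> (1 <= l)%N ->
  ('E_P[(a k \* a l)%R] = (cos ((k%:R - l%:R) * alpha))%:E)%E.
Hypothesis cov_b : forall k l : nat, (1 <= k)%N -> (1 <= l)%N ->
  ('E_P[(b k \* b l)%R] = (cos ((k%:R - l%:R) * alpha))%:E)%E.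
Variable n : nat.
Hypothesis hna : 0 < 1 - `|cos (n%:R * alpha)|.

Local Notation F := (trig_poly a b n).
Local Notation kappa := (@kappa R).
Local Notation C := (fun k l : nat => cos ((k%:R - l%:R) * alpha)).

Let C11 : C 1%N 1%N != 0.
Proof. by rewrite /= subrr mul0r cos0 oner_neq0. Qed.

Let kappa0 : 0 < kappa.
Proof. exact: (kappa_gt0 gauss_a centered_a cov_a C11). Qed.

Let n0 : (0 < n)%N.
Proof. by case: n hna => //; rewrite mul0r cos0 normr1 subrr ltxx. Qed.

(** The squared scale of f t in the sense of [normal_law], hence the division by [kappa]. *)
Let variance t := qform n alpha t / (2 * n%:R) / kappa.

Let variance_gt0 t : 0 < variance t.
Proof. by rewrite !divr_gt0 ?qform_gt0 ?mulr_gt0 ?ltr0n. Qed.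

Lemma trig_poly_pair_law (t t' u v : R) :
  normal_law P (fun w => u * F w t + v * F w t') 0
    (Num.sqrt (u ^+ 2 * variance t +
      2 * u * v * (cos (n.+1%:R / 2 * (t' - t)) * dotp n alpha t t' / (2 * n%:R) / kappa) +
      v ^+ 2 * variance t')).
Proof.
have := lincomb2_law gauss_a gauss_b centered_a centered_b indep_ab cov_a cov_b C11 n
  (fun k => (Num.sqrt n%:R)^-1 * (u * cos (k%:R * t) + v * cos (k%:R * t')))
  (fun k => (Num.sqrt n%:R)^-1 * (u * sin (k%:R * t) + v * sin (k%:R * t'))).
rewrite quad_trig// -/kappa.
rewrite (_ : lincomb2 _ _ _ _ _ = fun w => u * F w t + v * F w t'); last first.
  apply/funext => w; rewrite /lincomb2 /lincomb /trig_poly.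
  rewrite -big_split/= !mulr_sumr -big_split/=; apply: eq_bigr => k _.
  ring.
have e (x y z k : R) : (x + y + z) / k = x / k + y / k + z / k by rewrite !mulrDl.
by rewrite e /variance -!(mulrA _ _ kappa^-1).
Qed.

Let measurable_trig_poly_pair :
  measurable_fun setT (fun p : Omega * R => F p.1 p.2).
Proof.
rewrite /trig_poly; apply: measurable_funM; first exact: measurable_cst.
under eq_fun do rewrite big_add1/=.
apply: measurable_sum => k; meas; exact: (measurableT_comp _ measurable_fst).
Qed.

Let measurable_trig_poly t : measurable_fun setT (F ^~ t).
Proof. exact: (measurableT_comp measurable_trig_poly_pair (pair2_measurable t)). Qed.

Definition dtrig_poly (w : Omega) (t : R) : R := (Num.sqrt n%:R)^-1 *
  \sum_(1 <= k < n.+1) (a k w * (- sin (k%:R * t) * k%:R) + b k w * (cos (k%:R * t) * k%:R)).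

Let is_derive_trig_poly w (t : R) : is_derive t (1 : R) (F w) (dtrig_poly w t).
Proof.
rewrite /trig_poly /dtrig_poly; eapply is_derive_eq.
  by isd; apply: isd_sum => k; isd.
cbv beta; rewrite mulr0 addr0; congr (_ * _).
by apply: eq_bigr => k _; rewrite /GRing.scale/=; ring.
Qed.

Let law1 t : normal_law P (F ^~ t) 0 (Num.sqrt (variance t)).
Proof.
have := trig_poly_pair_law t t 1 0.
rewrite expr1n mul1r mulr0 mul0r expr0n/= mul0r !addr0.
by under eq_fun do rewrite mul1r mul0r addr0.
Qed.

Let slope (w : Omega) : R := (Num.sqrt n%:R)^-1 *
  \sum_(1 <= k < n.+1) (`|a k w| * (k%:R * k%:R) + `|b k w| * (k%:R * k%:R)).

Let slope_ge0 w : 0 <= slope w.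
Proof.
by rewrite mulr_ge0 ?invr_ge0 ?sqrtr_ge0// sumr_ge0// => k _; rewrite addr_ge0 ?mulr_ge0.
Qed.

Let lipschitz_dtrig_poly w t u :
  `|dtrig_poly w t - dtrig_poly w u| <= slope w * `|t - u|.
Proof.
rewrite /dtrig_poly /slope -mulrBr -sumrB normrM -mulrA.
rewrite ger0_norm ?invr_ge0 ?sqrtr_ge0// ler_wpM2l ?invr_ge0 ?sqrtr_ge0//.
rewrite mulr_suml (le_trans (ler_norm_sum _ _ _))// ler_sum// => k _.
have hs : `|sin (k%:R * t) - sin (k%:R * u)| <= k%:R * `|t - u|.
  by rewrite (le_trans (lipschitz_sin _ _))// -mulrBr normrM normr_nat.
have hc : `|cos (k%:R * t) - cos (k%:R * u)| <= k%:R * `|t - u|.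
  by rewrite (le_trans (lipschitz_cos _ _))// -mulrBr normrM normr_nat.
rewrite (_ : _ - _ = - (a k w * ((sin (k%:R * t) - sin (k%:R * u)) * k%:R)) +
    b k w * ((cos (k%:R * t) - cos (k%:R * u)) * k%:R)); last by ring.
rewrite (le_trans (ler_normD _ _))// normrN !normrM normr_nat mulrDl.
by rewrite lerD// -!mulrA ler_wpM2l// mulrC ler_wpM2l.
Qed.

Let variance_ge t : (1 - `|cos (n%:R * alpha)|) / (2 * n%:R) / kappa <= variance t.
Proof.
by rewrite !ler_wpM2r ?invr_ge0 ?mulr_ge0 ?(ltW kappa0)// qform_ge.
Qed.

Let small_constant : R := 2 * normal_peak 1 /
  Num.sqrt ((1 - `|cos (n%:R * alpha)|) / (2 * n%:R) / kappa).

Let trig_poly_small (t e : R) : 0 <= e ->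
  (P [set w | (`|F w t| <= e)%R] <= (small_constant * e)%:E)%E.
Proof.
move=> e0; apply: (le_trans (normal_law_small _ _ e0 (@law1 (t)))) => //.
  by rewrite sqrtr_gt0.
rewrite lee_fin ler_wpM2r// ler_wpM2l ?mulr_ge0 ?normal_peak_ge0//.
by rewrite lef_pV2 ?posrE ?sqrtr_gt0 ?ler_wsqrtr// !divr_gt0 ?mulr_gt0 ?ltr0n.
Qed.

Lemma ae_simple_zeros : {ae P, forall w, forall t, 0 <= t <= 2 * pi ->
  F w t = 0 -> dtrig_poly w t != 0 /\ 0 < t < 2 * pi}.
Proof.
have pi2 : 0 < 2 * pi :> R by rewrite mulr_gt0 ?pi_gt0.
have sc : 0 <= small_constant.
  by rewrite divr_ge0 ?sqrtr_ge0// mulr_ge0 ?normal_peak_ge0.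
have nd := ae_no_double_zero pi2 sc measurable_trig_poly is_derive_trig_poly
  lipschitz_dtrig_poly slope_ge0 trig_poly_small.
have s0 t : 0 < Num.sqrt (variance t) by rewrite sqrtr_gt0.
have e0 := ae_neq0 (@measurable_trig_poly (0)) (s0 0) (@law1 (0)).
have e1 := ae_neq0 (@measurable_trig_poly (2 * pi)) (s0 _) (@law1 (2 * pi)).
apply: filterS3 nd e0 e1 => w h F0 F2 t /andP[t0 t2] Ft.
split; first by apply: h => //; rewrite t0.
rewrite !lt_neqAle t0 t2 !andbT; apply/andP; split.
  by apply: contraNneq F0 => e; move: Ft; rewrite -e => ->.
by apply: contraNneq F2 => <-; rewrite Ft.
Qed.

Lemma sign_change_acos (t h : R) : 0 < n.+1%:R / 2 * h < pi ->
  P [set w | F w t * F w (t + h) < 0] = (acos (rho n alpha h t) / pi)%:E.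
Proof.
move=> hp; have := rho_lt1 hna t hp; rewrite ltr_norml => /andP[r1 r2].
have r11 : -1 <= rho n alpha h t <= 1 by rewrite !ltW.
have a0 : 0 < acos (rho n alpha h t) by rewrite acos_gt0// ltW//=.
have ap : acos (rho n alpha h t) < pi by rewrite acos_ltpi// r1 ltW.
(* The angle b is asin rho, written pi / 2 - acos rho, so that 1 / 2 - b / pi = acos rho / pi. *)
rewrite (@sign_change_probability _ _ _ P (F ^~ t) (F ^~ (t + h)) (variance t)
  (variance (t + h)) (cos (n.+1%:R / 2 * h) * dotp n alpha t (t + h) / (2 * n%:R) / kappa)
  (pi / 2 - acos (rho n alpha h t)))//.
- congr EFin; have := @pi_gt0 R; move: (pi : R) => q q0; field; rewrite gt_eqF//.
- by apply/andP; split; lra.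
- rewrite sinB sin_pihalf cos_pihalf mul1r mul0r subr0 acosK ?in_itv//.
  rewrite -sqrtrM ?(ltW (variance_gt0 _))// /variance.
  have q0 s := qform_gt0 hna s.
  have k2 : 0 < 2 * n%:R * kappa by rewrite !mulr_gt0 ?ltr0n.
  rewrite (_ : _ * (_ / kappa) = (qform n alpha t * qform n alpha (t + h)) * (2 * n%:R * kappa) ^-2).
    rewrite sqrtrM ?mulr_ge0 ?ltW// sqrtrV ?exprn_ge0 ?ltW// sqrtr_sqr gtr0_norm// /rho.
    have sq0 := sqrt_qform_gt0 hna t h.
    move: (Num.sqrt _) (cos _) (dotp _ _ _ _) sq0 => x y z x0.
    by field; rewrite !gt_eqF// ltr0n.
  by move: (qform _ _ _) (qform _ _ _) => x y; field; rewrite !gt_eqF// ltr0n.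
- move=> u v; have := trig_poly_pair_law t (t + h) u v.
  by have -> : t + h - t = h by rewrite addrC addKr.
Qed.

Let measurable_acos_rho h : 0 < n.+1%:R / 2 * h < pi ->
  measurable_fun setT (fun t : R => acos (rho n alpha h t)).
Proof.
move=> hp; apply: continuous_measurable_fun => t.
have := rho_lt1 hna t hp; rewrite ltr_norml => r1.
apply: (@continuous_comp _ _ _ (rho n alpha h) acos); first exact: continuous_rho.
exact: continuous_acos.
Qed.

Lemma expected_num_zeros_trig_poly :
  (\int[P]_w num_zeros (F w) `[0%R, (2 * pi)%R] =
   \int[mu]_(t in `[0%R, (2 * pi)%R]) (speed n alpha t / pi)%:E)%E.
Proof.
apply: (expected_num_zeros measurable_trig_poly_pair is_derive_trig_poly ae_simple_zeros).
pose h k : R := k.+1%:R^-1.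
have h0 k : 0 < h k by rewrite invr_gt0 ltr0n.
have hl : h @ \oo --> 0 by exact: cvg_harmonic.
pose Cb := (n.+1%:R / 2) ^+ 2 / 2 + n%:R ^+ 4 / (1 - `|cos (n%:R * alpha)|).
(* The first [K] terms are skipped: from there on the probability formula and the uniform bound
   [acos_rho_le] hold for every term. *)
have [K HK] : exists K, forall k, (K <= k)%N -> n.+1%:R / 2 * h k < pi /\ Cb * h k ^+ 2 <= 1.
  have l1 : n.+1%:R / 2 * h k @[k --> \oo] --> n.+1%:R / 2 * (0 : R).
    by apply: cvgM => //; exact: cvg_cst.
  have l2 : Cb * (h k * h k) @[k --> \oo] --> Cb * (0 * 0).
    by apply: cvgM; [exact: cvg_cst|apply: cvgM].
  have e1 : \forall k \near \oo, n.+1%:R / 2 * h k < pi.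
    by apply: (@cvgr_lt R _ _ _ _ _ l1); rewrite mulr0 pi_gt0.
  have e2 : \forall k \near \oo, Cb * (h k * h k) < 1.
    by apply: (@cvgr_lt R _ _ _ _ _ l2); rewrite !mulr0 ltr01.
  have [K _ HK] : \forall k \near \oo, n.+1%:R / 2 * h k < pi /\ Cb * (h k * h k) < 1.
    by near=> k; split; near: k.
  by exists K => k /HK[-> /ltW].
have hK k : 0 < n.+1%:R / 2 * h (k + K)%N < pi.
  by have [-> _] := HK (k + K)%N (leq_addl _ _); rewrite mulr_gt0// divr_gt0// ltr0n.
have hlK : (fun k => h (k + K)%N) @ \oo --> 0 by rewrite (cvg_shiftn K).
(* The indicator replaces the varying domain [0, 2 pi - h] by a fixed one; it never reaches t = 2
   pi, the exceptional null point below. *)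
pose f k t := acos (rho n alpha (h (k + K)%N) t) / h (k + K)%N / pi *
  \1_(`[0, 2 * pi - h (k + K)%N]%classic : set R) t.
have acos_rho_ge0 k t : 0 <= acos (rho n alpha (h (k + K)%N) t).
  have := rho_lt1 hna t (hK k); rewrite ltr_norml => /andP[r1 r2].
  by rewrite acos_ge0// !ltW.
have mf k : measurable_fun setT (f k).
  apply: measurable_funM; last exact: measurable_indic.
  by meas; exact: measurable_acos_rho.
have mspeed : measurable_fun setT (fun t => speed n alpha t / pi).
  by meas; exact: measurable_speed.
rewrite -(cvg_shiftn K).
rewrite [X in X @ _ --> _](_ : _ = fun k =>
    (\int[mu]_(t in `[0%R, (2 * pi)%R]) (f k t)%:E)%E); last first.
  apply/funext => k.
  transitivity ((h (k + K)%N)^-1%:E *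
      \int[mu]_(t in `[0%R, (2 * pi - h (k + K)%N)%R]) (acos (rho n alpha (h (k + K)%N) t) / pi)%:E)%E.
    rewrite /h invrK -[LHS]/(mule _ _); apply: congr1; apply: eq_integral => t _.
    exact: (@sign_change_acos t _ (hK k)).
  rewrite -ge0_integralZl//; last 3 first.
  - apply/measurable_EFinP; apply: (measurable_funS measurableT) => //.
    by meas; exact: measurable_acos_rho.
  - by move=> t _; rewrite lee_fin divr_ge0// pi_ge0.
  - by rewrite lee_fin invr_ge0 ltW.
  rewrite [LHS]integral_mkcond [RHS]integral_mkcond; apply: eq_integral => t _.
  rewrite /patch !mem_setE/= !in_itv/=.
  have [/andP[t0 th]|th] := boolP (0 <= t <= 2 * pi - h (k + K)%N).
    rewrite t0/= (le_trans th) ?gerBl ?ltW//.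
    rewrite /f indicE mem_set/= ?in_itv/= ?t0// mulr1 -EFinM; congr EFin.
    by rewrite mulrCA mulrA.
  by case: ifP => // _; rewrite /f indicE memNset ?mulr0//= in_itv/=; exact/negP.
apply: (@bounded_cvg_integral _ _ _ (acos_rho_bound n alpha / pi) _ _ [set 2 * pi]) => //.
- exact: lebesgue_measure_set1.
- move=> t /andP[t0 t2] /= /eqP t2N.
  have {t2N}t2' : t < 2 * pi by rewrite lt_neqAle t2N.
  have : acos (rho n alpha (h (k + K)%N) t) / h (k + K)%N / pi @[k --> \oo] -->
      speed n alpha t / pi.
    apply: cvgM; last exact: cvg_cst.
    exact: (cvg_acos_rho hna (fun k => h0 (k + K)%N) hlK).
  apply: cvg_trans; apply: near_eq_cvg.
  have : \forall k \near \oo, h (k + K)%N < 2 * pi - t.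
    by apply: (@cvgr_lt R _ _ _ _ _ hlK); rewrite subr_gt0.
  apply: filterS => k hk.
  by rewrite /f indicE mem_set/= ?mulr1// in_itv/= t0/=; lra.
- move=> k t _; have [h1 h2] := HK (k + K)%N (leq_addl _ _).
  have p0 := @pi_gt0 R.
  rewrite /f ger0_norm ?mulr_ge0 ?invr_ge0 ?(ltW (h0 _)) ?(ltW p0) ?acos_rho_ge0//.
  apply: (@le_trans _ _ (acos (rho n alpha (h (k + K)%N) t) / h (k + K)%N / pi)).
    by rewrite ler_piMr ?mulr_ge0 ?invr_ge0 ?(ltW (h0 _)) ?(ltW p0) ?acos_rho_ge0//.
  by rewrite ler_pM2r ?invr_gt0// acos_rho_le.
Unshelve. all: by end_near. Qed.

End random_trig_poly.

(** * The Poisson kernel *)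

Section poisson_kernel.
Context {R : realType}.
Local Notation mu := (@lebesgue_measure R).

Lemma trig_lin_lt (M A B W u : R) : 0 < W -> 0 < M ->
  W ^+ 2 = M ^+ 2 - A ^+ 2 - B ^+ 2 -> A * cos u + B * sin u < M.
Proof.
move=> W0 M0 WE.
have h : (A * cos u + B * sin u) ^+ 2 <= A ^+ 2 + B ^+ 2.
  have -> : A ^+ 2 + B ^+ 2 = (A * cos u + B * sin u) ^+ 2 + (A * sin u - B * cos u) ^+ 2.
    have := cos2Dsin2 u; move: (cos u) (sin u) => c s e.
    by rewrite -[A ^+ 2 + _]mulr1 -e; ring.
  by rewrite lerDl sqr_ge0.
have W2 : 0 < W ^+ 2 by rewrite exprn_gt0.
move: (_ + _) h => X h; nra.
Qed.

(** The antiderivative u + 2 atan (...) is smooth on the whole line because its inner denominator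
    stays above W, so the cut caused by tan (u / 2) is avoided; the arctangent term has period 2 pi
    and contributes nothing. *)
Lemma integral_poisson (M A B W : R) : 0 < W -> 0 < M ->
  W ^+ 2 = M ^+ 2 - A ^+ 2 - B ^+ 2 ->
  (\int[mu]_(u in `[0%R, (2 * pi)%R]) (W / (M - (A * cos u + B * sin u)))%:E = (2 * pi)%:E)%E.
Proof.
move=> W0 M0 WE.
have XM u := trig_lin_lt u W0 M0 WE.
pose F u := u + 2 * atan ((A * sin u - B * cos u) / (M + W - (A * cos u + B * sin u))).
have dF (u : R) : is_derive u (1 : R) F (W / (M - (A * cos u + B * sin u))).
  have Xu := XM u.
  have K0 : M + W - (A * cos u + B * sin u) != 0 by rewrite gt_eqF//; lra.
  rewrite /F; isde; first exact: K0.
  have e := cos2Dsin2 u.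
  have eY : (A * sin u - B * cos u) ^+ 2 = M ^+ 2 - W ^+ 2 - (A * cos u + B * sin u) ^+ 2.
    rewrite WE; move: (cos u) (sin u) e => c s e.
    have -> : M ^+ 2 - (M ^+ 2 - A ^+ 2 - B ^+ 2) = (A ^+ 2 + B ^+ 2) * (c ^+ 2 + s ^+ 2).
      by rewrite e; ring.
    ring.
  have D0 : (M + W - (A * cos u + B * sin u)) ^+ 2 + (A * sin u - B * cos u) ^+ 2 =
    2 * (M + W) * (M - (A * cos u + B * sin u)) by rewrite eY; ring.
  have -> : A * (- sin u * 1) + cos u * 0 + (B * (cos u * 1) + sin u * 0) =
    - (A * sin u - B * cos u) by ring.
  have -> : A * (cos u * 1) + sin u * 0 - (B * (- sin u * 1) + cos u * 0) =
    A * cos u + B * sin u by ring.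
  rewrite mulr0 addr0.
  move: (A * sin u - B * cos u) (A * cos u + B * sin u) Xu K0 eY D0 => Y X Xu K0 eY D0.
  have MX : M - X != 0 by rewrite gt_eqF// subr_gt0.
  have MW : M + W != 0 by rewrite gt_eqF// addr_gt0.
  have -> : (1 + (Y / (M + W - X)) ^+ 2)^-1 = (M + W - X) ^+ 2 / (2 * (M + W) * (M - X)).
    have -> : 1 + (Y / (M + W - X)) ^+ 2 = ((M + W - X) ^+ 2 + Y ^+ 2) / (M + W - X) ^+ 2.
      by field.
    by rewrite D0 invf_div.
  have -> : Y * (- (M + W - X) ^- 2 * (0 - - Y)) + (M + W - X)^-1 * X =
      (M + W) * (X - M + W) / (M + W - X) ^+ 2.
    have -> : (M + W) * (X - M + W) = (M + W - X) * X - Y ^+ 2 by rewrite eY; ring.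
    by field.
  by field; rewrite K0 MX MW.
have pi2 : 0 <= 2 * pi :> R by rewrite mulr_ge0// pi_ge0.
rewrite (@integral_is_derive _ _ F _ _ pi2 (fun u _ => dF u)).
  rewrite /F; have -> : 2 * pi = pi *+ 2 :> R by rewrite mulr2n; ring.
  rewrite sin2pi cos2pi sin0 cos0; congr EFin.
  by move: (atan _) (pi *+ 2) => x y; ring.
move=> u _; apply: (@isd_continuous _ _ _ _); isd.
by rewrite gt_eqF// subr_gt0.
Qed.

Implicit Types (alpha x s u : R).

Lemma g_periodic alpha x s u : g alpha x s (u + 2 * pi) = g alpha x s u.
Proof.
have h y : sin ((u + 2 * pi + y) / 2) ^+ 2 = sin ((u + y) / 2) ^+ 2.
  by rewrite (_ : (u + 2 * pi + y) / 2 = (u + y) / 2 + pi) ?sinDpi ?sqrrN//; lra.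
by rewrite /g !h.
Qed.

(** Hence |g| integrated over a period in [u] has period pi in [x]. *)
Lemma g_shift_pi alpha x s u : g alpha (x + pi) s (u + pi) = - g alpha x s u.
Proof.
rewrite /g sinDpi (_ : u + pi - (x + pi) = u - x); last by lra.
rewrite (_ : (u + pi + (x + pi)) / 2 = (u + x) / 2 + pi); last by lra.
by rewrite sinDpi sqrrN !mulNr.
Qed.

Lemma sin_sqr_half x : sin (x / 2) ^+ 2 = (1 - cos x) / 2.
Proof. by rewrite one_sub_cos; lra. Qed.

(** With a and b the two sines, half-angle formulas turn |g| into the Poisson kernel W / (M - A cos
    u - B sin u), where M^2 - A^2 - B^2 = W^2. Its integral is 2 pi; if the numerator vanishes it is
    0. *)
Lemma integral_norm_g_le alpha x s :
  (\int[mu]_(u in `[0%R, (2 * pi)%R]) (`|g alpha x s u|)%:E <= (2 * pi)%:E)%E.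
Proof.
set a := sin ((s + alpha) / 2); set b := sin ((s - alpha) / 2).
have p0 := @pi_gt0 R.
have [ab0|ab0] := eqVneq (sin x * b * a) 0.
  under eq_integral do rewrite /g -/a -/b ab0 mul0r normr0.
  by rewrite integral0 lee_fin mulr_ge0// ltW.
have [x0 b0 a0] : [/\ sin x != 0, b != 0 & a != 0].
  by move: ab0; rewrite !mulf_eq0 !negb_or => /andP[/andP[]].
pose M := a ^+ 2 + b ^+ 2.
pose A := M * cos x; pose B := (a ^+ 2 - b ^+ 2) * sin x.
pose W : R := `|2 * (sin x * b * a)|.
have W0 : 0 < W by rewrite normr_gt0 mulf_neq0// pnatr_eq0.
have M0 : 0 < M by rewrite addr_gt0// exprn_even_gt0.
have WE : W ^+ 2 = M ^+ 2 - A ^+ 2 - B ^+ 2.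
  rewrite /W real_normK ?num_real// /A /B /M.
  rewrite [((_ + _) * cos x) ^+ 2]exprMn cos2sin2.
  by move: (sin x) => y; ring.
rewrite -(integral_poisson W0 M0 WE) le_eqVlt; apply/orP; left; apply/eqP.
apply: eq_integral => u _; congr EFin.
rewrite /g -/a -/b (sin_sqr_half (u - x)) (sin_sqr_half (u + x)) (cosD u x) (cosB u x).
have -> : (1 - (cos u * cos x + sin u * sin x)) / 2 * a ^+ 2 +
    (1 - (cos u * cos x - sin u * sin x)) / 2 * b ^+ 2 = (M - (A * cos u + B * sin u)) / 2.
  by rewrite /A /B /M; move: (cos u) (sin u) (cos x) (sin x) => c1 s1 c2 s2; field.
have Xu := trig_lin_lt u W0 M0 WE.
rewrite normrM normfV (gtr0_norm (_ : 0 < (M - _) / 2)) ?divr_gt0 ?subr_gt0//.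
have -> : W = 2 * `|sin x * b * a| by rewrite /W (normrM 2) gtr0_norm.
by rewrite invf_div; ring.
Qed.

(** [g] is homogeneous of degree 0 in its two sines, hence a function of their ratio; the hypotheses
    say that the ratios at [s] and [s'] agree in modulus up to a factor [r]. *)
Lemma g_compare alpha x s s' u (r : R) : 0 <= r ->
  sin ((s + alpha) / 2) != 0 -> sin ((s - alpha) / 2) != 0 ->
  `|sin ((s' + alpha) / 2)| * `|sin ((s - alpha) / 2)| <=
    r * (`|sin ((s + alpha) / 2)| * `|sin ((s' - alpha) / 2)|) ->
  `|sin ((s + alpha) / 2)| * `|sin ((s' - alpha) / 2)| <=
    r * (`|sin ((s' + alpha) / 2)| * `|sin ((s - alpha) / 2)|) ->
  `|g alpha x s' u| <= r * `|g alpha x s u|.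
Proof.
rewrite /g; move: (sin ((s + alpha) / 2)) (sin ((s - alpha) / 2)) => a b.
move: (sin ((s' + alpha) / 2)) (sin ((s' - alpha) / 2)) => a' b' r0 a0 b0 h1 h2.
have sq (y : R) : y ^+ 2 = `|y| ^+ 2 by rewrite real_normK ?num_real.
rewrite !normrM !normfV.
have n0 (p q c d : R) : `|p ^+ 2 * c ^+ 2 + q ^+ 2 * d ^+ 2| = p ^+ 2 * `|c| ^+ 2 + q ^+ 2 * `|d| ^+ 2.
  by rewrite ger0_norm -?sq// addr_ge0// mulr_ge0 ?sqr_ge0.
rewrite !n0; have {a0} : 0 < `|a| by rewrite normr_gt0.
have {b0} : 0 < `|b| by rewrite normr_gt0.
move: (sin ((u - x) / 2)) (sin ((u + x) / 2)) => p q.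
have := normr_ge0 (sin x); have := normr_ge0 a'; have := normr_ge0 b'.
move: `|sin x| `|a| `|b| `|a'| `|b'| h1 h2 => c A B A' B' h1 h2 B'0 A'0 c0 B0 A0.
(* Here both denominators vanish, and both values of [g] are 0 by the convention on division. *)
have [pq0|pq0] := eqVneq (p ^+ 2 + q ^+ 2) 0.
  have p20 : p ^+ 2 = 0 by have := sqr_ge0 p; have := sqr_ge0 q; lra.
  have q20 : q ^+ 2 = 0 by have := sqr_ge0 p; have := sqr_ge0 q; lra.
  by rewrite p20 q20 !mul0r addr0 invr0 !mulr0.
have P0 := sqr_ge0 p; have Q0 := sqr_ge0 q.
move: (p ^+ 2) (q ^+ 2) pq0 P0 Q0 => P Q pq0 P0 Q0.
have D0 : 0 < P * A ^+ 2 + Q * B ^+ 2.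
  rewrite lt0r; apply/andP; split; last by apply: addr_ge0; apply: mulr_ge0 => //; apply: sqr_ge0.
  apply: contraNneq pq0 => e.
  have e1 : P * A ^+ 2 = 0.
    have : 0 <= P * A ^+ 2 by rewrite mulr_ge0 ?sqr_ge0.
    have : 0 <= Q * B ^+ 2 by rewrite mulr_ge0 ?sqr_ge0.
    lra.
  have e2 : Q * B ^+ 2 = 0 by lra.
  move/eqP : e1; rewrite mulf_eq0 (gt_eqF (exprn_gt0 2 A0)) orbF => /eqP ->.
  by move/eqP : e2; rewrite mulf_eq0 (gt_eqF (exprn_gt0 2 B0)) orbF => /eqP ->; rewrite addr0.
have D'0 : 0 <= P * A' ^+ 2 + Q * B' ^+ 2 by rewrite addr_ge0 ?mulr_ge0 ?sqr_ge0.
move: D'0; rewrite le_eqVlt => /predU1P[<-|D'0].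
  by rewrite invr0 mulr0 !mulr_ge0 ?invr_ge0 ?(ltW D0)// ltW.
rewrite ler_pdivrMr//.
have -> : r * (c * B * A / (P * A ^+ 2 + Q * B ^+ 2)) * (P * A' ^+ 2 + Q * B' ^+ 2) =
  c * (r * (B * A * (P * A' ^+ 2 + Q * B' ^+ 2))) / (P * A ^+ 2 + Q * B ^+ 2) by ring.
rewrite ler_pdivlMr// -!mulrA ler_wpM2l//.
(* With denominators cleared, the inequality holds separately for the terms in [P] and in [Q]. *)
have k1 : P * (A * A') * (A * B') <= P * (A * A') * (r * (A' * B)).
  by rewrite ler_wpM2l// !mulr_ge0// ltW.
have k2 : Q * (B * B') * (A' * B) <= Q * (B * B') * (r * (A * B')).
  by rewrite ler_wpM2l// !mulr_ge0// ltW.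
rewrite [leLHS](_ : _ = P * (A * A') * (A * B') + Q * (B * B') * (A' * B)); last by ring.
rewrite [leRHS](_ : _ = P * (A * A') * (r * (A' * B)) + Q * (B * B') * (r * (A * B'))); last by ring.
exact: lerD.
Qed.

End poisson_kernel.

(** * Periodicity *)

Section periodicity.
Context {R : realType}.
Local Notation mu := (@lebesgue_measure R).
Implicit Types (alpha x s u : R).

Lemma periodic_int (U : Type) (f : R -> U) (T : R) :
  (forall x, f (x + T) = f x) -> forall (x : R) (j : int), f (x + j%:~R * T) = f x.
Proof.
move=> fT.
have h (m : nat) x : f (x + m%:R * T) = f x.
  elim: m x => [|m IH] x; first by rewrite mul0r addr0.
  by rewrite -natr1 mulrDl mul1r addrA fT IH.
move=> x [m|m]; first by rewrite -pmulrn h.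
by rewrite NegzE mulrNz mulNr -pmulrn -(h m.+1) subrK.
Qed.

Lemma lebesgue_measure_itv_2pi : mu `[0%R, (2 * pi)%R] = (2 * pi)%:E.
Proof.
rewrite lebesgue_measure_itv/= lte_fin ifT -?EFinB ?subr0//.
by rewrite mulr_gt0 ?pi_gt0.
Qed.

Definition gsqrt alpha x s u : R := Num.sqrt (1 + `|g alpha x s u| ^+ 2).

Lemma measurable_gsqrt d (T : measurableType d) alpha x (f h : T -> R) :
  measurable_fun setT f -> measurable_fun setT h ->
  measurable_fun setT (fun p => gsqrt alpha x (f p) (h p)).
Proof. by move=> mf mh; rewrite /gsqrt /g; meas. Qed.

Lemma gsqrt_ge0 alpha x s u : 0 <= gsqrt alpha x s u.
Proof. exact: sqrtr_ge0. Qed.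

Lemma gsqrt_le alpha x s u : gsqrt alpha x s u <= 1 + `|g alpha x s u|.
Proof.
have g0 := normr_ge0 (g alpha x s u).
rewrite -[leRHS]ger0_norm ?addr_ge0// -sqrtr_sqr ler_wsqrtr//.
by move: (`|g _ _ _ _|) g0 => y y0; nra.
Qed.

Lemma integral_gsqrt_shift alpha x s c :
  (\int[mu]_(u in `[0%R, (2 * pi)%R]) (gsqrt alpha x s (u + c))%:E =
   \int[mu]_(u in `[0%R, (2 * pi)%R]) (gsqrt alpha x s u)%:E)%E.
Proof.
apply: (@ge0_integral_periodic _ (2 * pi) (fun u => (gsqrt alpha x s u)%:E)).
- by rewrite mulr_gt0 ?pi_gt0.
- by apply/measurable_EFinP; apply: measurable_gsqrt => //; exact: measurable_cst.
- by move=> u; rewrite lee_fin gsqrt_ge0.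
- by move=> u; rewrite /gsqrt g_periodic.
Qed.

Lemma integral_gsqrt_le alpha x s :
  (\int[mu]_(u in `[0%R, (2 * pi)%R]) (gsqrt alpha x s u)%:E <= (4 * pi)%:E)%E.
Proof.
have p2 : 0 <= 2 * pi :> R by rewrite mulr_ge0 ?pi_ge0.
apply: (@le_trans _ _ (\int[mu]_(u in `[0%R, (2 * pi)%R]) (1%:E + `|g alpha x s u|%:E))%E).
  apply: ge0_le_integral_nomeas => u _; first by rewrite lee_fin gsqrt_ge0.
  by rewrite -EFinD lee_fin gsqrt_le.
rewrite ge0_integralD//; last first.
  by apply/measurable_EFinP; apply: measurable_funTS; rewrite /g; meas.
rewrite integral_cst//; apply: (@le_trans _ _ (1%:E * (2 * pi)%:E + (2 * pi)%:E)%E).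
  apply: leeD; last exact: integral_norm_g_le.
  by apply: lee_wpmul2l => //; rewrite -lebesgue_measure_itv_2pi.
by rewrite -EFinM -EFinD lee_fin; lra.
Qed.

Lemma ellE alpha x : ell alpha x = ((4 * pi ^+ 2)^-1%:E *
  \int[mu]_(s in `[0%R, (2 * pi)%R])
    \int[mu]_(u in `[0%R, (2 * pi)%R]) (gsqrt alpha x s u)%:E)%E.
Proof.
rewrite /ell; apply: congr1.
rewrite (@ge0_fubini_setXE _ _ _ _ _ mu mu _ _
  (fun z => (gsqrt alpha x z.1 z.2)%:E))//.
- by apply/measurable_EFinP; apply: measurable_gsqrt; [exact: measurable_fst|exact: measurable_snd].
- by move=> p; rewrite lee_fin gsqrt_ge0.
Qed.

(** Allows the limit functional to be evaluated at n alpha itself. *)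
Lemma ell_mod_pi alpha y : ell alpha (mod_pi y) = ell alpha y.
Proof.
rewrite -[in RHS](subrK ((Num.floor (y / pi))%:~R * pi) y) -/(mod_pi y).
apply/esym/(@periodic_int _ (ell alpha)) => x; rewrite !ellE; apply: congr1.
apply: eq_integral => s _; rewrite -[LHS](integral_gsqrt_shift _ _ _ pi).
by apply: eq_integral => u _; rewrite /gsqrt g_shift_pi normrN.
Qed.

End periodicity.

(** * The Dirichlet kernel near its peaks, its periodicity and its derivative *)

Section wronskian_formula.
Context {R : realType}.
Variables (n : nat) (alpha : R).
Hypothesis n0 : (0 < n)%N.
Implicit Types (t x : R).

Lemma norm_sinDpi_int x (j : int) : `|sin (x + j%:~R * pi)| = `|sin x|.
Proof. by apply: (@periodic_int R _ (fun x => `|sin x|)) => y; rewrite sinDpi normrN. Qed.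

(** Doubling: sin x = 2 sin (x / 2) cos (x / 2) >= x cos^2 (x / 2) = x (1 + cos x) / 2. *)
Lemma sin_ge_half x : 0 <= x <= pi / 2 -> x / 2 <= sin x.
Proof.
move=> /andP[x0 xp]; have p0 := @pi_gt0 R.
have h : x / 2 * cos (x / 2) <= sin (x / 2) by apply: cos_le_sinc; apply/andP; split; lra.
have c0 : 0 <= cos x by apply: cos_ge0_pihalf; apply/andP; split; lra.
have ch0 : 0 <= cos (x / 2) by apply: cos_ge0_pihalf; apply/andP; split; lra.
have e := one_add_cos x.
have -> : sin x = 2 * (cos (x / 2) * sin (x / 2)).
  have {1}-> : x = x / 2 + x / 2 by lra.
  by rewrite sinD; ring.
move: (cos (x / 2)) (sin (x / 2)) (cos x) h c0 ch0 e => c s C h C0 c0 e.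
nra.
Qed.

Lemma norm_sin_ge_half x : `|x| <= pi / 2 -> `|x| / 2 <= `|sin x|.
Proof.
move=> xp; have [x0|x0] := leP 0 x.
  rewrite (ger0_norm x0) in xp *; apply: le_trans (ler_norm _).
  by apply: sin_ge_half; rewrite x0.
rewrite (ltr0_norm x0) in xp *; rewrite -normrN -sinN; apply: le_trans (ler_norm _).
by apply: sin_ge_half; rewrite xp oppr_ge0 ltW.
Qed.

Lemma near_int_pi x : exists j : int, `|x - j%:~R * pi| <= pi / 2.
Proof.
have p0 := @pi_gt0 R; exists (Num.floor (x / pi + 2^-1)).
have := floor_itv (x / pi + 2^-1); move: (Num.floor _) => j; rewrite intrD => /andP[h1 h2].
have -> : x - j%:~R * pi = pi * (x / pi - j%:~R).
  by rewrite mulrBr [pi * (_ / pi)]mulrC divfK ?gt_eqF// [pi * _]mulrC.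
rewrite normrM gtr0_norm// ler_wpM2l ?(ltW p0)// ler_norml; apply/andP; split; lra.
Qed.

Lemma sin_eq0 x : sin x = 0 -> exists j : int, x = j%:~R * pi.
Proof.
move=> sx; have [j xj] := near_int_pi x; exists j.
have := norm_sin_ge_half xj; rewrite -(norm_sinDpi_int _ j) subrK sx normr0.
move=> h; apply/eqP; rewrite -subr_eq0 -normr_eq0 eq_le normr_ge0 andbT; lra.
Qed.

Lemma freq_2pi t k : freq n k * (t + 2 * pi) =
  (freq n k * t - n.+1%:R * pi) + k%:R * (2 * pi).
Proof. by rewrite /freq; move: (pi : R) => p; field. Qed.

Lemma cosD_2pi x k : cos (x + k%:R * (2 * pi)) = cos x :> R.
Proof.
have := @periodic_int R _ (@cos R) (2 * pi) _ x k; rewrite -pmulrn; apply => y.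
have -> : y + 2 * pi = y + pi + pi by ring.
by rewrite !cosDpi opprK.
Qed.

Lemma sinD_2pi x (k : nat) : sin (x + k%:R * (2 * pi)) = sin x :> R.
Proof.
have := @periodic_int R _ (@sin R) (2 * pi) _ x k; rewrite -pmulrn; apply => y.
have -> : y + 2 * pi = y + pi + pi by ring.
by rewrite !sinDpi opprK.
Qed.

Lemma cos_nat_pi k : cos (k%:R * pi) ^+ 2 = 1 :> R.
Proof.
elim: k => [|k IH]; first by rewrite mul0r cos0 expr1n.
by rewrite -natr1 mulrDl mul1r cosDpi sqrrN.
Qed.

Lemma sin_nat_pi k : sin (k%:R * pi) = 0 :> R.
Proof.
elim: k => [|k IH]; first by rewrite mul0r sin0.
by rewrite -natr1 mulrDl mul1r sinDpi IH oppr0.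
Qed.

(** For even [n] the centred frequencies are half-integers, so D is 2 pi-periodic only up to the
    sign (-1)^(n + 1), which cancels in [speed]. *)
Lemma dker_2pi t : dker n (t + 2 * pi) = cos (n.+1%:R * pi) * dker n t.
Proof.
rewrite /dker mulr_sumr; apply: eq_bigr => k _.
by rewrite freq_2pi cosD_2pi cosB sin_nat_pi mulr0 addr0 mulrC.
Qed.

Lemma ddker_2pi t : ddker n (t + 2 * pi) = cos (n.+1%:R * pi) * ddker n t.
Proof.
rewrite /ddker mulrN mulr_sumr; congr (- _); apply: eq_bigr => k _.
by rewrite freq_2pi sinD_2pi sinB sin_nat_pi mulr0 subr0; ring.
Qed.

Lemma norm_dker_2pi_int t (j : int) : `|dker n (t + j%:~R * (2 * pi))| = `|dker n t|.
Proof.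
apply: (@periodic_int R _ (fun t => `|dker n t|)) => y.
rewrite dker_2pi normrM (_ : `|cos _| = 1) ?mul1r//.
by apply/eqP; rewrite -(@eqrXn2 _ 2)// expr1n real_normK ?num_real// cos_nat_pi.
Qed.

Let addr2pi t (c : R) : t + 2 * pi + c = t + c + 2 * pi.
Proof. by rewrite addrAC. Qed.

Lemma speed_2pi t : speed n alpha (t + 2 * pi) = speed n alpha t.
Proof.
rewrite /speed; congr (Num.sqrt (_ + _ ^+ 2)).
rewrite /wronskian /qform !addr2pi !dker_2pi !ddker_2pi.
have := cos_nat_pi n.+1; move: (cos _) => e e2.
rewrite !exprMn e2 !mul1r; congr (_ / _).
rewrite [LHS](_ : _ = e ^+ 2 * (dker n (t + alpha) * ddker n (t - alpha) -
  dker n (t - alpha) * ddker n (t + alpha))); last by ring.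
by rewrite e2 mul1r.
Qed.

(** If t / 2 differs from a multiple of pi by e with |e| <= 1 / n, all angles freq k * 2 e are at
    most 1 in modulus and every cosine is at least 1 / 2. The threshold 1 / (2 n) comes from |sin e|
    >= |e| / 2. *)
Lemma dker_large t : `|sin (t / 2)| <= (2 * n%:R)^-1 -> n%:R / 2 <= `|dker n t|.
Proof.
move=> hs; have p0 := @pi_gt0 R; have nR : 0 < n%:R :> R by rewrite ltr0n.
have [j ep] := near_int_pi (t / 2); set e := _ - _ in ep.
have se : `|sin (t / 2)| = `|sin e| by rewrite -(norm_sinDpi_int e j) subrK.
have e1 : `|e| <= n%:R^-1.
  have := norm_sin_ge_half ep; rewrite -se => h.
  have := le_trans h hs; rewrite invfM; lra.
have -> : `|dker n t| = `|dker n (2 * e)|.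
  rewrite -(norm_dker_2pi_int (2 * e) j); congr (`|dker n _|).
  by rewrite [_ * (2 * pi)]mulrCA -mulrDr subrK; lra.
apply: le_trans (ler_norm _); rewrite /dker.
apply: (@le_trans _ _ (\sum_(1 <= k < n.+1) 2^-1)).
  by rewrite sumr_const_nat subn1/= -[leRHS]mulr_natr mulrC.
rewrite ler_sum_nat// => k kn.
have := one_sub_cos_le (freq n k * (2 * e)).
have : (freq n k * (2 * e)) ^+ 2 <= 1.
  have fk : `|freq n k| <= n%:R / 2 :> R.
    have [k1 k2] := andP kn; rewrite ler_norml /freq -[n.+1%:R]natr1.
    have k1' : 1 <= k%:R :> R by rewrite ler1n.
    have k2' : k%:R <= n%:R :> R by rewrite ler_nat.
    by apply/andP; split; lra.
  rewrite -real_normK ?num_real// expr_le1// normrM (normrM 2) [`|2|]gtr0_norm//.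
  apply: (@le_trans _ _ (n%:R / 2 * (2 * n%:R^-1))).
    by rewrite ler_pM// ler_wpM2l.
  by rewrite mulrA divfK// mulfV// gt_eqF.
by lra.
Qed.

Lemma ddker_sin t : ddker n t * sin (t / 2) =
  n%:R / 2 * cos (n%:R * t / 2) - dker n t * cos (t / 2) / 2.
Proof.
have h1 : is_derive t 1 (fun t => dker n t * sin (t / 2))
    (dker n t * (cos (t / 2) / 2) + sin (t / 2) * ddker n t).
  apply: isdM; first exact: is_derive_dker.
  by isde; ring.
have h2 : is_derive t 1 (fun t : R => sin (n%:R * t / 2)) (n%:R / 2 * cos (n%:R * t / 2)).
  by isde; ring.
have e : (fun t => dker n t * sin (t / 2)) = (fun t : R => sin (n%:R * t / 2)).
  by apply/funext => x; exact: dker_sin.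
rewrite e in h1.
have := @derive_val _ _ _ _ _ _ _ h1; rewrite (@derive_val _ _ _ _ _ _ _ h2) => ->.
ring.
Qed.

End wronskian_formula.

(** * The normalized speed *)

Section normalized_speed.
Context {R : realType}.
Variables (n : nat) (alpha : R).
Hypothesis n0 : (0 < n)%N.
Hypothesis hna : 0 < 1 - `|cos (n%:R * alpha)|.
Implicit Types (s t x u v : R).

Let nR : 0 < n%:R :> R. Proof. by rewrite ltr0n. Qed.

Local Notation sp t := (sin ((t + alpha) / 2)).
Local Notation sm t := (sin ((t - alpha) / 2)).

Definition nspeed t : R := 2 / n%:R * speed n alpha t.

Lemma nspeedE t : nspeed t =
  Num.sqrt ((1 + n%:R^-1) ^+ 2 + (2 / n%:R * (wronskian n alpha t / qform n alpha t)) ^+ 2).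
Proof.
rewrite /nspeed /speed; move: (_ / qform _ _ _) => y.
rewrite (_ : (1 + n%:R^-1) ^+ 2 + (2 / n%:R * y) ^+ 2 =
    (2 / n%:R) ^+ 2 * ((n.+1%:R / 2) ^+ 2 + y ^+ 2)).
  by rewrite sqrtrM ?sqr_ge0// sqrtr_sqr ger0_norm// divr_ge0.
by rewrite -natr1; field; rewrite gt_eqF.
Qed.

(** With D' obtained by differentiating [dker_sin], the sine subtraction formulas reduce the
    Wronskian times both sines to n sin (n alpha) / 2 - D (t + alpha) D (t - alpha) sin alpha / 2,
    and the denominator of [g] becomes qform times the squared product of the sines. The remainder
    is thus exact. *)
Lemma wronskian_g t : sp t != 0 -> sm t != 0 ->
  2 / n%:R * (wronskian n alpha t / qform n alpha t) =
  g alpha (n%:R * alpha) t (n%:R * t) -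
  dker n (t + alpha) * dker n (t - alpha) / qform n alpha t * (sin alpha / (n%:R * (sp t * sm t))).
Proof.
move=> p0 m0; have Q0 := lt0r_neq0 (qform_gt0 hna t).
have e1 := dker_sin n (t + alpha); have e2 := dker_sin n (t - alpha).
have d1 := ddker_sin n (t + alpha); have d2 := ddker_sin n (t - alpha).
have hx : sin (n%:R * alpha) = sin (n%:R * (t + alpha) / 2) * cos (n%:R * (t - alpha) / 2) -
    cos (n%:R * (t + alpha) / 2) * sin (n%:R * (t - alpha) / 2).
  by rewrite -sinB; congr sin; lra.
have ha : sin alpha = sp t * cos ((t - alpha) / 2) - cos ((t + alpha) / 2) * sm t.
  by rewrite -sinB; congr sin; lra.
have hW : wronskian n alpha t * (sp t * sm t) = n%:R / 2 * sin (n%:R * alpha) -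
    dker n (t + alpha) * dker n (t - alpha) * sin alpha / 2.
  rewrite hx ha -e1 -e2 /wronskian.
  transitivity (dker n (t + alpha) * sp t * (ddker n (t - alpha) * sm t) -
    dker n (t - alpha) * sm t * (ddker n (t + alpha) * sp t)); first by ring.
  by rewrite d1 d2; field.
have -> : wronskian n alpha t = (n%:R / 2 * sin (n%:R * alpha) -
    dker n (t + alpha) * dker n (t - alpha) * sin alpha / 2) / (sp t * sm t).
  by rewrite -hW mulfK// mulf_neq0.
have -> : g alpha (n%:R * alpha) t (n%:R * t) = sin (n%:R * alpha) / (sp t * sm t * qform n alpha t).
  rewrite /g (_ : (n%:R * t - n%:R * alpha) / 2 = n%:R * (t - alpha) / 2); last by lra.
  rewrite (_ : (n%:R * t + n%:R * alpha) / 2 = n%:R * (t + alpha) / 2); last by lra.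
  rewrite -e1 -e2.
  have -> : (dker n (t - alpha) * sm t) ^+ 2 * sp t ^+ 2 + (dker n (t + alpha) * sp t) ^+ 2 * sm t ^+ 2 =
    (sp t * sm t) ^+ 2 * qform n alpha t by rewrite /qform; ring.
  move: (qform _ _ _) Q0 (sp t) (sm t) p0 m0 (sin (n%:R * alpha)) => q q0 a b a0 b0 c.
  by field; rewrite q0 a0 b0.
move: (qform _ _ _) Q0 (sp t) (sm t) p0 m0 (sin (n%:R * alpha)) (sin alpha) => q q0 a b a0 b0 c e.
by field; rewrite q0 a0 b0 gt_eqF.
Qed.

Lemma norm_sin_alpha_le t : `|sin alpha| <= `|sp t| + `|sm t|.
Proof.
have -> : sin alpha = sp t * cos ((t - alpha) / 2) - cos ((t + alpha) / 2) * sm t.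
  by rewrite -sinB; congr sin; lra.
rewrite (le_trans (ler_normB _ _))// !normrM lerD//.
  by rewrite ler_piMr// norm_cos_le1.
by rewrite ler_piMl// norm_cos_le1.
Qed.

Lemma sqrt_triangle (a b c e : R) :
  Num.sqrt (a ^+ 2 + b ^+ 2) <= Num.sqrt (c ^+ 2 + e ^+ 2) + (`|a - c| + `|b - e|).
Proof.
set r := Num.sqrt (c ^+ 2 + e ^+ 2).
have r0 : 0 <= r := sqrtr_ge0 _.
have hc : c ^+ 2 + e ^+ 2 = r ^+ 2 by rewrite sqr_sqrtr// addr_ge0 ?sqr_ge0.
have cr : `|c| <= r by rewrite -sqrtr_sqr ler_wsqrtr// lerDl sqr_ge0.
have er : `|e| <= r by rewrite -sqrtr_sqr ler_wsqrtr// lerDr sqr_ge0.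
have p0 : 0 <= r + (`|a - c| + `|b - e|) by rewrite !addr_ge0.
rewrite -[leRHS]ger0_norm// -sqrtr_sqr ler_wsqrtr//.
have h1 : a ^+ 2 - c ^+ 2 <= 2 * (r * `|a - c|) + `|a - c| ^+ 2.
  rewrite [X in _ <= _ + X]real_normK ?num_real//.
  have : c * (a - c) <= r * `|a - c|.
    by rewrite (le_trans (ler_norm _))// normrM ler_wpM2r.
  by move: (r * _) => y; nra.
have h2 : b ^+ 2 - e ^+ 2 <= 2 * (r * `|b - e|) + `|b - e| ^+ 2.
  rewrite [X in _ <= _ + X]real_normK ?num_real//.
  have : e * (b - e) <= r * `|b - e|.
    by rewrite (le_trans (ler_norm _))// normrM ler_wpM2r.
  by move: (r * _) => y; nra.
have h3 : 0 <= `|a - c| * `|b - e| by rewrite mulr_ge0.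
by move: `|a - c| `|b - e| h1 h2 h3 => x y h1 h2 h3; nra.
Qed.

Lemma sqrt_sub_le (a b c e : R) :
  `|Num.sqrt (a ^+ 2 + b ^+ 2) - Num.sqrt (c ^+ 2 + e ^+ 2)| <= `|a - c| + `|b - e|.
Proof.
have h1 := sqrt_triangle a b c e; have h2 := sqrt_triangle c e a b.
rewrite (distrC c) (distrC e) in h2.
by rewrite ler_norml; apply/andP; split; lra.
Qed.

(** The error 1 / n is that of 1 + 1 / n against 1. In the other one, |D (t + alpha) D (t - alpha)|
    <= qform / 2 makes the bound independent of n alpha. *)
Lemma nspeed_gsqrt t (m : R) : 0 < m -> m <= `|sp t| -> m <= `|sm t| ->
  `|nspeed t - gsqrt alpha (n%:R * alpha) t (n%:R * t)| <= (1 + m^-1) / n%:R.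
Proof.
move=> m0 hp hm; have p0 : sp t != 0 by rewrite -normr_gt0 (lt_le_trans m0).
have q0 : sm t != 0 by rewrite -normr_gt0 (lt_le_trans m0).
have e x u : gsqrt alpha x t u = Num.sqrt (1 ^+ 2 + g alpha x t u ^+ 2).
  by rewrite /gsqrt expr1n real_normK ?num_real.
rewrite nspeedE e (le_trans (sqrt_sub_le _ _ _ _))// addrAC subrr add0r.
rewrite [leRHS]mulrDl mul1r [`|n%:R^-1|]gtr0_norm ?invr_gt0// lerD2l wronskian_g//.
rewrite addrAC subrr add0r normrN !normrM !normfV !normrM (gtr0_norm nR).
have -> : `|qform n alpha t| = qform n alpha t by rewrite gtr0_norm// qform_gt0.
have h1 : `|dker n (t + alpha)| * `|dker n (t - alpha)| / qform n alpha t <= 2^-1.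
  rewrite ler_pdivrMr ?qform_gt0// /qform.
  rewrite -[X in _ <= _ * (X + _)]real_normK ?num_real// -[X in _ <= _ * (_ + X)]real_normK ?num_real//.
  by have := sqr_ge0 (`|dker n (t + alpha)| - `|dker n (t - alpha)|); nra.
have h2 : `|sin alpha| / (n%:R * (`|sp t| * `|sm t|)) <= 2 / m / n%:R.
  have a0 : 0 < `|sp t| := lt_le_trans m0 hp; have b0 : 0 < `|sm t| := lt_le_trans m0 hm.
  apply: (@le_trans _ _ ((`|sp t| + `|sm t|) / (n%:R * (`|sp t| * `|sm t|)))).
    by rewrite ler_wpM2r ?norm_sin_alpha_le// invr_ge0 ?mulr_ge0// ltW.
  rewrite (_ : _ / _ = (`|sp t|^-1 + `|sm t|^-1) / n%:R); last first.
    by move: `|sp t| `|sm t| a0 b0 => a b a0 b0; field; rewrite !gt_eqF.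
  rewrite ler_pM2r ?invr_gt0//.
  have : `|sp t|^-1 <= m^-1 by rewrite lef_pV2.
  have : `|sm t|^-1 <= m^-1 by rewrite lef_pV2.
  lra.
apply: (le_trans (ler_pM _ _ h1 h2)); rewrite ?divr_ge0 ?mulr_ge0 ?(ltW (qform_gt0 _ _))//.
by rewrite le_eqVlt; apply/orP; left; apply/eqP; field; rewrite !gt_eqF.
Qed.

(** Near a zero of one of the sines, qform >= n^2 / 4 by [dker_large], while Cauchy-Schwarz gives
    W^2 <= 2 n^4 qform; hence (W / qform)^2 <= 8 n^2, and the squared normalized speed is at most 4
    + 32 <= 8^2. *)
Lemma nspeed_bad t : (`|sp t| <= (2 * n%:R)^-1) || (`|sm t| <= (2 * n%:R)^-1) -> nspeed t <= 8.
Proof.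
move=> bad; have Q0 := qform_gt0 hna t.
have Qge : (n%:R / 2) ^+ 2 <= qform n alpha t.
  have sq y : n%:R / 2 <= `|dker n y| -> (n%:R / 2) ^+ 2 <= dker n y ^+ 2 :> R.
    by move=> h; rewrite -[leRHS]real_normK ?num_real// lerXn2r ?nnegrE// divr_ge0.
  rewrite /qform; case/orP: bad => /(dker_large n0)/sq h.
    by rewrite (le_trans h)// lerDl sqr_ge0.
  by rewrite (le_trans h)// lerDr sqr_ge0.
have W2 : wronskian n alpha t ^+ 2 <= qform n alpha t * (2 * n%:R ^+ 4).
  have h y : ddker n y ^+ 2 <= n%:R ^+ 4 :> R.
    rewrite -real_normK ?num_real// (_ : n%:R ^+ 4 = (n%:R ^+ 2) ^+ 2); last by rewrite -exprM.
    by rewrite lerXn2r ?nnegrE ?exprn_ge0// ddker_le.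
  apply: (@le_trans _ _ (qform n alpha t * (ddker n (t + alpha) ^+ 2 + ddker n (t - alpha) ^+ 2))).
    rewrite /wronskian /qform.
    move: (dker _ _) (dker _ _) (ddker _ _) (ddker _ _) => a b c e.
    have := sqr_ge0 (b * c + a * e); nra.
  by rewrite ler_wpM2l ?(ltW Q0)//; have := h (t + alpha); have := h (t - alpha); lra.
have r2 : (wronskian n alpha t / qform n alpha t) ^+ 2 <= 8 * n%:R ^+ 2.
  rewrite exprMn exprVn ler_pdivrMr ?exprn_gt0//.
  apply: (le_trans W2); have := ler_wpM2l (sqr_ge0 (n%:R : R)) Qge.
  move: (qform _ _ _) Q0 => q q0 h.
  rewrite (_ : 8 * n%:R ^+ 2 * q ^+ 2 = q * (8 * (n%:R ^+ 2 * q))); last by ring.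
  by rewrite ler_wpM2l ?(ltW q0)//; move: (n%:R ^+ 2 * q) h => y; lra.
have n1 : n%:R^-1 <= 1 :> R by rewrite invf_le1// ler1n.
rewrite nspeedE -[leRHS](ger0_norm)// -sqrtr_sqr ler_wsqrtr//.
have -> : (2 / n%:R * (wronskian n alpha t / qform n alpha t)) ^+ 2 =
    4 / n%:R ^+ 2 * (wronskian n alpha t / qform n alpha t) ^+ 2.
  by move: (_ / qform _ _ _) => y; field; rewrite gt_eqF.
have : 4 / n%:R ^+ 2 * (wronskian n alpha t / qform n alpha t) ^+ 2 <= 32.
  rewrite mulrAC ler_pdivrMr ?exprn_gt0//; lra.
have ni0 : 0 <= n%:R^-1 :> R by rewrite invr_ge0 ltW.
have : (1 + n%:R^-1) ^+ 2 <= 4 :> R by move: (n%:R^-1) n1 ni0 => y y1 y0; nra.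
lra.
Qed.

End normalized_speed.

(** * Moving averages *)

Section moving_average.
Context {R : realType}.
Local Notation mu := (@lebesgue_measure R).
Variable alpha : R.
Implicit Types (s t x u v m : R).

Local Notation sp t := (sin ((t + alpha) / 2)).
Local Notation sm t := (sin ((t - alpha) / 2)).

Lemma norm_sin_half_le s t c : `|sin ((t + c) / 2)| <= `|sin ((s + c) / 2)| + `|s - t| / 2.
Proof.
have := lipschitz_sin ((t + c) / 2) ((s + c) / 2).
rewrite (_ : _ / 2 - _ / 2 = (t - s) / 2); last by lra.
rewrite normrM (@gtr0_norm _ 2^-1) ?invr_gt0// distrC (distrC t) => h.
have := lerB_dist (sin ((t + c) / 2)) (sin ((s + c) / 2)); rewrite distrC; lra.
Qed.

(** Because of the half angles, a move of 2 delta changes each sine by at most delta, that is by a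
    factor 1 + delta / m; each hypothesis of [g_compare] involves two sines, hence the square. *)
Lemma g_compare_near x s s' u m (delta : R) : 0 < m -> `|s - s'| <= 2 * delta ->
  m <= `|sp s| -> m <= `|sm s| -> m <= `|sp s'| -> m <= `|sm s'| ->
  `|g alpha x s' u| <= (1 + delta / m) ^+ 2 * `|g alpha x s u|.
Proof.
move=> m0 ss' h1 h2 h3 h4.
have d0 : 0 <= delta by have := normr_ge0 (s - s'); lra.
have y0 : 0 <= delta / m by rewrite divr_ge0// ltW.
have key a a' : m <= a -> a' <= a + delta -> a' <= (1 + delta / m) * a.
  move=> ma /le_trans; apply; rewrite mulrDl mul1r lerD2l.
  by rewrite mulrAC ler_pdivlMr// ler_wpM2l.
have ss2 : `|s - s'| / 2 <= delta by lra.
have ss2' : `|s' - s| / 2 <= delta by rewrite distrC.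
have k1 : `|sp s'| <= (1 + delta / m) * `|sp s|.
  by apply: key => //; apply: (le_trans (norm_sin_half_le s s' alpha)); rewrite lerD2l.
have k2 : `|sp s| <= (1 + delta / m) * `|sp s'|.
  by apply: key => //; apply: (le_trans (norm_sin_half_le s' s alpha)); rewrite lerD2l.
have k3 : `|sm s'| <= (1 + delta / m) * `|sm s|.
  by apply: key => //; apply: (le_trans (norm_sin_half_le s s' (- alpha))); rewrite lerD2l.
have k4 : `|sm s| <= (1 + delta / m) * `|sm s'|.
  by apply: key => //; apply: (le_trans (norm_sin_half_le s' s (- alpha))); rewrite lerD2l.
apply: g_compare; rewrite ?sqr_ge0 -?normr_gt0 ?(lt_le_trans m0)//.
- by rewrite expr2 mulrACA; apply: ler_pM.
- by rewrite expr2 mulrACA; apply: ler_pM.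
Qed.

Lemma gsqrt_sub_le x s s' u :
  `|gsqrt alpha x s' u - gsqrt alpha x s u| <= `| `|g alpha x s' u| - `|g alpha x s u| |.
Proof.
rewrite /gsqrt -(expr1n R 2); apply: (le_trans (sqrt_sub_le _ _ _ _)).
by rewrite subrr normr0 add0r.
Qed.

Lemma integral_norm_g_shift_le x s c :
  (\int[mu]_(v in `[0%R, (2 * pi)%R]) `|g alpha x s (c + v)|%:E <= (2 * pi)%:E)%E.
Proof.
under eq_integral do rewrite addrC.
rewrite (@ge0_integral_periodic _ (2 * pi) (fun u => `|g alpha x s u|%:E)).
- exact: integral_norm_g_le.
- by rewrite mulr_gt0 ?pi_gt0.
- by apply/measurable_EFinP; rewrite /g; meas.
- by move=> u; rewrite lee_fin.
- by move=> u; rewrite g_periodic.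
Qed.

Variable n : nat.
Hypothesis n0 : (0 < n)%N.
Hypothesis hna : 0 < 1 - `|cos (n%:R * alpha)|.

Let nR : 0 < n%:R :> R. Proof. by rewrite ltr0n. Qed.

(** The speed at the point s + v / n against the limit density whose slow argument is frozen at [s];
    the fast one is n (s + v / n) = n s + v. *)
Definition dist s v : R :=
  `|nspeed n alpha (s + v / n%:R) - gsqrt alpha (n%:R * alpha) s (n%:R * s + v)|.

Lemma measurable_dist : measurable_fun setT (fun p : R * R => dist p.1 p.2).
Proof.
rewrite /dist /nspeed; meas.
  apply: (measurableT_comp (@measurable_speed R n alpha)); meas.
by apply: measurable_gsqrt; meas.
Qed.

Let shift_freq s v : n%:R * (s + v / n%:R) = n%:R * s + v.
Proof. by rewrite mulrDr mulrC [n%:R * _]mulrC divfK ?gt_eqF// mulrC. Qed.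

Lemma dist_near s v m : 0 < m -> pi / n%:R <= m -> 0 <= v <= 2 * pi ->
  2 * m <= `|sp s| -> 2 * m <= `|sm s| ->
  dist s v <= (1 + m^-1) / n%:R +
    12 * pi / (n%:R * m) * `|g alpha (n%:R * alpha) s (n%:R * s + v)|.
Proof.
move=> m0 nm /andP[v0 v2] h1 h2; set s' := s + v / n%:R.
have p0 := @pi_gt0 R.
have ss' : `|s - s'| <= 2 * (pi / n%:R).
  rewrite /s' opprD addrA subrr add0r normrN ger0_norm ?divr_ge0// mulrA.
  by rewrite ler_pM2r ?invr_gt0.
have h1' : m <= `|sp s'| by have := norm_sin_half_le s' s alpha; rewrite distrC; lra.
have h2' : m <= `|sm s'| by have := norm_sin_half_le s' s (- alpha); rewrite distrC; lra.
have h1w : m <= `|sp s| by lra.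
have h2w : m <= `|sm s| by lra.
have := nspeed_gsqrt n0 hna m0 h1' h2'; rewrite /s' shift_freq -/s' => hN.
set x := n%:R * alpha in hN *; set u := n%:R * s + v in hN *.
have c1 := g_compare_near x u m0 ss' h1w h2w h1' h2'.
rewrite distrC in ss'.
have c2 := g_compare_near x u m0 ss' h1' h2' h1w h2w.
have gs := gsqrt_sub_le x s s' u.
rewrite /dist -/s' -/x -/u.
apply: (le_trans (ler_distD (gsqrt alpha x s' u) _ _)); apply: lerD => //.
apply: (le_trans gs).
(* As y <= 1, (1 + y)^2 <= 1 + 3 y, so b - a <= 3 y a and a - b <= 3 y b; then b <= 4 a turns the
   latter into 12 y a. *)
set y := pi / n%:R / m in c1 c2.
have y0 : 0 <= y by rewrite !divr_ge0// ltW.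
have y1 : y <= 1 by rewrite ler_pdivrMr// mul1r.
have -> : 12 * pi / (n%:R * m) = 12 * y.
  by rewrite /y; move: (pi : R) => q; field; rewrite !gt_eqF.
have := normr_ge0 (g alpha x s u); have := normr_ge0 (g alpha x s' u).
move: `|g _ _ s _| `|g _ _ s' _| c1 c2 => a b c1 c2 b0 a0.
have ya : 0 <= y * a by rewrite mulr_ge0.
have yb : 0 <= y * b by rewrite mulr_ge0.
have b1 : b - a <= 3 * (y * a).
  have : y * (y * a) <= y * a by rewrite ler_piMl.
  by move: c1; rewrite sqrrD expr1n !mulrDl mul1r expr2; lra.
have a1 : a - b <= 3 * (y * b).
  have : y * (y * b) <= y * b by rewrite ler_piMl.
  by move: c2; rewrite sqrrD expr1n !mulrDl mul1r expr2; lra.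
have b4 : b <= 4 * a.
  have : y * a <= a by rewrite ler_piMl.
  lra.
have : y * b <= y * (4 * a) by rewrite ler_wpM2l.
by rewrite ler_norml => h; apply/andP; split; lra.
Qed.

Lemma integral_dist_near s m : 0 < m -> pi / n%:R <= m ->
  2 * m <= `|sp s| -> 2 * m <= `|sm s| ->
  (\int[mu]_(v in `[0%R, (2 * pi)%R]) (dist s v)%:E <=
   (((1 + m^-1) * (2 * pi) + 12 * pi / m * (2 * pi)) / n%:R)%:E)%E.
Proof.
move=> m0 nm h1 h2; have p0 := @pi_gt0 R.
have C0 : 0 <= 12 * pi / (n%:R * m) by rewrite divr_ge0 ?mulr_ge0// ltW.
have m1 : 0 <= (1 + m^-1) / n%:R by rewrite divr_ge0// ?addr_ge0 ?invr_ge0 ?(ltW m0).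
have mg : measurable_fun (`[0, 2 * pi]%classic : set R)
    (fun v => `|g alpha (n%:R * alpha) s (n%:R * s + v)|%:E).
  by apply/measurable_EFinP; apply: measurable_funTS; rewrite /g; meas.
apply: (@le_trans _ _ (\int[mu]_(v in `[0%R, (2 * pi)%R]) (((1 + m^-1) / n%:R)%:E +
    (12 * pi / (n%:R * m))%:E * `|g alpha (n%:R * alpha) s (n%:R * s + v)|%:E))%E).
  apply: ge0_le_integral_nomeas => v; first by rewrite lee_fin normr_ge0.
  by rewrite /= in_itv/= => v2; rewrite -EFinM -EFinD lee_fin dist_near.
rewrite ge0_integralD//; last 2 first.
- by move=> v _; rewrite mule_ge0.
- exact: measurable_funeM.
rewrite integral_cst// ge0_integralZl//.
apply: (@le_trans _ _ (((1 + m^-1) / n%:R)%:E * (2 * pi)%:E +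
    (12 * pi / (n%:R * m))%:E * (2 * pi)%:E)%E).
  apply: leeD; apply: lee_wpmul2l => //; first by rewrite -lebesgue_measure_itv_2pi.
  exact: integral_norm_g_shift_le.
rewrite -!EFinM -EFinD lee_fin le_eqVlt; apply/orP; left; apply/eqP.
by move: (pi : R) => q; field; rewrite !gt_eqF.
Qed.

(* Within the window the [g]-values at points where both sines are at least
   [1 / (2 n)] are all comparable to the one at a single such point, and
   [nspeed] is at most 8 elsewhere. *)
Lemma nspeed_window s t0 v : 0 <= v <= 2 * pi -> 0 <= t0 <= 2 * pi ->
  (2 * n%:R)^-1 <= `|sp (s + t0 / n%:R)| -> (2 * n%:R)^-1 <= `|sm (s + t0 / n%:R)| ->
  nspeed n alpha (s + v / n%:R) <= 8 + (1 + 2 * pi) ^+ 2 *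
    `|g alpha (n%:R * alpha) (s + t0 / n%:R) (n%:R * s + v)|.
Proof.
move=> /andP[v0 v2] /andP[t00 t02] g1 g2; have p0 := @pi_gt0 R.
have nn0 : 0 < (2 * n%:R)^-1 :> R by rewrite invr_gt0 mulr_gt0.
have [bad|] := boolP ((`|sp (s + v / n%:R)| <= (2 * n%:R)^-1) || (`|sm (s + v / n%:R)| <= (2 * n%:R)^-1)).
  by rewrite (le_trans (nspeed_bad n0 hna bad))// lerDl mulr_ge0 ?sqr_ge0.
rewrite negb_or -!ltNge => /andP[/ltW b1 /ltW b2].
have := nspeed_gsqrt n0 hna nn0 b1 b2; rewrite shift_freq invrK ler_norml => /andP[_ h].
have d1 : `|s + t0 / n%:R - (s + v / n%:R)| <= 2 * (pi / n%:R).
  rewrite opprD addrACA subrr add0r -mulrBl normrM (@gtr0_norm _ n%:R^-1) ?invr_gt0// mulrA.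
  by rewrite ler_pM2r ?invr_gt0// ler_norml; apply/andP; split; lra.
have := g_compare_near (n%:R * alpha) (n%:R * s + v) nn0 d1 g1 g2 b1 b2.
rewrite invrK (_ : pi / n%:R * (2 * n%:R) = 2 * pi); last first.
  by rewrite mulrCA divfK ?gt_eqF.
have := gsqrt_le alpha (n%:R * alpha) (s + v / n%:R) (n%:R * s + v).
have : (1 + 2 * n%:R) / n%:R <= 3 :> R.
  rewrite ler_pdivrMr//; have : 1 <= n%:R :> R by rewrite ler1n.
  by lra.
lra.
Qed.

(** The three terms integrate over one period, in this order, the constant 8 and the multiple of |g|
    of [nspeed_window], and the bound on the integral of [gsqrt]. *)
Definition dist_bound : R := 8 * (2 * pi) + (1 + 2 * pi) ^+ 2 * (2 * pi) + 4 * pi.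

(** If both sines reach 1 / (2 n) at some point of the window, the slow argument is frozen there; as
    this point does not depend on [v], the Poisson integral in [v] applies. Otherwise the normalized
    speed is at most 8 throughout. *)
Lemma integral_dist_le s :
  (\int[mu]_(v in `[0%R, (2 * pi)%R]) (dist s v)%:E <= dist_bound%:E)%E.
Proof.
have p0 := @pi_gt0 R; have p2 : 0 <= 2 * pi :> R by lra.
have [s0 hs0] : exists s0, forall v, 0 <= v <= 2 * pi ->
    nspeed n alpha (s + v / n%:R) <= 8 + (1 + 2 * pi) ^+ 2 *
      `|g alpha (n%:R * alpha) s0 (n%:R * s + v)|.
  have [[t0 [t02 g1 g2]]|nogood] := pselect (exists t0, [/\ 0 <= t0 <= 2 * pi,
      (2 * n%:R)^-1 <= `|sp (s + t0 / n%:R)| & (2 * n%:R)^-1 <= `|sm (s + t0 / n%:R)|]).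
    by exists (s + t0 / n%:R) => v v2; exact: nspeed_window.
  exists s => v v2; rewrite (le_trans (nspeed_bad n0 hna _))//; last first.
    by rewrite lerDl mulr_ge0 ?sqr_ge0.
  rewrite -[_ || _]negbK negb_or -!ltNge; apply/negP => /andP[/ltW b1 /ltW b2].
  by apply: nogood; exists v.
have mg : measurable_fun (`[0, 2 * pi]%classic : set R)
    (fun v => `|g alpha (n%:R * alpha) s0 (n%:R * s + v)|%:E).
  by apply/measurable_EFinP; apply: measurable_funTS; rewrite /g; meas.
have mgs : measurable_fun (`[0, 2 * pi]%classic : set R)
    (fun v => (gsqrt alpha (n%:R * alpha) s (n%:R * s + v))%:E).
  by apply/measurable_EFinP; apply: measurable_funTS; rewrite /gsqrt /g; meas.
apply: (@le_trans _ _ (\int[mu]_(v in `[0%R, (2 * pi)%R]) ((8%:E +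
    ((1 + 2 * pi) ^+ 2)%:E * `|g alpha (n%:R * alpha) s0 (n%:R * s + v)|%:E) +
    (gsqrt alpha (n%:R * alpha) s (n%:R * s + v))%:E))%E).
  apply: ge0_le_integral_nomeas => v; first by rewrite lee_fin normr_ge0.
  rewrite /= in_itv/= => v2; rewrite -EFinM -!EFinD lee_fin /dist.
  rewrite (le_trans (ler_normB _ _))// [`|gsqrt _ _ _ _|]ger0_norm ?gsqrt_ge0// lerD2r.
  by rewrite ger0_norm ?hs0// /nspeed mulr_ge0 ?divr_ge0 ?sqrtr_ge0.
have q0 : 0 <= (1 + 2 * pi) ^+ 2 :> R := sqr_ge0 _.
rewrite ge0_integralD//; last 3 first.
- by move=> v _; rewrite adde_ge0// mule_ge0.
- by apply: emeasurable_funD; [exact: measurable_cst|exact: measurable_funeM].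
- by move=> v _; rewrite lee_fin gsqrt_ge0.
rewrite ge0_integralD//; last 2 first.
- by move=> v _; rewrite mule_ge0.
- exact: measurable_funeM.
rewrite integral_cst// ge0_integralZl//.
apply: (@le_trans _ _ (8%:E * (2 * pi)%:E + ((1 + 2 * pi) ^+ 2)%:E * (2 * pi)%:E + (4 * pi)%:E)%E).
  apply: leeD; last first.
    under eq_integral do rewrite addrC.
    rewrite integral_gsqrt_shift; exact: integral_gsqrt_le.
  apply: leeD; apply: lee_wpmul2l => //; first by rewrite -lebesgue_measure_itv_2pi.
  exact: integral_norm_g_shift_le.
by rewrite -!EFinM -!EFinD.
Qed.

End moving_average.

(** * Mean distance to the limit density *)

Section average_distance.
Context {R : realType}.
Local Notation mu := (@lebesgue_measure R).
Variable alpha : R.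
Implicit Types (s t x u v m : R) (n : nat).

Local Notation I := (`[0%R, (2 * pi)%R]%classic : set R).
Local Notation sp t := (sin ((t + alpha) / 2)).
Local Notation sm t := (sin ((t - alpha) / 2)).

Lemma admissible_gt0 n : admissible alpha n -> (0 < n)%N.
Proof. by case: n => // adm; exfalso; apply: adm; exists 0; rewrite !mul0r. Qed.

Lemma admissible_cos n : admissible alpha n -> 0 < 1 - `|cos (n%:R * alpha)|.
Proof.
move=> adm; have := cos2Dsin2 (n%:R * alpha).
have : sin (n%:R * alpha) != 0 by apply/eqP => /sin_eq0.
move=> sn0 e; have s0 : 0 < sin (n%:R * alpha) ^+ 2 by rewrite exprn_even_gt0.
rewrite subr_gt0 -(@expr_lt1 _ 2)// real_normK ?num_real//; lra.
Qed.

Lemma integral_dist_fin n s : admissible alpha n ->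
  (\int[mu]_(v in I) (dist alpha n s v)%:E)%E \is a fin_num.
Proof.
move=> adm; rewrite ge0_fin_numE; last by apply: integral_ge0 => v _; rewrite lee_fin normr_ge0.
apply: le_lt_trans (integral_dist_le (admissible_gt0 adm) (admissible_cos adm) s) _.
exact: ltry.
Qed.

(* Set to 0 at non-admissible [n], so that limits can be taken along all [n]. *)
Definition mean_dist n s : R :=
  `[< admissible alpha n >]%:R * fine (\int[mu]_(v in I) (dist alpha n s v)%:E)%E.

Lemma mean_dist_ge0 n s : 0 <= mean_dist n s.
Proof.
rewrite mulr_ge0// fine_ge0// integral_ge0// => v _.
by rewrite lee_fin normr_ge0.
Qed.

Lemma mean_distE n s : admissible alpha n ->
  (mean_dist n s)%:E = (\int[mu]_(v in I) (dist alpha n s v)%:E)%E.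
Proof. by move=> adm; rewrite /mean_dist asboolT// mul1r fineK// integral_dist_fin. Qed.

Lemma measurable_mean_dist n : measurable_fun setT (mean_dist n).
Proof.
apply: measurable_funM; first exact: measurable_cst.
apply: measurableT_comp; first exact: fine_measurable.
apply: (@measurable_integral_section _ _ _ _ _ mu I (fun p => (dist alpha n p.1 p.2)%:E)) => //.
- by apply/measurable_EFinP; exact: measurable_dist.
- by move=> p; rewrite lee_fin normr_ge0.
Qed.

Lemma mean_dist_le n s : `|mean_dist n s| <= @dist_bound R.
Proof.
rewrite ger0_norm ?mean_dist_ge0//.
have [adm|nadm] := pselect (admissible alpha n).
  rewrite -lee_fin mean_distE//.
  exact: integral_dist_le (admissible_gt0 adm) (admissible_cos adm) s.
rewrite /mean_dist asboolF// mul0r /dist_bound.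
have p0 : 0 <= 2 * pi :> R by rewrite mulr_ge0 ?pi_ge0.
by have := mulr_ge0 (sqr_ge0 (1 + 2 * pi)) p0; lra.
Qed.

(** For fixed [s] both sines are bounded away from 0, and [integral_dist_near] gives O (1 / n) with
    a constant depending on [s]. *)
Lemma cvg_mean_dist s : sp s != 0 -> sm s != 0 -> mean_dist n s @[n --> \oo] --> (0 : R).
Proof.
move=> s1 s2; have p0 := @pi_gt0 R.
pose m := Num.min `|sp s| `|sm s| / 2.
have m0 : 0 < m by rewrite divr_gt0// lt_min !normr_gt0 s1.
have h1 : 2 * m <= `|sp s| by rewrite mulrC divfK// ge_min lexx.
have h2 : 2 * m <= `|sm s| by rewrite mulrC divfK// ge_min lexx orbT.
pose K := (1 + m^-1) * (2 * pi) + 12 * pi / m * (2 * pi).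
have K0 : 0 <= K.
  have mi0 : 0 < m^-1 by rewrite invr_gt0.
  by rewrite addr_ge0// mulr_ge0// ?(ltW mi0) ?addr_ge0 ?mulr_ge0// ltW.
apply: (@squeeze_cvgr _ _ _ _ (fun=> 0) (fun n => 2 * K * harmonic n)); last 2 first.
- exact: cvg_cst.
- rewrite -[X in _ --> X](mulr0 (2 * K)); apply: cvgM; first exact: cvg_cst.
  exact: cvg_harmonic.
have [N _ HN] : \forall n \near \oo, harmonic n < m / (2 * pi).
  by apply: (@cvgr_lt R _ _ _ _ _ cvg_harmonic); rewrite divr_gt0// mulr_gt0.
exists N => // n /= Nn; rewrite mean_dist_ge0/=.
have h0 : 0 < harmonic n :> R by rewrite /= invr_gt0 ltr0n.
have [adm|nadm] := pselect (admissible alpha n); last first.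
  by rewrite /mean_dist asboolF// mul0r mulr_ge0 ?mulr_ge0// ltW.
have n0 := admissible_gt0 adm.
(* [harmonic n] is 1 / (n + 1), hence the factor 2. *)
have ninv : n%:R^-1 <= 2 * harmonic n :> R.
  rewrite /= -div1r ler_pdivrMr ?ltr0n// mulrAC ler_pdivlMr ?ltr0n// mul1r.
  by rewrite -natrM ler_nat mul2n -addnn -addn1 leq_add2l.
have nm : pi / n%:R <= m.
  apply: (@le_trans _ _ (pi * (2 * harmonic n))); first by rewrite ler_wpM2l// ltW.
  have := HN n Nn; rewrite /= ltr_pdivlMr ?mulr_gt0// => /ltW.
  by rewrite mulrC -mulrA mulrCA.
have := integral_dist_near n0 (admissible_cos adm) m0 nm h1 h2.
rewrite -mean_distE// lee_fin => /le_trans; apply.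
by have := ler_wpM2l K0 ninv; rewrite [K * (2 * _)]mulrA (mulrC K 2).
Qed.

(** The points where one of the two sines vanishes; the boolean selects which one. *)
Let zeros : set R :=
  range (fun p : bool * int => 2 * (p.2%:~R * pi) + (if p.1 then alpha else - alpha)).

Let countable_zeros : countable zeros.
Proof. exact: sub_countable (card_image_le _ _) (countableP _). Qed.

Lemma cvg_integral_mean_dist :
  (\int[mu]_(s in I) (mean_dist n s)%:E)%E @[n --> \oo] --> (0 : \bar R)%E.
Proof.
rewrite -[X in _ --> X](_ : (\int[mu]_(s in I) (0 : R)%:E = 0)%E); last first.
  by rewrite integral0.
apply: (@bounded_cvg_integral _ _ _ (@dist_bound R) _ (fun=> 0) zeros).
- exact: measurable_mean_dist.
- exact: measurable_cst.
- exact: countable_measurable.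
- exact: countable_lebesgue_measure0.
- move=> s _ Z; apply: cvg_mean_dist; apply/eqP => /sin_eq0[j e]; apply: Z.
    by exists (false, j) => //=; rewrite -e; lra.
  by exists (true, j) => //=; rewrite -e; lra.
- by move=> n s _; exact: mean_dist_le.
Qed.

End average_distance.

(** * Comparison with the limit functional *)

Section comparison.
Context {R : realType}.
Local Notation mu := (@lebesgue_measure R).
Local Notation I := (`[0%R, (2 * pi)%R]%classic : set R).
Local Open Scope ereal_scope.

Lemma double_integral_le (A B : set R) (f g h : R * R -> R) :
  measurable A -> measurable B ->
  measurable_fun setT g -> measurable_fun setT h ->
  (forall p, (0 <= f p)%R) -> (forall p, (0 <= g p)%R) -> (forall p, (0 <= h p)%R) ->
  (forall p, (f p <= g p + h p)%R) ->
  \int[mu]_(x in A) \int[mu]_(y in B) (f (x, y))%:E <=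
  \int[mu]_(x in A) \int[mu]_(y in B) (g (x, y))%:E +
  \int[mu]_(x in A) \int[mu]_(y in B) (h (x, y))%:E.
Proof.
move=> mA mB mg mh f0 g0 h0 fgh.
have msec (k : R * R -> R) : measurable_fun setT k -> (forall p, (0 <= k p)%R) ->
    measurable_fun setT (fun x => \int[mu]_(y in B) (k (x, y))%:E).
  move=> mk k0; apply: (@measurable_integral_section _ _ _ _ _ mu B (fun p => (k p)%:E)) => //.
  exact/measurable_EFinP.
have m1 (k : R * R -> R) x : measurable_fun setT k -> measurable_fun setT (fun y => (k (x, y))%:E).
  by move=> mk; apply/measurable_EFinP; exact: (measurableT_comp mk (pair1_measurable x)).
have I0 (k : R * R -> R) x : (forall p, (0 <= k p)%R) -> 0 <= \int[mu]_(y in B) (k (x, y))%:E.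
  by move=> k0; apply: integral_ge0 => y _; rewrite lee_fin.
rewrite -ge0_integralD//; last 4 first.
- by move=> x _; exact: I0.
- by apply: measurable_funTS; exact: msec.
- by move=> x _; exact: I0.
- by apply: measurable_funTS; exact: msec.
apply: ge0_le_integral_nomeas => x _; first exact: I0.
rewrite -ge0_integralD//; last 4 first.
- by move=> y _; rewrite lee_fin.
- by apply: measurable_funTS; exact: m1.
- by move=> y _; rewrite lee_fin.
- by apply: measurable_funTS; exact: m1.
apply: ge0_le_integral_nomeas => y _; first by rewrite lee_fin.
by rewrite -EFinD lee_fin.
Qed.

Lemma abse_scale_sub_le (c : R) (x y e : \bar R) : (0 <= c)%R ->
  0 <= x -> 0 <= y -> y < +oo -> 0 <= e -> e < +oo ->
  x <= y + e -> y <= x + e -> `|c%:E * x - c%:E * y| <= c%:E * e.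
Proof.
move=> c0 x0 y0 yoo e0 eoo xy yx.
have xoo : x < +oo by apply: (le_lt_trans xy); exact: lte_add_pinfty.
move: x0 y0 e0 xoo yoo eoo xy yx.
case: x => [x| |] //; case: y => [y| |] //; case: e => [e| |] //.
move=> _ _ _ _ _ _; rewrite -!EFinD !lee_fin => h1 h2.
rewrite -mulrBr normrM ger0_norm// ler_wpM2l//.
by rewrite ler_norml; apply/andP; split; lra.
Qed.

Lemma integral_cst_2pi (c : R) : \int[mu]_(s in I) c%:E = (c * (2 * pi))%:E.
Proof. by rewrite integral_cst// EFinM; apply: congr1; exact: lebesgue_measure_itv_2pi. Qed.

Lemma integral_scale (f : R -> R) (c : R) : measurable_fun setT f ->
  (forall s, (0 <= f s)%R) -> (0 <= c)%R ->
  \int[mu]_(s in I) (c * f s)%:E = c%:E * \int[mu]_(s in I) (f s)%:E.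
Proof.
move=> mf f0 c0; under eq_integral do rewrite EFinM.
rewrite ge0_integralZl//.
  by apply/measurable_EFinP; exact: measurable_funTS.
by move=> s _; rewrite lee_fin.
Qed.

(** Averaging a periodic function over translated windows does not change its mean. *)
Lemma double_integral_shift (f : R -> R) (c : R) : measurable_fun setT f ->
  (forall s, (0 <= f s)%R) -> (forall s, f (s + 2 * pi)%R = f s) ->
  \int[mu]_(s in I) \int[mu]_(v in I) (f (s + v * c)%R)%:E =
  (2 * pi)%:E * \int[mu]_(s in I) (f s)%:E.
Proof.
move=> mf f0 fT; have mI : measurable I by [].
have mF : measurable_fun setT (fun p : R * R => (f (p.1 + p.2 * c)%R)%:E).
  by apply/measurable_EFinP; apply: (measurableT_comp mf); meas.
have F0 (p : R * R) : 0 <= (f (p.1 + p.2 * c)%R)%:E by rewrite lee_fin.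
rewrite (@ge0_fubini_setX _ _ _ _ _ mu mu I I _ mI mI mF F0); cbn [fst snd].
transitivity (\int[mu]_(v in I) (\int[mu]_(s in I) (f s)%:E)).
  apply: eq_integral => v _.
  apply: (@ge0_integral_periodic _ (2 * pi)%R (fun s => (f s)%:E)).
  - by rewrite mulr_gt0 ?pi_gt0.
  - exact/measurable_EFinP.
  - by move=> s; rewrite lee_fin.
  - by move=> s; rewrite fT.
rewrite integral_cst// muleC; apply: (congr1 (fun x => x * _)); exact: lebesgue_measure_itv_2pi.
Qed.

Variables (alpha : R) (n : nat).
Hypothesis adm : admissible alpha n.

Let n0 : (0 < n)%N := admissible_gt0 adm.
Let hna := admissible_cos adm.
Let nR : (0 < n%:R :> R)%R. Proof. by rewrite ltr0n. Qed.

Let S (p : R * R) : R := nspeed n alpha (p.1 + p.2 / n%:R)%R.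
Let G (p : R * R) : R := gsqrt alpha (n%:R * alpha)%R p.1 (n%:R * p.1 + p.2)%R.
Let D (p : R * R) : R := dist alpha n p.1 p.2.

Let nspeed_ge0 s : (0 <= nspeed n alpha s)%R.
Proof. by rewrite /nspeed mulr_ge0 ?divr_ge0 ?sqrtr_ge0. Qed.

Let nspeed_2pi s : nspeed n alpha (s + 2 * pi)%R = nspeed n alpha s.
Proof. by rewrite /nspeed speed_2pi. Qed.

Let S0 p : (0 <= S p)%R. Proof. exact: nspeed_ge0. Qed.

Let G0 p : (0 <= G p)%R. Proof. exact: gsqrt_ge0. Qed.

Let D0 p : (0 <= D p)%R. Proof. exact: normr_ge0. Qed.

Let mnspeed : measurable_fun setT (nspeed n alpha).
Proof. by rewrite /nspeed; meas; exact: measurable_speed. Qed.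

Let mS : measurable_fun setT S.
Proof. by apply: (measurableT_comp mnspeed); meas. Qed.

Let mG : measurable_fun setT G.
Proof. by apply: measurable_gsqrt; meas. Qed.

Let mD : measurable_fun setT D. Proof. exact: measurable_dist. Qed.

Let II (f : R * R -> R) : \bar R := \int[mu]_(s in I) \int[mu]_(v in I) (f (s, v))%:E.

Let II_ge0 f : (forall p, (0 <= f p)%R) -> 0 <= II f.
Proof.
by move=> f0; apply: integral_ge0 => s _; apply: integral_ge0 => v _; rewrite lee_fin.
Qed.

Let II_D : II D = \int[mu]_(s in I) (mean_dist alpha n s)%:E.
Proof. by apply: eq_integral => s _; rewrite mean_distE. Qed.

Let II_Doo : II D < +oo.
Proof.
apply: (@le_lt_trans _ _ (\int[mu]_(s in I) (@dist_bound R)%:E)).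
  apply: ge0_le_integral_nomeas => s _.
    by apply: integral_ge0 => v _; rewrite lee_fin.
  exact: integral_dist_le.
by rewrite integral_cst_2pi ltry.
Qed.

Let II_GE : II G = \int[mu]_(s in I) \int[mu]_(u in I) (gsqrt alpha (n%:R * alpha) s u)%:E.
Proof.
apply: eq_integral => s _; rewrite /G/=; under eq_integral do rewrite addrC.
exact: integral_gsqrt_shift.
Qed.

Let II_Goo : II G < +oo.
Proof.
rewrite II_GE; apply: (@le_lt_trans _ _ (\int[mu]_(s in I) (4 * pi)%:E)).
  apply: ge0_le_integral_nomeas => s _; last exact: integral_gsqrt_le.
  by apply: integral_ge0 => v _; rewrite lee_fin gsqrt_ge0.
by rewrite integral_cst_2pi ltry.
Qed.

Let II_S : II S = (2 * pi)%:E * \int[mu]_(s in I) (nspeed n alpha s)%:E.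
Proof.
exact: (@double_integral_shift (nspeed n alpha) n%:R^-1 mnspeed nspeed_ge0 nspeed_2pi).
Qed.

(** [II S] is 2 pi times the integral of the normalized speed, and [II G] is the double integral in
    [ell], since v -> n s + v is a shift over one period; they differ by at most [II D], the
    integral of [mean_dist]. *)
Lemma speed_ell_le :
  `| (\int[mu]_(t in I) (speed n alpha t / pi)%:E) * (n%:R^-1)%:E
     - ell alpha (mod_pi (n%:R * alpha)) | <=
  (4 * pi ^+ 2)^-1%:E * \int[mu]_(s in I) (mean_dist alpha n s)%:E.
Proof.
have p0 := @pi_gt0 R.
have c0 : (0 < (4 * pi ^+ 2)^-1 :> R)%R by rewrite invr_gt0 mulr_gt0 ?exprn_gt0.
have -> : ell alpha (mod_pi (n%:R * alpha)) = (4 * pi ^+ 2)^-1%:E * II G.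
  by rewrite ell_mod_pi ellE II_GE.
have -> : (\int[mu]_(t in I) (speed n alpha t / pi)%:E) * (n%:R^-1)%:E =
    (4 * pi ^+ 2)^-1%:E * II S.
  (* The constants match: speed / pi = n nspeed / (2 pi), and (1 / n) (n / (2 pi)) = 2 pi / (4
     pi^2). *)
  have e : \int[mu]_(t in I) (speed n alpha t / pi)%:E =
      (n%:R / (2 * pi))%:E * \int[mu]_(t in I) (nspeed n alpha t)%:E.
    have k0 : (0 <= n%:R / (2 * pi) :> R)%R by exact: divr_ge0 (ler0n _ _) (mulr_ge0 (ler0n _ _) (ltW p0)).
    rewrite -(integral_scale mnspeed nspeed_ge0 k0).
    apply: eq_integral => t _; congr EFin.
    rewrite /nspeed; move: (pi : R) p0 (speed _ _ _) => p p0' y.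
    by field; rewrite !gt_eqF.
  rewrite e II_S muleAC -EFinM muleA -EFinM; apply: (congr1 (fun x => x%:E * _)).
  by move: (pi : R) p0 => p p0'; field; rewrite !gt_eqF.
have SGD p : (S p <= G p + D p)%R.
  by have := ler_norm (S p - G p)%R; rewrite -[D p]/(`|S p - G p|)%R; lra.
have GSD p : (G p <= S p + D p)%R.
  by have := ler_norm (G p - S p)%R; rewrite -[D p]/(`|S p - G p|)%R distrC; lra.
have mI : measurable I by [].
rewrite -II_D; apply: (abse_scale_sub_le (ltW c0) (II_ge0 S0) (II_ge0 G0) II_Goo (II_ge0 D0) II_Doo).
  exact: (double_integral_le mI mI mG mD S0 G0 D0 SGD).
exact: (double_integral_le mI mI mS mD G0 S0 D0 GSD).
Qed.

End comparison.

Unset Implicit Arguments.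

Theorem theorem1p1 (d : measure_display) (Omega : measurableType d)
  (R : realType) (P : probability Omega R)
  (alpha : R) (halpha : 0 <= alpha)
  (a b : nat -> {RV P >-> R})
  (gauss_a : gaussian_process a) (gauss_b : gaussian_process b)
  (centered_a : centered a) (centered_b : centered b)
  (stat_a : stationary a) (stat_b : stationary b)
  (indep_ab : independent_processes a b)
  (cov_a : forall k l : nat, (1 <= k)%N -> (1 <= l)%N ->
     ('E_P[(a k \* a l)%R] = (cos ((k%:R - l%:R) * alpha))%:E)%E)
  (cov_b : forall k l : nat, (1 <= k)%N -> (1 <= l)%N ->
     ('E_P[(b k \* b l)%R] = (cos ((k%:R - l%:R) * alpha))%:E)%E)
  (cov_ab : forall k l : nat, (1 <= k)%N -> (1 <= l)%N ->
     ('E_P[(a k \* b l)%R] = 0)%E)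
  (beta : R) (hbeta : 0 < beta < 1) :
  exists h1 h2 : nat -> R^o,
    [/\ h1 =O_ (within (admissible alpha) \oo)
          (fun n => (n%:R `^ beta * (1 - `|cos (n%:R * alpha)|) ^+ 2)^-1 : R^o),
        h2 =o_ (within (admissible alpha) \oo) (fun=> 1 : R^o)
      & \forall n \near within (admissible alpha) \oo,
          `| (\int[P]_w num_zeros (trig_poly a b n w) `[0%R, (2 * pi)%R])
               * (n%:R^-1)%:E
             - ell alpha (mod_pi (n%:R * alpha)) |%E
          = (h1 n + h2 n)%:E].
Proof.
pose err n : \bar R := (`| (\int[P]_w num_zeros (trig_poly a b n w) `[0%R, (2 * pi)%R])
  * (n%:R^-1)%:E - ell alpha (mod_pi (n%:R * alpha)) |)%E.
pose D n : \bar R := (\int[lebesgue_measure]_(s in `[0%R, (2 * pi)%R]) (mean_dist alpha n s)%:E)%E.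
pose c : R := (4 * pi ^+ 2)^-1.
have c0 : 0 < c by rewrite invr_gt0 mulr_gt0 ?exprn_gt0 ?pi_gt0.
have errD n : admissible alpha n -> (err n <= c%:E * D n)%E.
  move=> adm; rewrite /err (expected_num_zeros_trig_poly gauss_a gauss_b centered_a centered_b
    indep_ab cov_a cov_b (admissible_cos adm)).
  exact: speed_ell_le.
have cD : (c%:E * D n)%E @[n --> \oo] --> (0 : \bar R)%E.
  rewrite -[X in _ --> X](mule0 c%:E); apply: cvgeZl => //.
  exact: cvg_integral_mean_dist.
have small (e : R) : 0 < e -> \forall n \near \oo, (c%:E * D n < e%:E)%E.
  move/fine_cvgP : cD => [cfin cfine] e0.
  have fe : \forall n \near \oo, fine (c%:E * D n)%E < e.
    by apply: (@cvgr_lt R _ _ _ _ _ cfine).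
  by apply: filterS2 cfin fe => n /fineK <-; rewrite lte_fin.
(* The required equality is between extended reals, so [fine (err n)] can serve as h2 only where
   [err n] is finite, which the bound ensures for large [n]. *)
have errfin n (e : R) : admissible alpha n -> (c%:E * D n < e%:E)%E -> err n \is a fin_num.
  move=> adm De; rewrite ge0_fin_numE ?abse_ge0//.
  by apply: le_lt_trans (errD n adm) (lt_trans De (ltry _)).
exists (fun=> 0), (fun n => fine (err n)); split.
- apply/eqOP; near=> k; apply: nearW => n; rewrite normr0.
  by rewrite mulr_ge0.
- apply/eqoP => e e0; rewrite near_withinE; have := small _ e0.
  apply: filterS => n Dn adm.
  rewrite normr1 mulr1 ger0_norm ?fine_ge0 ?abse_ge0//.
  rewrite -lee_fin fineK ?(errfin n e)//.
  exact/ltW/(le_lt_trans (errD n adm)).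
- rewrite near_withinE; have := small _ ltr01; apply: filterS => n Dn adm.
  by rewrite add0r fineK ?(errfin n 1).
Unshelve. all: by end_near. Qed.
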